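(* Let $\Gamma$ be a leafless metric graph of genus $g \ge 2$. Then \[ \# \operatorname{Aut}(\Gamma) \le \begin{cases}2^g g! & \text{if } g \ge 3,\\ 12 & \text{if } g = 2.\end{cases} \] Furthermore, the inequality becomes an equality if and only if $\Gamma$ is one of the following: \begin{itemize} \item $\Gamma$ is defined by the pair of $G_{\mathrm{banana}, g}$ and some length function $l$ whose image is one point, with $g \in \{2, 3\}$. \item $\Gamma$ is defined by the pair of $G_{\mathrm{bouquet}, g}$ and some length function $l$ whose image is one point, with $g \ge 3$. \item $\Gamma$ is defined by the pair of $G_{\mathrm{lollipop}, g}$ and some length function $l$ such that all $g$ loops have the same length and all $g$ bridges have the same length, with $g \ge 3$. \end{itemize}
   Context: A metric graph $\Gamma$ is the underlying metric space (with the path metric) of a pair $(G,l)$, where $G$ is an unweighted, undirected, finite, connected, nonempty multigraph, possibly with loops, with vertex set $V_G$ and edge set $E_G$, and $l : E_G \to \mathbb{R}_{>0}$ is a length function; each edge $e$ is identified with the closed interval $[0,l(e)]$, and these intervals are glued at their endpoints according to the incidence relations of $G$. We say that $\Gamma$ is defined by the pair $(G,l)$. Different pairs may define the same (isometric) metric graph; metric graphs are considered up to isometry. The genus of $\Gamma$ is its genus in the usual topological sense (its first Betti number); it equals $\# E_G - \# V_G + 1$ for any pair $(G,l)$ defining $\Gamma$. The valency of a point $x \in \Gamma$ is the number of connected components of $U \setminus \{x\}$ for any sufficiently small connected neighborhood $U$ of $x$. $\Gamma$ is leafless if it has no points of valency one. $\operatorname{Aut}(\Gamma)$ is the automorphism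 group of $\Gamma$, which is the group of isometries $\Gamma \to \Gamma$. $G_{\mathrm{banana}, g}$ ($g \ge 1$) is the multigraph with exactly two vertices and $g+1$ multiple edges between them (and no other edges). $G_{\mathrm{bouquet}, g}$ ($g \ge 1$) is the graph with exactly one vertex and $g$ loops incident to it. $G_{\mathrm{lollipop}, g}$ ($g \ge 2$) is the graph obtained from $G_{\mathrm{bouquet}, g}$ by replacing the unique vertex with the star $S_g$ with $g$ leaves, i.e. the star with a central vertex joined by one edge (a bridge) to each of $g$ further vertices, with exactly one loop attached at each of these $g$ further vertices. *)

(* Defs.v *)
From HB Require Import structures.
From mathcomp Require Import all_boot all_order all_algebra.
From mathcomp Require Import all_classical all_reals all_analysis.
From mathcomp Require Import lra.

Set Implicit Arguments.
Unset Strict Implicit.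
Unset Printing Implicit Defensive.

Import Order.TTheory GRing.Theory Num.Theory.
Local Open Scope classical_set_scope.
Local Open Scope card_scope.
Local Open Scope ring_scope.

Definition adjacent (V E : finType) (src tgt : E -> V) : rel V :=
  fun u v => [exists e, ((src e == u) && (tgt e == v))
                     || ((src e == v) && (tgt e == u))].

(* An undirected multigraph.  The maps src and tgt orient the edges, but the
   choice of orientation is immaterial: it only says which end of the interval
   [0, l e] is glued to which end of e.  Loops are the edges with
   src e = tgt e. *)
Record multigraph := Multigraph {
  vertex : finType;
  edge : finType;
  src : edge -> vertex;
  tgt : edge -> vertex;
  vertex_nonempty : (0 < #|vertex|)%N;
  vertex_connected : forall u v, connect (adjacent src tgt) u v }.

(* The cellular boundary map from 1-chains to 0-chains over the rationals,
   acting on row vectors. *)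
Definition boundary (G : multigraph) : 'M[rat]_(#|edge G|, #|vertex G|) :=
  \matrix_(i, j) ((tgt (enum_val i) == enum_val j)%:R
                  - (src (enum_val i) == enum_val j)%:R).

(* The first Betti number: there are no 2-cells, so H_1 is the kernel of the
   boundary map.  By genusE below it is #E - #V + 1. *)
Definition genus (G : multigraph) : nat := \rank (kermx (boundary G)).

Section genusE.
Variable G : multigraph.

Lemma coboundaryE (f : 'rV[rat]_#|vertex G|) e : (f *m (boundary G)^T) 0 (enum_rank e) =
  f 0 (enum_rank (tgt e)) - f 0 (enum_rank (src e)).
Proof.
rewrite mxE (eq_bigr (fun j => (if j == enum_rank (tgt e) then f 0 j else 0)
  - (if j == enum_rank (src e) then f 0 j else 0))); last first.
  move=> j _; rewrite !mxE enum_rankK mulrBr.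
  have E (v : vertex G) : (v == enum_val j) = (j == enum_rank v).
    by rewrite -[j in RHS]enum_valK (inj_eq enum_rank_inj) eq_sym.
  by rewrite !E; do 2 case: ifP => _; rewrite ?mulr1 ?mulr0.
by rewrite sumrB -!big_mkcond/= !big_pred1_eq.
Qed.

Lemma coboundary0 (f : 'rV[rat]_#|vertex G|) : f *m (boundary G)^T = 0 ->
  forall u v : vertex G, f 0 (enum_rank u) = f 0 (enum_rank v).
Proof.
move=> fB0; have fe e : f 0 (enum_rank (src e)) = f 0 (enum_rank (tgt e)).
  by have := coboundaryE f e; rewrite fB0 mxE => /esym/eqP; rewrite subr_eq0 => /eqP.
move=> u v; have /connectP[p + ->] := vertex_connected u v.
elim: p u => //= w p IH u /andP[/existsP[e uew] wp]; rewrite -(IH w wp).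
by case/orP: uew => /andP[/eqP <- /eqP <-].
Qed.

Lemma genusE : (genus G + #|vertex G| = #|edge G| + 1)%N.
Proof.
have /card_gt0P[v0 _] := vertex_nonempty G.
have keq : (kermx (boundary G)^T :=: (const_mx 1 : 'rV[rat]_#|vertex G|))%MS.
  apply/eqmxP/andP; split; last first.
    apply/sub_kermxP/matrixP => i j.
    by rewrite ord1 -(enum_valK j) coboundaryE !mxE subrr.
  apply/row_subP => i; set f := row i _.
  have fB0 : f *m (boundary G)^T = 0 by apply/sub_kermxP; exact: row_sub.
  apply/sub_rVP; exists (f 0 (enum_rank v0)); apply/rowP => j.
  by rewrite -(enum_valK j) (coboundary0 fB0 _ v0) !mxE mulr1.
have := mxrank_ker (boundary G)^T; rewrite keq mxrank_tr rank_rV.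
have -> : (const_mx 1 : 'rV[rat]_#|vertex G|) != 0.
  by apply/eqP => /rowP/(_ (enum_rank v0)); rewrite !mxE => /eqP; rewrite oner_eq0.
rewrite /genus mxrank_ker /= => rkE.
have := rank_leq_row (boundary G); have := rank_leq_col (boundary G).
move: rkE; set r := \rank _ => h1 h2 h3.
by rewrite -{1}(subnK h2) -h1 addnCA subnK// addn1.
Qed.

End genusE.

Record length_function (R : realType) (G : multigraph) := LengthFunction {
  length_of :> edge G -> R;
  length_gt0 : forall e, 0 < length_of e }.

Section MetricGraph.
Variables (R : realType) (G : multigraph) (l : length_function R G).

(* The points of the space obtained from the intervals [0, l e] by gluing their
   ends: every class of glued points is either a vertex or a single interior
   point of one interval. *)
Inductive metric_graph : Type :=
| Vertex of vertex G
| Interior (e : edge G) of {t : R | 0 < t < l e}.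

HB.instance Definition _ := gen_eqMixin metric_graph.
HB.instance Definition _ := gen_choiceMixin metric_graph.

(* The image of the point t of [0, l e]; a junk value if t lies outside. *)
Definition edge_point (e : edge G) (t : R) : metric_graph :=
  if insub t is Some s then @Interior e s
  else Vertex (if t <= 0 then src e else tgt e).

(* route x y L: there is a path from x to y of length L that is a finite
   concatenation of segments, each lying in one edge. *)
Inductive route : metric_graph -> metric_graph -> R -> Prop :=
| route_nil x : route x x 0
| route_cons e s t y L : 0 <= s <= l e -> 0 <= t <= l e ->
    route (edge_point e t) y L -> route (edge_point e s) y (`|s - t| + L).

Definition path_dist (x y : metric_graph) : R := inf [set L | route x y L].

Lemma route1 e s t : 0 <= s <= l e -> 0 <= t <= l e ->
  route (edge_point e s) (edge_point e t) `|s - t|.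
Proof.
by move=> se te; rewrite -[`|_|]addr0; apply: route_cons => //; exact: route_nil.
Qed.

Lemma edge_point_src e : edge_point e 0 = Vertex (src e).
Proof. by rewrite /edge_point insubF ?ltxx// lexx. Qed.

Lemma edge_point_tgt e : edge_point e (l e) = Vertex (tgt e).
Proof. by rewrite /edge_point insubF ?ltxx ?andbF// leNgt length_gt0. Qed.

Lemma edge_point_int e (s : {t : R | 0 < t < l e}) : edge_point e (sval s) = Interior s.
Proof. by rewrite /edge_point valK. Qed.

Lemma endpt0 e : 0 <= (0 : R) <= l e.
Proof. by rewrite lexx ltW// length_gt0. Qed.

Lemma endpt1 e : 0 <= l e <= l e.
Proof. by rewrite lexx ltW// length_gt0. Qed.

#[local] Hint Resolve endpt0 endpt1 : core.

Lemma route_trans x y z L M : route x y L -> route y z M -> route x z (L + M).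
Proof.
move=> xy; elim: xy z M => {x y L} [x z M|e s t y L se te _ IH z M yz].
  by rewrite add0r.
by rewrite -addrA; apply: route_cons => //; exact: IH.
Qed.

Lemma route_sym x y L : route x y L -> route y x L.
Proof.
elim => {x y L} [x|e s t y L se te _ ys]; first exact: route_nil.
by rewrite addrC distrC; apply: route_trans ys _; exact: route1.
Qed.

Lemma route_ge0 x y L : route x y L -> 0 <= L.
Proof. by elim => // *; rewrite addr_ge0. Qed.

Lemma route_lip (f : metric_graph -> R) :
  (forall e s t, 0 <= s <= l e -> 0 <= t <= l e ->
    f (edge_point e s) - f (edge_point e t) <= `|s - t|) ->
  forall x y L, route x y L -> f x - f y <= L.
Proof.
move=> lipf x y L; elim => {x y L} [x|e s t y L se te _ IH].
  by rewrite subrr.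
by have := lipf _ _ _ se te; lra.
Qed.

Lemma route_edge e : exists L, route (Vertex (src e)) (Vertex (tgt e)) L.
Proof.
by exists `|0 - l e|; rewrite -edge_point_src -edge_point_tgt; exact: route1.
Qed.

Lemma route_vertex x : exists v L, route x (Vertex v) L.
Proof.
case: x => [v|e s]; first by exists v, 0; exact: route_nil.
exists (src e), `|sval s - 0|; rewrite -edge_point_int -edge_point_src; apply: route1 => //.
by case: s => /= s /andP[/ltW -> /ltW ->].
Qed.

Lemma route_exists x y : exists L, route x y L.
Proof.
have [u [Lx xu]] := route_vertex x; have [v [Ly yv]] := route_vertex y.
suff [L uv] : exists L, route (Vertex u) (Vertex v) L.
  exists (Lx + (L + Ly)); apply: (route_trans xu).
  by apply: (route_trans uv); exact: route_sym.
have /connectP[p + ->] := vertex_connected u v.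
elim: p u {xu} => /= [u _|w p IH u /andP[/existsP[e uew] /IH[M wp]]].
  by exists 0; exact: route_nil.
have [L uw] : exists L, route (Vertex u) (Vertex w) L.
  have [L st] := route_edge e; exists L.
  by case/orP: uew => /andP[/eqP <- /eqP <-] //; exact: route_sym.
by exists (L + M); exact: route_trans wp.
Qed.

Lemma route_inf x y : has_inf [set L | route x y L].
Proof.
by split; [exact: route_exists|exists 0 => L /= /route_ge0].
Qed.

Lemma path_dist_le x y L : route x y L -> path_dist x y <= L.
Proof. by move=> xy; apply: ge_inf => //; exact: (route_inf x y).2. Qed.

Lemma path_dist_ge x y M : (forall L, route x y L -> M <= L) -> M <= path_dist x y.
Proof. by move=> xyM; apply: lb_le_inf => //; exact: (route_inf x y).1. Qed.

Lemma path_dist_sym x y : path_dist x y = path_dist y x.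
Proof.
by congr inf; apply/seteqP; split => L /=; exact: route_sym.
Qed.

Lemma path_distxx x : path_dist x x = 0.
Proof.
apply/eqP; rewrite eq_le path_dist_le/=; last exact: route_nil.
by apply: path_dist_ge => L /route_ge0.
Qed.

Lemma path_dist_triangle y x z :
  path_dist x z <= path_dist x y + path_dist y z.
Proof.
rewrite -lerBlDr; apply: path_dist_ge => L xy.
rewrite lerBlDr -lerBlDl; apply: path_dist_ge => M yz.
by rewrite lerBlDl; apply: path_dist_le; exact: route_trans yz.
Qed.

Lemma lip_dist (f : metric_graph -> R) :
  (forall e s t, 0 <= s <= l e -> 0 <= t <= l e ->
    f (edge_point e s) - f (edge_point e t) <= `|s - t|) ->
  forall x y, path_dist x y = 0 -> f x <= f y.
Proof.
move=> /route_lip lipf x y xy0; rewrite -subr_le0 -xy0.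
by apply: path_dist_ge => L; exact: lipf.
Qed.

Lemma edge_pointP e s : 0 <= s <= l e ->
  [\/ s = 0 /\ edge_point e s = Vertex (src e),
      s = l e /\ edge_point e s = Vertex (tgt e) |
      exists s' : {t : R | 0 < t < l e}, s = sval s' /\ edge_point e s = Interior s'].
Proof.
move=> /andP[s0 sl]; have [->|sn0] := eqVneq s 0.
  by apply: Or31; rewrite edge_point_src.
have [->|snl] := eqVneq s (l e); first by apply: Or32; rewrite edge_point_tgt.
have s' : 0 < s < l e by rewrite !lt_neqAle s0 sl eq_sym sn0 snl.
by apply: Or33; exists (exist _ s s'); rewrite -edge_point_int.
Qed.

(* The tent of height min s (l e - s) around the interior point s of e. *)
Lemma dist_interior e (s : {t : R | 0 < t < l e}) y :
  path_dist (Interior s) y = 0 -> Interior s = y.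
Proof.
case: s => a a0l; have /andP[a0 al] := a0l.
set r := Num.min a (l e - a).
have r0 : 0 < r by rewrite lt_min a0/= subr_gt0.
have ra : r <= a by rewrite ge_min lexx.
have rl : r <= l e - a by rewrite ge_min lexx orbT.
clearbody r.
pose h (t : R) := Num.max 0 (r - `|t - a|).
pose f x := if x is Interior e' s' then if e' == e then h (sval s') else 0 else 0.
have fE e' t : 0 <= t <= l e' -> f (edge_point e' t) = if e' == e then h t else 0.
  move=> te; have [[-> ->]|[-> ->]|[s' [-> ->]]] := edge_pointP te => //=.
    case: eqP => // _; apply/esym/max_idPl.
    by rewrite sub0r normrN gtr0_norm//; lra.
  case: eqP => // ->; apply/esym/max_idPl.
  by rewrite ger0_norm; lra.
have lipf e' t u : 0 <= t <= l e' -> 0 <= u <= l e' ->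
    f (edge_point e' t) - f (edge_point e' u) <= `|t - u|.
  move=> te ue; rewrite !fE//; case: eqP => _; last by rewrite subrr.
  rewrite /h; have := ler_distD t u a; rewrite (distrC u t).
  by case: (lerP 0 (r - `|t - a|)); case: (lerP 0 (r - `|u - a|));
     have := normr_ge0 (t - u); lra.
move=> /(lip_dist lipf); rewrite /f /= eqxx /h /= subrr normr0 subr0.
rewrite (max_idPr (ltW r0)).
case: y => [v|e' [b be]]; first by rewrite leNgt r0.
case: eqP => [ee|_]; last by rewrite leNgt r0.
subst e' => /=.
rewrite le_max leNgt r0/= lerBrDr gerDl normr_le0 subr_eq0 => /eqP ba.
by congr Interior; exact/val_inj.
Qed.

Lemma path_dist0 x y : path_dist x y = 0 -> x = y.
Proof.
case: x => [u|e s]; last exact: dist_interior.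
case: y => [v|e s]; last by rewrite path_dist_sym => /dist_interior ->.
have [-> //|uv] := eqVneq u v.
pose r := \big[Num.min/1]_e l e.
have r0 : 0 < r by apply: lt_bigmin => // e _; exact: length_gt0.
have rl e : r <= l e by exact: bigmin_le_cond.
clearbody r.
pose h (w : vertex G) : R := if w == u then r else 0.
pose f x := match x with
  | Vertex w => h w
  | Interior e s => h (src e) + (sval s / l e) * (h (tgt e) - h (src e))
  end.
have fE e t : 0 <= t <= l e ->
    f (edge_point e t) = h (src e) + (t / l e) * (h (tgt e) - h (src e)).
  move=> te; have [[-> ->]|[-> ->]|[s' [-> ->]]] := edge_pointP te => //=.
    by rewrite !mul0r addr0.
  by rewrite divff ?gt_eqF ?length_gt0// mul1r addrC subrK.
have lipf e t s : 0 <= t <= l e -> 0 <= s <= l e ->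
    f (edge_point e t) - f (edge_point e s) <= `|t - s|.
  move=> te se; rewrite !fE//.
  rewrite opprD addrACA subrr add0r -mulrBl -mulrBl.
  rewrite (le_trans (ler_norm _))// !normrM -mulrA ler_piMr//.
  rewrite normfV (gtr0_norm (length_gt0 _ _)) mulrC ler_pdivrMr ?length_gt0//.
  rewrite mul1r (le_trans _ (rl e))// /h.
  by do 2 case: eqP => _; rewrite ?subrr ?subr0 ?sub0r ?normrN ?normr0 ?gtr0_norm// ltW.
move=> /(lip_dist lipf); rewrite /f /h eqxx eq_sym (negbTE uv).
by rewrite leNgt r0.
Qed.

HB.instance Definition _ := isMetric.Build R metric_graph
  path_distxx path_dist0 path_dist_sym path_dist_triangle.

End MetricGraph.

Definition is_isometry (R : realType) (X Y : metricType R) (f : X -> Y) : Prop :=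
  bijective f /\ forall x y, mdist (f x) (f y) = mdist x y.

Definition Aut (R : realType) (X : metricType R) : set (X -> X) :=
  [set f | is_isometry f].
Arguments Aut {R} X.

Definition defined_by (R : realType) (X : metricType R) (G : multigraph)
    (l : length_function R G) : Prop :=
  exists f : X -> metric_graph l, is_isometry f.

Definition components (T : topologicalType) (A : set T) : set (set T) :=
  [set connected_component A y | y in A].

(* W quantifies "sufficiently small": every connected neighbourhood U of x
   inside W gives the same count. *)
Definition has_valency (T : topologicalType) (x : T) (k : nat) : Prop :=
  exists2 W : set T, nbhs x W & forall U : set T,
    nbhs x U -> U `<=` W -> connected U -> components (U `\ x) #= `I_k.

Definition leafless (T : topologicalType) : Prop :=
  forall x : T, ~ has_valency x 1.

Section Graphs.
Variable g : nat.

Definition banana_src (_ : 'I_g.+1) := false.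
Definition banana_tgt (_ : 'I_g.+1) := true.

Fact banana_nonempty : (0 < #|{: bool}|)%N.
Proof. by rewrite card_bool. Qed.

Fact banana_connected u v : connect (adjacent banana_src banana_tgt) u v.
Proof.
have [-> //|uv] := eqVneq u v; apply/connect1/existsP; exists ord0.
by move: u v uv => [] [].
Qed.

Definition banana : multigraph :=
  Multigraph banana_nonempty banana_connected.

Definition bouquet_end (_ : 'I_g) := tt.

Fact bouquet_nonempty : (0 < #|{: unit}|)%N.
Proof. by rewrite card_unit. Qed.

Fact bouquet_connected u v : connect (adjacent bouquet_end bouquet_end) u v.
Proof. by case: u; case: v. Qed.

Definition bouquet : multigraph :=
  Multigraph bouquet_nonempty bouquet_connected.

(* None is the centre of the star and Some i is its i-th leaf; the edge inl i
   is the loop at Some i and inr i is the bridge from None to Some i. *)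
Definition lollipop_src (e : 'I_g + 'I_g) : option 'I_g :=
  match e with inl i => Some i | inr _ => None end.
Definition lollipop_tgt (e : 'I_g + 'I_g) : option 'I_g :=
  match e with inl i => Some i | inr i => Some i end.

Fact lollipop_nonempty : (0 < #|{: option 'I_g}|)%N.
Proof. by rewrite card_option. Qed.

Fact lollipop_connected u v : connect (adjacent lollipop_src lollipop_tgt) u v.
Proof.
have c0 w : connect (adjacent lollipop_src lollipop_tgt) w None.
  case: w => [i|//]; apply/connect1/existsP; exists (inr i).
  by apply/orP; right; rewrite /= !eqxx.
have c1 w : connect (adjacent lollipop_src lollipop_tgt) None w.
  case: w => [i|//]; apply/connect1/existsP; exists (inr i).
  by rewrite /= !eqxx.
exact: connect_trans (c0 u) (c1 v).
Qed.

Definition lollipop : multigraph :=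
  Multigraph lollipop_nonempty lollipop_connected.

End Graphs.

Definition aut_bound (g : nat) : nat :=
  if (3 <= g)%N then (2 ^ g * g`!)%N else 12%N.

(* Main.v *)
Require Import Defs.
From mathcomp Require Import all_boot all_order all_algebra.
From mathcomp Require Import fingroup perm morphism action zify.

Set Implicit Arguments.
Unset Strict Implicit.
Unset Printing Implicit Defensive.

(** Smoothing the vertices of degree two puts the graph in stable form: all
    degrees are at least three. In that form vertices and darts (oriented edges)
    can be recognised by small spheres, so that an isometry is the same thing as a
    permutation of the darts that commutes with reversal, respects origins and
    preserves lengths ([card_Aut]). The statement is then about the order of such
    a permutation group [A]. Write [f k = 2 ^ k * k!], which is [hyperoct k].

    The main tool is [pointed_bound]. Suppose that a group fixes a vertex [w] of a
    connected graph of genus [c], and that the vertices it moves have degree at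
    least three. Sort the darts by distance to [w]. Going down from the farthest
    vertices, one sees that an element is determined by what it does to the
    horizontal edges and to the bundles of two or more darts that go from one
    vertex back towards [w]. These blocks of darts are permuted among themselves,
    and the sum of their sizes, each diminished by one, is [c]. A group that
    permutes such blocks acts on them in at most [f c] ways
    ([index_stab_blocks]).

    The bound on [A] follows in three cases, without induction on the graph.

    - There are [q > 0] loops. They are permuted in at most [f q] ways, and the
      group that fixes them acts on the rest, a graph of genus [g - q] pointed at
      a loop. So the order is at most [f q * f (g - q) = f g / 'C(g, q)]. In the
      case of equality every cycle is a loop, and [A] realises all permutations
      and flips of the loops, in particular it is doubly transitive on them. The
      bridges form a tree, and the sum of [deg v - 2] over a tree is [- 2]. This
      leaves the bouquet and the lollipop ([bouquet_or_injective],
      [lollipop_structure]).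

    - There is no loop, but a vertex [u] cuts off a piece. Take a piece with the
      fewest vertices. Its translates are disjoint, so there are at most
      [2 * g - 3] of them, and its stabiliser has order at most [f h * f (g - h)]
      with [h] and [g - h] at least two. The product is less than [f g]
      ([piece_strict]).

    - There is no loop and no cut vertex. Let [u] have the least degree [k]. Its
      orbit has at most [#|V|] elements, its darts are permuted in at most [k!]
      ways, and the group that fixes them acts on the complement of [u], which is
      connected of genus [g + 1 - k]. As [#|V| * (k - 2) <= 2 * (g - 1)], the order
      is less than [f g] unless there are just two vertices ([nopiece_bound]; cubic
      graphs with four vertices need a closer look, [four_vertices_strict]). Two
      vertices make a banana, of order at most [2 * (g + 1)!], which is less than
      [f g] for [g >= 4], equal to it for [g = 3] and equal to 12 for [g = 2].

    In the extremal cases the transitivity obtained along the way makes all edges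
    of the same kind equally long. Conversely the model graphs have visibly
    enough automorphisms. *)

(** * The numbers 2^k k! *)

(** The order of the hyperoctahedral group, the signed permutations of [k] objects. *)
Definition hyperoct k := (2 ^ k * k`!)%N.

Lemma hyperoct_gt0 a : (0 < hyperoct a)%N.
Proof. by rewrite muln_gt0 expn_gt0 fact_gt0. Qed.

Lemma hyperoct_mono a c : (a <= c)%N -> (hyperoct a <= hyperoct c)%N.
Proof. by move=> ac; rewrite leq_mul ?leq_pexp2l// leq_fact. Qed.

Lemma succ_leq_exp2 a : (a < 2 ^ a)%N.
Proof. exact: ltn_expl. Qed.

Lemma succ_leq_bin a c : (0 < a)%N -> (c < 'C(a + c, a))%N.
Proof.
move=> a0; rewrite -bin_sub ?leq_addr// addKn -[X in (X <= _)%N]binSn.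
by apply: leq_bin2l; lia.
Qed.

Lemma leq_bin_mid a c : (0 < a)%N -> (0 < c)%N -> (a + c <= 'C(a + c, a))%N.
Proof.
move=> a0 c0; rewrite -[X in (X <= _)%N]bin1.
elim: a a0 => // a IH _; have [->|a1] := posnP a; first by rewrite add1n.
have := IH a1; rewrite !bin1 addSn binS => le.
have : (0 < 'C(a + c, a.+1))%N by rewrite bin_gt0; lia.
lia.
Qed.

Lemma bin2_double n : ('C(n, 2)).*2 = (n * n.-1)%N.
Proof. by elim: n => // n; rewrite binS bin1; case: n => // n; nia. Qed.

(** The left side bounds the number of translates of a piece with the fewest
    vertices, see [piece_strict]. *)
Lemma bin_mid_gt a c : (1 < a)%N -> (1 < c)%N -> ((a + c).*2 - 3 < 'C(a + c, a))%N.
Proof.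
move=> a1 c1; elim: a a1 => // a IH a1'; have [a1|a1] := leqP a 1.
  have -> : a = 1%N by lia.
  have := bin2_double (2 + c); rewrite addnC; nia.
have lt := IH a1; rewrite addSn binS.
have : (a + c <= 'C(a + c, a.+1))%N.
  have -> : (a + c = a.+1 + c.-1)%N by lia.
  by apply: leq_bin_mid; lia.
lia.
Qed.

Lemma hyperoctD a c : (hyperoct (a + c) = 'C(a + c, a) * (hyperoct a * hyperoct c))%N.
Proof.
rewrite /hyperoct -(bin_fact (leq_addr c a)) addKn expnD; lia.
Qed.

Lemma hyperoct_strict a c : (0 < a)%N -> (0 < c)%N -> (2 < a + c)%N ->
  (hyperoct a * hyperoct c < hyperoct (a + c))%N.
Proof.
move=> a0 c0 ac; rewrite hyperoctD ltn_Pmull//.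
  by have := leq_bin_mid a0 c0; lia.
by have := hyperoct_gt0 a; have := hyperoct_gt0 c; nia.
Qed.

Lemma hyperoct_le a c : (hyperoct a * hyperoct c <= hyperoct (a + c))%N.
Proof. by rewrite hyperoctD leq_pmull// bin_gt0 leq_addr. Qed.

(** The step of the induction in [index_stab_blocks]: [p] blocks, a largest one of
    size [a + 1], and the rest with excess [c]. *)
Lemma block_bound p a c : (0 < a)%N -> (p <= c.+1)%N ->
  (p * a.+1`! * hyperoct c <= hyperoct (a + c))%N.
Proof.
move=> a0 pc; rewrite hyperoctD [leqRHS]mulnA leq_mul// leq_mul//.
  by apply: leq_trans pc _; exact: succ_leq_bin.
by rewrite factS leq_mul// succ_leq_exp2.
Qed.

Lemma banana_order_lt k : (4 <= k)%N -> (2 * k.+1`! < hyperoct k)%N.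
Proof.
move=> k4; rewrite /hyperoct factS mulnA ltn_pmul2r ?fact_gt0//.
elim: k k4 => // k IH k4; have [k3|k3] := leqP k 3.
  by have -> : k = 3 by lia.
by have := IH k3; rewrite expnS; lia.
Qed.

(** * Counting permutations by stabilisers *)

Local Open Scope group_scope.

Section Stabilisers.
Variable T : finType.
Implicit Types (H K : {group {perm T}}) (Y Z : {set T}) (s : {perm T}).

Lemma in_stabP H Y s :
  reflect (s \in H /\ forall y, y \in Y -> s y = y) (s \in 'C_H(Y | 'P)).
Proof.
rewrite inE; apply: (iffP andP) => -[sH sY]; split=> //.
  by move=> y /(astabP sY).
by apply/astabP => y /sY.
Qed.

Lemma stab_eq H K Y Z : K \subset H ->
  (forall s, s \in H -> (s \in K /\ {in Y, forall y, s y = y}) <->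
                        {in Z, forall y, s y = y}) ->
  'C_K(Y | 'P) = 'C_H(Z | 'P).
Proof.
move=> /subsetP KH E; apply/setP => s; apply/in_stabP/in_stabP.
  by move=> [sK sY]; split; [exact: KH | apply/E; [exact: KH|]].
by move=> [sH sZ]; have [sK sY] := (E s sH).2 sZ.
Qed.

Lemma stab_set0 H : 'C_H(set0 | 'P) = H :> {set _}.
Proof.
by apply/setP => s; apply/in_stabP/idP => [[]//|sH]; split=> // y; rewrite inE.
Qed.

Lemma card_orbit_perm H x : #|orbit 'P H x| = #|H : 'C_H([set x] | 'P)|.
Proof. by rewrite card_orbit. Qed.

Lemma orbit_sub H x Y : (forall s, s \in H -> s x \in Y) -> orbit 'P H x \subset Y.
Proof. by move=> HY; apply/subsetP => _ /orbitP[s /HY + <-]. Qed.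

Lemma index_stab_trans H K Y Z : K \subset H ->
  'C_K(Y | 'P) = 'C_H(Z | 'P) ->
  #|H : 'C_H(Z | 'P)| = (#|H : K| * #|K : 'C_K(Y | 'P)|)%N.
Proof. by move=> KH <-; rewrite Lagrange_index// subsetIl. Qed.

(** [H] acts on [Y] through a group of permutations of [Y]. The index is counted by
    fixing one point at a time, a form that [full_index_perm] can reverse. *)
Lemma index_stab_perm H Y : (forall s y, s \in H -> y \in Y -> s y \in Y) ->
  (#|H : 'C_H(Y | 'P)| <= #|Y|`!)%N.
Proof.
move: {2}#|Y| (leqnn #|Y|) => n; elim: n H Y => [|n IH] H Y.
  rewrite leqn0 cards_eq0 => /eqP -> _.
  by rewrite stab_set0 indexgg fact_gt0.
move=> Yn HY; have [->|[y yY]] := set_0Vmem Y.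
  by rewrite stab_set0 indexgg fact_gt0.
pose K := 'C_H([set y] | 'P)%G.
have KP s : s \in K -> s \in H /\ s y = y.
  by move=> /in_stabP[sH sy]; split => //; apply: sy; rewrite inE.
have cY : #|Y| = #|Y :\ y|.+1 by rewrite (cardsD1 y) yY.
have KY : 'C_K(Y :\ y | 'P) = 'C_H(Y | 'P).
  apply: stab_eq => [|s sH]; first exact: subsetIl.
  split=> [[/KP[_ sy] sY] z zY|sY].
    by have [->//|zy] := eqVneq z y; apply: sY; rewrite !inE zy.
  split; last by move=> z; rewrite !inE => /andP[_ /sY].
  by apply/in_stabP; split=> // z; rewrite inE => /eqP ->; exact: sY.
rewrite (index_stab_trans _ KY) ?subsetIl// cY factS leq_mul//.
  rewrite -card_orbit_perm -cY subset_leq_card//; apply: orbit_sub => s sH.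
  exact: HY.
apply: IH; first by rewrite -ltnS -cY.
move=> s z /KP[sH sy]; rewrite !inE => /andP[zy zY].
by rewrite HY// andbT -sy (inj_eq perm_inj).
Qed.

End Stabilisers.

Section Blocks.
Variables (T K : finType) (key : T -> K).
Implicit Types (H : {group {perm T}}) (Z : {set T}).

Definition fibre Z k := [set y in Z | key y == k].

Lemma card_fibres Z : #|Z| = (\sum_(k in key @: Z) #|fibre Z k|)%N.
Proof.
rewrite -sum1_card (partition_big_imset key); apply: eq_bigr => k _.
by rewrite -sum1_card; apply: eq_bigl => y; rewrite !inE.
Qed.

(** The fibres of [key] are the blocks. If they all have two elements this is the
    order of a hyperoctahedral group; larger blocks leave less freedom for the
    same excess [c]. *)
Lemma index_stab_blocks H Z c :
  (forall s z, s \in H -> z \in Z -> s z \in Z) ->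
  (forall s y z, s \in H -> y \in Z -> z \in Z ->
    (key (s y) == key (s z)) = (key y == key z)) ->
  (forall z, z \in Z -> 1 < #|fibre Z (key z)|)%N ->
  #|Z| = (c + #|key @: Z|)%N ->
  (#|H : 'C_H(Z | 'P)| <= hyperoct c)%N.
Proof.
move: {2}#|Z| (leqnn #|Z|) => n; elim: n H Z c => [|n IH] H Z c.
  rewrite leqn0 cards_eq0 => /eqP -> *.
  by rewrite stab_set0 indexgg hyperoct_gt0.
move=> Zn HZ Hkey fib2 cZ; have [->|[z0 z0Z]] := set_0Vmem Z.
  by rewrite stab_set0 indexgg hyperoct_gt0.
have [z zZ0 zmax] := arg_maxnP (fun z => #|fibre Z (key z)|) z0Z.
have zZ : z \in Z by exact: zZ0.
set B := fibre Z (key z) in zmax.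
have zB : z \in B by rewrite inE zZ eqxx.
have BZ : B \subset Z by apply/subsetP => y; rewrite inE => /andP[].
(* fix z first, then the rest of its block B; as B is a largest block, the orbit
   of z has at most #|key @: Z| * #|B| elements *)
pose H1 := 'C_H([set z] | 'P)%G.
have H1P s : s \in H1 -> s \in H /\ s z = z.
  by move=> /in_stabP[sH sz]; split => //; apply: sz; rewrite inE.
pose H2 := 'C_H1(B :\ z | 'P)%G.
have H2P s : s \in H2 -> s \in H /\ {in B, forall y, s y = y}.
  move=> /in_stabP[/H1P[sH sz] sB]; split => // y yB.
  by have [->//|yz] := eqVneq y z; apply: sB; rewrite in_setD1 yz.
have H2H : H2 \subset H by apply/subsetP => s /H2P[].
have E : 'C_H2(Z :\: B | 'P) = 'C_H(Z | 'P).
  apply: stab_eq => // s sH.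
  split=> [[/H2P[_ sB] sZ] y yZ|sZ].
    by have [/sB//|yB] := boolP (y \in B); apply: sZ; rewrite inE yB.
  split; last by move=> y; rewrite inE => /andP[_ /sZ].
  apply/in_stabP; split; last first.
    by move=> y; rewrite inE => /andP[_ /(subsetP BZ)/sZ].
  by apply/in_stabP; split=> // y; rewrite inE => /eqP ->; exact: sZ.
have fibD y : y \in Z :\: B -> fibre (Z :\: B) (key y) = fibre Z (key y).
  rewrite !inE => /andP[yB yZ]; move: yB; rewrite yZ/= => yz.
  apply/setP => x; rewrite !inE; case: (key x =P key y) => [->|_]; rewrite ?andbF// !andbT.
  by rewrite (negbTE yz) andbF.
have keyD : key @: (Z :\: B) = (key @: Z) :\ key z.
  apply/setP => k; rewrite !inE; apply/imsetP/andP => [[y + ->]|[kz /imsetP[y yZ ky]]].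
    by rewrite !inE => /andP[+ yZ]; rewrite yZ/= => yz; rewrite yz imset_f.
  by exists y; rewrite // !inE yZ -ky kz.
have kZ : key z \in key @: Z by rewrite imset_f.
have cB := fib2 _ zZ; rewrite -/B in cB.
have cZB : (#|Z :\: B| + #|B| = #|Z|)%N by rewrite -(cardsID B Z) (setIidPr BZ) addnC.
have ckD : (#|key @: (Z :\: B)|.+1 = #|key @: Z|)%N.
  by rewrite keyD [RHS](cardsD1 (key z)) kZ.
have le_keys : (#|key @: (Z :\: B)| * 2 <= #|Z :\: B|)%N.
  rewrite card_fibres -sum_nat_const leq_sum// => _ /imsetP[y yZ ->].
  by rewrite fibD// fib2//; move: yZ; rewrite inE => /andP[].
have le_Z : (#|Z| <= #|key @: Z| * #|B|)%N.
  rewrite card_fibres -sum_nat_const leq_sum// => _ /imsetP[y yZ ->].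
  exact: zmax.
rewrite (index_stab_trans H2H E).
pose c' := (c - #|B|.-1)%N.
have cc' : c = (#|B|.-1 + c')%N by rewrite /c'; lia.
have le2 : (#|H2 : 'C_H2(Z :\: B | 'P)| <= hyperoct c')%N.
  apply: IH.
  - lia.
  - move=> s y /H2P[sH sB]; rewrite !inE => /andP[yB yZ].
    move: yB; rewrite yZ HZ//= andbT => yz.
    by rewrite -{1}(sB _ zB) Hkey.
  - move=> s x y /H2P[sH sB]; rewrite !inE => /andP[_ xZ] /andP[_ yZ].
    exact: Hkey.
  - move=> y yZB; rewrite fibD// fib2//.
    by move: yZB; rewrite inE => /andP[].
  - lia.
have le1 : (#|H : H2| <= #|key @: Z| * #|B|`!)%N.
  rewrite -(@Lagrange_index _ H H1) ?subsetIl//.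
  have -> : #|B| = #|B|.-1.+1 by lia.
  rewrite factS mulnA leq_mul//.
    rewrite -card_orbit_perm; apply: leq_trans (subset_leq_card _) _.
      by apply: orbit_sub => s sH; exact: HZ.
    by rewrite prednK//; lia.
  have -> : #|B|.-1 = #|B :\ z| by rewrite [in LHS](cardsD1 z) zB.
  apply: index_stab_perm => s y /H1P[sH sz]; rewrite !inE => /and3P[yz yZ kyz].
  by rewrite HZ//= -{1 2}sz (inj_eq perm_inj) yz Hkey.
apply: leq_trans (leq_mul le1 le2) _.
rewrite cc' -{1}(@prednK #|B|); last by lia.
by apply: block_bound; lia.
Qed.

End Blocks.

(** * Darts, and distance from a vertex *)

Section Darts.
Variables (V E : finType) (src tgt : E -> V).

(** The dart [(e, false)] is [e] with its given orientation, [(e, true)] is [e]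
    reversed. *)
Definition dart : finType := (E * bool)%type.
Implicit Types (d : dart) (F : {set E}) (w : V).

Definition rev d : dart := (d.1, ~~ d.2).
Definition org d : V := if d.2 then tgt d.1 else src d.1.

Lemma revK : involutive rev.
Proof. by move=> [e b]; rewrite /rev/= negbK. Qed.

Lemma rev_neq d : rev d != d.
Proof. by case: d => e []; rewrite /rev xpair_eqE andbF. Qed.

Lemma same_edge d d' : d.1 = d'.1 -> d' = d \/ d' = rev d.
Proof. by case: d d' => [e []] [e' []] /= <-; [left|right|right|left]. Qed.

(** The least fixed point of this operator is the set of vertices that can be
    reached from [w], and its iterates are the balls around [w]. *)
Definition reach F w (X : {set V}) : {set V} :=
  [set x | [|| x == w, x \in X |
    [exists d : dart, [&& d.1 \in F, org d \in X & org (rev d) == x]]]].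

Lemma reach_mono F w : {homo reach F w : X Y / X \subset Y}.
Proof.
move=> X Y /subsetP XY; apply/subsetP => x; rewrite !inE.
case/or3P => [->//|/XY ->|/existsP[d /and3P[dF /XY dY dx]]]; first by rewrite orbT.
by apply/orP; right; apply/orP; right; apply/existsP; exists d; rewrite dF dY.
Qed.

(** One more than the distance from [w] along the edges of [F]; 0 on the
    vertices that cannot be reached. *)
Definition level F w := fix_order (reach F w).

Lemma fix_order_ext (f : {set V} -> {set V}) x y : {homo f : X Y / X \subset Y} ->
  (forall k, (x \in iter k f set0) -> (y \in iter k f set0)) ->
  x \in fixset f -> (fix_order f y <= fix_order f x)%N.
Proof.
by move=> mf xy xf; apply: fix_order_small => //; apply: xy; rewrite in_iter_fix_orderE.
Qed.

Section Level.
Variables (F : {set E}) (w : V).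

Lemma level_gt0E x : (0 < level F w x)%N = (x \in fixset (reach F w)).
Proof. by rewrite fix_order_gt0//; exact: reach_mono. Qed.

Lemma level_root : level F w w = 1%N.
Proof.
have w1 : w \in iter 1 (reach F w) set0 by rewrite !inE eqxx.
have := w1; rewrite in_iter_fixE; last exact: reach_mono.
by rewrite -/(level F w w); lia.
Qed.

Lemma level_step d : d.1 \in F -> (0 < level F w (org d))%N ->
  (0 < level F w (org (rev d)) <= (level F w (org d)).+1)%N.
Proof.
move=> dF d0; rewrite -in_iter_fixE; last exact: reach_mono.
rewrite iterS inE; apply/orP; right; apply/orP; right.
apply/existsP; exists d; rewrite dF eqxx andbT/=.
by rewrite in_iter_fix_orderE -?level_gt0E//; exact: reach_mono.
Qed.

Lemma level_back v : (0 < level F w v)%N -> v != w ->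
  exists d, [/\ d.1 \in F, org d = v & (0 < level F w (org (rev d)) < level F w v)%N].
Proof.
move=> v0 vw; have : v \in iter (level F w v) (reach F w) set0.
  by rewrite in_iter_fix_orderE -?level_gt0E//; exact: reach_mono.
rewrite -{1}(prednK v0) iterS inE (negbTE vw)/= => /orP[|/existsP[d /and3P[dF dX /eqP dv]]].
  by rewrite in_iter_fixE; [rewrite -/(level F w v); lia|exact: reach_mono].
exists (rev d); rewrite revK; split=> //.
by move: dX; rewrite in_iter_fixE; [rewrite -/(level F w _); lia|exact: reach_mono].
Qed.

Lemma level_inv (H : {group {perm dart}}) :
  (forall s d, s \in H -> s (rev d) = rev (s d)) ->
  (forall s d d', s \in H -> org d = org d' -> org (s d) = org (s d')) ->
  (forall s d, s \in H -> d.1 \in F -> (s d).1 \in F) ->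
  (forall s d, s \in H -> org d = w -> org (s d) = w) ->
  forall s d, s \in H -> level F w (org (s d)) = level F w (org d).
Proof.
move=> Hrev Horg HF Hw.
have fwd s d : s \in H -> forall k, org d \in iter k (reach F w) set0 ->
    org (s d) \in iter k (reach F w) set0.
  move=> sH k; elim: k d => [|k IH] d; first by rewrite inE.
  move=> dk; move: dk; rewrite iterS inE; case/or3P => [/eqP dw|/IH dk|/existsP[d' /and3P[dF /IH dk /eqP dd]]].
  - by rewrite (Hw _ _ sH dw) !inE eqxx.
  - by rewrite inE dk orbT.
  - rewrite inE; apply/orP; right; apply/orP; right; apply/existsP.
    by exists (s d'); rewrite HF// dk -Hrev// (Horg _ _ _ sH dd) eqxx.
have bwd s d : s \in H -> forall k, org (s d) \in iter k (reach F w) set0 ->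
    org d \in iter k (reach F w) set0.
  by move=> sH k /(fwd s^-1); rewrite permK; apply; rewrite groupV.
move=> s d sH; apply/eqP; rewrite eqn_leq.
have sdE : (org (s d) \in fixset (reach F w)) = (org d \in fixset (reach F w)).
  by apply/idP/idP => [/bwd->|/fwd->].
have [d1|d1] := boolP (org d \in fixset (reach F w)).
  apply/andP; split; apply: fix_order_ext; rewrite ?sdE//; try exact: reach_mono.
    exact: fwd.
  exact: bwd.
have z x : x \notin fixset (reach F w) -> level F w x = 0%N.
  by rewrite -level_gt0E -eqn0Ngt => /eqP.
by rewrite !z ?sdE.
Qed.

End Level.

Definition fdarts F := [set d : dart | d.1 \in F].

(** * Groups that fix a vertex *)

Section Pointed.
Variables (H : {group {perm dart}}) (F : {set E}) (S : {set V}) (w : V).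
Hypothesis Hrev : forall s d, s \in H -> s (rev d) = rev (s d).
Hypothesis Horg : forall s d d', s \in H -> org d = org d' -> org (s d) = org (s d').
Hypothesis HF : forall s d, s \in H -> d.1 \in F -> (s d).1 \in F.
Hypothesis Hw : forall s d, s \in H -> org d = w -> org (s d) = w.
Hypothesis FS : forall d, d.1 \in F -> org d \in S.
Hypothesis wS : w \in S.
Hypothesis conn : forall T : {set V}, w \in T ->
  (forall d, d.1 \in F -> org d \in T -> org (rev d) \in T) -> S \subset T.
Hypothesis degS : forall v, v \in S ->
  (forall s d, s \in H -> org d = v -> org (s d) = v) \/
  (3 <= #|[set d in fdarts F | org d == v]|)%N.

(** [hor] picks the darts between vertices at the same distance from [w], [back]
    those that come closer to [w]. The block of a horizontal dart is its edge, the
    block of a back dart is the bundle of all back darts at its origin; bundles of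
    one dart are left out of [Z]. *)
Let rho := level F w.
Let hor d := (d.1 \in F) && (rho (org (rev d)) == rho (org d)).
Let back d := (d.1 \in F) && (rho (org (rev d)) < rho (org d))%N.
Let bset v := [set d | back d & org d == v].
Let Z := [set d | hor d || back d && (1 < #|bset (org d)|)%N].
Let key d : E + V := if hor d then inl d.1 else inr (org d).

Let rho_gt0 v : v \in S -> (0 < rho v)%N.
Proof.
have/subsetP : S \subset fixset (reach F w).
  apply: conn => [|d dF]; rewrite -!level_gt0E ?level_root// => d0.
  by have /andP[] := level_step dF d0.
by move=> S0 /S0; rewrite -level_gt0E.
Qed.

Let rho_inv s d : s \in H -> rho (org (s d)) = rho (org d).
Proof. by move=> sH; exact: (level_inv Hrev). Qed.

Let horP d : d.1 \in F -> [\/ hor d, back d | back (rev d)].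
Proof.
move=> dF; rewrite /hor /back revK/= dF/=.
by case: ltngtP => _; [apply: Or32|apply: Or33|apply: Or31].
Qed.

Let s1E s d : s \in H -> ((s d).1 \in F) = (d.1 \in F).
Proof.
move=> sH; apply/idP/idP => [|/HF->//].
by move=> /(HF (groupVr sH)); rewrite permK.
Qed.

Let hor_inv s d : s \in H -> hor (s d) = hor d.
Proof. by move=> sH; rewrite /hor -Hrev// !rho_inv// s1E. Qed.

Let back_inv s d : s \in H -> back (s d) = back d.
Proof. by move=> sH; rewrite /back -Hrev// !rho_inv// s1E. Qed.

Let hor_rev d : hor (rev d) = hor d.
Proof. by rewrite /hor revK/= eq_sym. Qed.

Let hor_back d : hor d -> back d = false.
Proof. by rewrite /hor /back => /andP[_ /eqP->]; rewrite ltnn andbF. Qed.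

Let bset_inv s d : s \in H -> (#|bset (org d)| <= #|bset (org (s d))|)%N.
Proof.
move=> sH; rewrite -(card_imset (bset (org d)) (@perm_inj _ s)).
apply/subset_leq_card/subsetP => _ /imsetP[d' + ->].
by rewrite !inE back_inv// => /andP[-> /eqP/(Horg sH)->]/=.
Qed.

Let ZP d : d \in Z -> hor d = false -> back d /\ (1 < #|bset (org d)|)%N.
Proof. by rewrite inE => + hd; rewrite hd => /andP[]. Qed.

Let key_inv s y z : s \in H -> key y = key z -> key (s y) = key (s z).
Proof.
move=> sH; rewrite /key !hor_inv//; case: ifP => _; case: ifP => _ // [].
  by case/same_edge => -> //; rewrite Hrev.
by move/(Horg sH) => ->.
Qed.

(** A vertex whose back darts are not in [Z] has just one of them, and so has
    another dart that is horizontal or comes from farther away. The latter is fixed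
    by induction, so the vertex is fixed, and with it its only back dart. *)
Lemma pointed_stab_eq : 'C_H(Z | 'P) = 'C_H(fdarts F | 'P).
Proof.
apply: stab_eq => // s sH; split=> [[_ sZ]|sF]; last first.
  split=> // d; rewrite inE => /orP dZ; apply: sF; rewrite inE.
  by case: dZ => [/andP[]//|/andP[/andP[]]].
have sh d : hor d -> s d = d by move=> hd; apply: sZ; rewrite inE hd.
suff sb n d : (#|V| - rho (org d) < n)%N -> back d -> s d = d.
  move=> d; rewrite inE => /horP[/sh//|/(sb _ _ (ltnSn _))//|].
  by move=> /(sb _ _ (ltnSn _)); rewrite Hrev// => /(can_inj revK).
have rho_le v : (rho v <= #|V|)%N by exact: fix_order_le_max.
elim: n d => [//|n IH] d dn bd.
have [b1|b1] := ltnP 1 #|bset (org d)|; first by apply: sZ; rewrite inE bd b1 orbT.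
suff sd : org (s d) = org d.
  by apply/(card_le1_eqP b1); rewrite inE ?back_inv// ?bd/= ?sd.
have dF : d.1 \in F by case/andP: bd.
have [fx|d3] := degS (FS dF); first exact: fx.
have /subsetPn[d'] : ~~ ([set d' in fdarts F | org d' == org d] \subset bset (org d)).
  by apply: contraTN d3 => /subset_leq_card; lia.
rewrite !inE => /andP[d'F /eqP d'd]; rewrite d'd eqxx andbT => nb.
suff sd' : s d' = d' by rewrite -(Horg sH d'd) sd'.
case: (horP d'F) => [/sh//|bd'|bd']; first by rewrite bd' in nb.
apply: (can_inj revK); rewrite -Hrev//; apply: IH => //.
by have := rho_le (org (rev d')); move: bd' => /andP[_]; rewrite revK d'd; lia.
Qed.

Let bset_gt0 v : v \in S -> v != w -> (0 < #|bset v|)%N.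
Proof.
move=> /rho_gt0 v0 vw; have [d [dF dv /andP[_ dr]]] := level_back v0 vw.
by apply/card_gt0P; exists d; rewrite inE /back dF dv eqxx dr.
Qed.

(** Every edge of [F] is horizontal or has one back dart, and every vertex other
    than [w] has a back dart. Hence [#|F|.+1 - #|S|] is the number of horizontal
    edges plus the number of superfluous back darts, which is the total excess of
    the blocks. *)
Lemma pointed_bound : (#|S| <= #|F|.+1)%N /\
  (#|H : 'C_H(fdarts F | 'P)| <= hyperoct (#|F|.+1 - #|S|))%N.
Proof.
(* Q: horizontal edges, B: back darts, M: vertices with a bundle of back darts *)
pose Q := [set e in F | hor (e, false)]; pose B := [set d | back d].
pose M := [set v | 1 < #|bset v|]%N.
have cF : #|F| = (#|Q| + #|B|)%N.
  have -> : #|B| = (\sum_e (back (e, false) + back (e, true)))%N.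
    rewrite -sum1_card big_mkcond/= (eq_bigr (fun d => nat_of_bool (back d))); last first.
      by move=> d _; rewrite inE; case: back.
    rewrite -(pair_bigA _ (fun e b => nat_of_bool (back (e, b))))/=.
    by apply: eq_bigr => e _; rewrite big_bool addnC.
  rewrite -!sum1_card big_mkcond [X in _ = (X + _)%N]big_mkcond/= -big_split/=.
  apply: eq_bigr => e _; rewrite inE /hor /back /rev/=.
  by case: (e \in F) => //=; case: ltngtP.
have cB : #|B| = (\sum_(v in S :\ w) #|bset v|)%N.
  rewrite -sum1_card (partition_big org (mem (S :\ w)))/=; last first.
    move=> d; rewrite !inE => /andP[dF dr]; rewrite FS// andbT.
    apply: contraTneq dr => dw; rewrite dw /rho level_root -leqNgt.
    by apply: rho_gt0; exact: (FS (d := rev d)).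
  apply: eq_bigr => v _; rewrite -sum1_card; apply: eq_bigl => d.
  by rewrite !inE.
have MS : M \subset S :\ w.
  apply/subsetP => v; rewrite inE => v1; have /card_gt0P[d] := ltnW v1.
  rewrite !inE => /andP[/andP[dF dr] /eqP <-]; rewrite FS// andbT.
  apply: contraTneq dr => dw; rewrite dw /rho level_root -leqNgt.
  by apply: rho_gt0; exact: (FS (d := rev d)).
have cBM : (\sum_(v in S :\ w) #|bset v| = \sum_(v in M) #|bset v| + #|(S :\ w) :\: M|)%N.
  rewrite (bigID (mem M))/=; congr addn.
    by apply: eq_bigl => v; have := subsetP MS v; case: (v \in M) => [->|]//; rewrite ?andbF.
  rewrite -sum1_card; apply: eq_big => v; first by rewrite !inE andbC.
  rewrite !inE -leqNgt -andbA => /and3P[vw vS v1].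
  by apply/eqP; rewrite eqn_leq v1 bset_gt0.
have cS : (#|(S :\ w) :\: M| + #|M| + 1 = #|S|)%N.
  rewrite [RHS](cardsD1 w) wS -(cardsID M (S :\ w)) (setIidPr MS); lia.
have MB : (#|M| <= \sum_(v in M) #|bset v|)%N.
  by rewrite -sum1_card leq_sum// => v; rewrite inE; exact: ltnW.
split; first by lia.
rewrite -pointed_stab_eq.
have cZ : #|Z| = (#|Q| + #|Q| + \sum_(v in M) #|bset v|)%N.
  have -> : (\sum_(v in M) #|bset v| = #|[set d in B | org d \in M]|)%N.
    rewrite -sum1_card (partition_big org (mem M))/=; last first.
      by move=> d; rewrite !inE => /andP[].
    apply: eq_bigr => v vM; rewrite -sum1_card; apply: eq_bigl => d.
    by rewrite !inE; case: eqP => [->|_]; rewrite ?andbF// -[(1 < _)%N](in_set (fun v => 1 < #|bset v|)%N) vM !andbT.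
  have -> : (#|Q| + #|Q| = #|[set d | hor d]|)%N.
    rewrite -!sum1_card [LHS](_ : _ = \sum_e ((e \in Q) + (e \in Q)))%N; last first.
      by rewrite big_split/= -!big_mkcond.
    rewrite [RHS]big_mkcond/= [RHS](eq_bigr (fun d => nat_of_bool (hor d))); last first.
      by move=> d _; rewrite inE; case: hor.
    rewrite -(pair_bigA _ (fun e b => nat_of_bool (hor (e, b))))/=.
    apply: eq_bigr => e _; rewrite big_bool.
    rewrite (hor_rev (e, false) : hor (e, true) = _) inE.
    by case he: (hor (e, false)); move: he; rewrite ?andbF//= => /andP[/= ->].
  rewrite -cardsUI (_ : _ :&: _ = set0) ?cards0 ?addn0; last first.
    by apply/setP => d; rewrite !inE; case hd: (hor d) => //=; rewrite (hor_back hd).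
  by apply: eq_card => d; rewrite !inE.
have cK : (#|Q| + #|M| <= #|key @: Z|)%N.
  rewrite -(card_imset Q (@inl_inj E V)) -(card_imset M (@inr_inj E V)) -cardsUI.
  rewrite (_ : _ :&: _ = set0) ?cards0 ?addn0; last first.
    by apply/setP => k; rewrite !inE; apply/negP => /andP[/imsetP[e _ ->] /imsetP[]].
  apply/subset_leq_card/subsetP => k; rewrite inE => /orP[|] /imsetP[x xX ->].
    move: xX; rewrite inE => /andP[_ hx]; apply/imsetP; exists (x, false).
      by rewrite inE hx.
    by rewrite /key hx.
  move: xX; rewrite inE => x1; have /card_gt0P[d] := ltnW x1.
  rewrite inE => /andP[bd /eqP dx]; apply/imsetP; exists d.
    by rewrite inE bd dx x1 orbT.
  by rewrite /key dx; case: ifP => // /hor_back; rewrite bd.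
have cK2 : (#|key @: Z| <= #|Z|)%N := leq_imset_card _ _.
apply: (@leq_trans (hyperoct (#|Z| - #|key @: Z|))); last first.
  by apply: hyperoct_mono; lia.
apply: (index_stab_blocks (key := key)).
- move=> s d sH; rewrite !inE hor_inv// => /orP[->//|/andP[bd d1]].
  by rewrite back_inv// bd (leq_trans d1) ?orbT// bset_inv.
- move=> s y z sH _ _; apply/eqP/eqP => [|/(key_inv sH)//].
  by move=> /(key_inv (groupVr sH)); rewrite !permK.
- move=> z zZ; case hz: (hor z).
    rewrite (cardD1 z) inE zZ eqxx/= (cardD1 (rev z)) !inE rev_neq hor_rev hz/=.
    by rewrite /key hor_rev hz eqxx.
  have [bz z1] := ZP zZ hz; apply: leq_trans z1 _; apply/subset_leq_card/subsetP => d.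
  rewrite !inE => /andP[bd /eqP dz]; rewrite bd/= dz.
  have [_ ->] := ZP zZ hz; rewrite orbT/= /key hz.
  by case: ifP => [/hor_back|_]; rewrite ?bd ?dz.
- by lia.
Qed.

End Pointed.
End Darts.

(** * Full actions on a set and on a set of edges *)

Section SetStabiliser.
Variable T : finType.
Implicit Types (H : {group {perm T}}) (Y Z : {set T}) (s : {perm T}).

Definition setstab H Y : {group {perm T}} := 'C_H[Y | 'P^*]%G.

Lemma in_setstabP H Y s : reflect (s \in H /\ s @: Y = Y) (s \in setstab H Y).
Proof.
have E : ('P^*)%act Y s = s @: Y by apply: eq_imset.
rewrite inE; apply: (iffP andP) => -[sH]; last by move=> sY; split=> //; apply/astab1P; rewrite E.
by move/astab1P; rewrite E.
Qed.

Lemma setstab_sub H Y : setstab H Y \subset H.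
Proof. exact: subsetIl. Qed.

Lemma index_setstab H Y (Q : {set {set T}}) :
  (forall s, s \in H -> s @: Y \in Q) -> (#|H : setstab H Y| <= #|Q|)%N.
Proof.
move=> HQ; rewrite -card_orbit; apply/subset_leq_card/subsetP => _ /orbitP[s sH <-].
by rewrite (_ : 'P^*%act Y s = s @: Y) ?HQ//; apply: eq_imset.
Qed.

Lemma stab_setT H : 'C_H([set: T] | 'P) = 1 :> {set _}.
Proof.
apply/setP => s; apply/in_stabP/set1P => [[_ sT]|->].
  by apply/permP => x; rewrite perm1 sT.
by split=> // x _; rewrite perm1.
Qed.

(** If the count by fixing one point at a time is sharp, then it is sharp at the
    first step and at all the others. *)
Lemma full_index_perm H Y x : (forall s y, s \in H -> y \in Y -> s y \in Y) ->
  #|H : 'C_H(Y | 'P)| = #|Y|`! -> x \in Y ->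
  (forall y, y \in Y -> exists2 s, s \in H & s x = y) /\
  #|'C_H([set x] | 'P) : 'C_('C_H([set x] | 'P))(Y :\ x | 'P)| = #|Y :\ x|`!.
Proof.
move=> HY full xY; pose K := 'C_H([set x] | 'P)%G.
have KP s : s \in K -> s \in H /\ s x = x.
  by move=> /in_stabP[sH sx]; split => //; apply: sx; rewrite inE.
have KE : 'C_K(Y :\ x | 'P) = 'C_H(Y | 'P).
  apply: stab_eq => [|s sH]; first exact: subsetIl.
  split=> [[/KP[_ sx] sY] y yY|sY].
    by have [->//|yx] := eqVneq y x; apply: sY; rewrite !inE yx.
  split; last by move=> y; rewrite !inE => /andP[_ /sY].
  by apply/in_stabP; split=> // y; rewrite inE => /eqP ->; exact: sY.
have KY : (#|K : 'C_K(Y :\ x | 'P)| <= #|Y :\ x|`!)%N.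
  apply: index_stab_perm => s y /KP[sH sx]; rewrite !inE => /andP[yx yY].
  by rewrite HY// andbT -sx (inj_eq perm_inj).
have cY : #|Y| = #|Y :\ x|.+1 by rewrite (cardsD1 x) xY.
have orbY : orbit 'P H x \subset Y by apply: orbit_sub => s sH; exact: HY.
have := subset_leq_card orbY; rewrite card_orbit_perm => orb_le.
move: full; rewrite (index_stab_trans (subsetIl _ _) KE) cY factS -cY => full.
have h0 := fact_gt0 #|Y :\ x|.
have oE : #|H : K| = #|Y|.
  by apply/eqP; rewrite eqn_leq orb_le -(leq_pmul2r h0) -full leq_mul2l KY orbT.
split; last first.
  by move: full => /eqP; rewrite -oE eqn_pmul2l ?indexg_gt0// => /eqP.
move=> y yY; have : y \in orbit 'P H x.
  suff -> : orbit 'P H x = Y by [].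
  by apply/eqP; rewrite eqEcard orbY card_orbit_perm -oE /=.
by case/orbitP => s sH <-; exists s.
Qed.

Lemma full_index_perm2 H Y x y z : (forall s y, s \in H -> y \in Y -> s y \in Y) ->
  #|H : 'C_H(Y | 'P)| = #|Y|`! -> x \in Y -> y \in Y -> z \in Y -> y != x -> z != x ->
  exists2 s, s \in H & s x = x /\ s y = z.
Proof.
move=> HY full xY yY zY yx zx; have [_ full'] := full_index_perm HY full xY.
have [| | |s] := (@full_index_perm 'C_H([set x] | 'P)%G (Y :\ x) y _ full' _).1 z.
- move=> s t /in_stabP[sH sx]; rewrite !inE => /andP[tx tY].
  by rewrite HY// andbT -(sx x) ?inE// (inj_eq perm_inj).
- by rewrite !inE yx.
- by rewrite !inE zx.
- by move=> /in_stabP[sH sx] sy; exists s => //; rewrite sx ?inE.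
Qed.

End SetStabiliser.

Section EdgeAction.
Variable E : finType.
Implicit Types (H : {group {perm dart E}}) (F : {set E}).

Lemma card_fdarts F : #|fdarts F| = #|F|.*2.
Proof.
rewrite -muln2 -card_bool -cardsT -cardsX; apply: eq_card => -[e b].
by rewrite !inE andbT.
Qed.

Lemma index_stab_edges H F :
  (forall s d, s \in H -> s (rev d) = rev (s d)) ->
  (forall s d, s \in H -> d.1 \in F -> (s d).1 \in F) ->
  (#|H : 'C_H(fdarts F | 'P)| <= hyperoct #|F|)%N.
Proof.
move=> Hrev HF; apply: (index_stab_blocks (key := fst)).
- by move=> s d sH; rewrite !inE; exact: HF.
- have sK s (y z : dart E) : s \in H -> y.1 = z.1 -> (s y).1 = (s z).1.
    by move=> sH /same_edge[] ->; rewrite // Hrev.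
  move=> s y z sH _ _; apply/eqP/eqP => [|/sK->//].
  by move=> /(sK _ _ _ (groupVr sH)); rewrite !permK.
- move=> z zF; rewrite (cardD1 z) inE zF eqxx/= (cardD1 (rev z)) !inE rev_neq/=.
  by rewrite eqxx; move: zF; rewrite inE => ->.
- rewrite card_fdarts -addnn; congr addn; apply: eq_card => e.
  apply/idP/imsetP => [eF|[d]]; first by exists (e, false); rewrite ?inE.
  by rewrite inE => ? ->.
Qed.

(** The analogue of [full_index_perm]: fixing a dart also fixes its reversal, which
    leaves two darts fewer to permute. *)
Lemma full_index_edges H F x :
  (forall s d, s \in H -> s (rev d) = rev (s d)) ->
  (forall s d, s \in H -> d.1 \in F -> (s d).1 \in F) ->
  #|H : 'C_H(fdarts F | 'P)| = hyperoct #|F| -> x.1 \in F ->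
  (forall y : dart E, y.1 \in F -> exists2 s, s \in H & s x = y) /\
  #|'C_H([set x] | 'P) : 'C_('C_H([set x] | 'P))(fdarts (F :\ x.1) | 'P)|
    = hyperoct #|F :\ x.1|.
Proof.
move=> Hrev HF full xF; pose K := 'C_H([set x] | 'P)%G.
have KP s : s \in K -> s \in H /\ s x = x.
  by move=> /in_stabP[sH sx]; split => //; apply: sx; rewrite inE.
have KE : 'C_K(fdarts (F :\ x.1) | 'P) = 'C_H(fdarts F | 'P).
  apply: stab_eq => [|s sH]; first exact: subsetIl.
  split=> [[/KP[_ sx] sF] y|sF].
    rewrite inE => yF; have [|yx] := eqVneq y.1 x.1; last by apply: sF; rewrite !inE yx.
    by move/esym/same_edge => [] ->; rewrite ?Hrev ?sx.
  split; last by move=> y; rewrite !inE => /andP[_ yF]; apply: sF; rewrite inE.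
  by apply/in_stabP; split=> // y; rewrite inE => /eqP ->; apply: sF; rewrite inE.
have KF : (#|K : 'C_K(fdarts (F :\ x.1) | 'P)| <= hyperoct #|F :\ x.1|)%N.
  apply: index_stab_edges => [s d /KP[sH _]|s d /KP[sH sx]]; first exact: Hrev.
  rewrite !inE => /andP[dx dF]; rewrite HF// andbT; apply: contra dx => /eqP.
  by rewrite -{1}sx => /esym/same_edge[]; rewrite -?Hrev// => /perm_inj ->.
have cF : #|F| = #|F :\ x.1|.+1 by rewrite (cardsD1 x.1) xF.
have hF : hyperoct #|F| = (#|F|.*2 * hyperoct #|F :\ x.1|)%N.
  by rewrite cF /hyperoct factS expnS -muln2; lia.
have orbF : orbit 'P H x \subset fdarts F.
  by apply: orbit_sub => s sH; rewrite inE HF.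
have := subset_leq_card orbF; rewrite card_fdarts card_orbit_perm => orb_le.
move: full; rewrite (index_stab_trans (subsetIl _ _) KE) hF => full.
have h0 := hyperoct_gt0 #|F :\ x.1|.
have i0 : (0 < #|H : K|)%N by rewrite indexg_gt0.
have oE : #|H : K| = #|F|.*2.
  apply/eqP; rewrite eqn_leq orb_le -(leq_pmul2r h0) -full leq_mul2l KF orbT//.
split; last first.
  by move: full => /eqP; rewrite -oE eqn_pmul2l// => /eqP.
move=> y yF; have : y \in orbit 'P H x.
  suff -> : orbit 'P H x = fdarts F by rewrite inE.
  by apply/eqP; rewrite eqEcard orbF card_fdarts card_orbit_perm -oE /=.
by case/orbitP => s sH <-; exists s.
Qed.

Lemma full_index_edges2 H F x y z :
  (forall s d, s \in H -> s (rev d) = rev (s d)) ->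
  (forall s d, s \in H -> d.1 \in F -> (s d).1 \in F) ->
  #|H : 'C_H(fdarts F | 'P)| = hyperoct #|F| -> x.1 \in F -> y.1 \in F -> z.1 \in F ->
  y.1 != x.1 -> z.1 != x.1 -> exists2 s, s \in H & s x = x /\ s y = z.
Proof.
move=> Hrev HF full xF yF zF yx zx; have [_ full'] := full_index_edges Hrev HF full xF.
have KP s : s \in 'C_H([set x] | 'P) -> s \in H /\ s x = x.
  by move=> /in_stabP[sH sx]; split => //; apply: sx; rewrite inE.
have [| | | |s] := (@full_index_edges 'C_H([set x] | 'P)%G (F :\ x.1) y _ _ full' _).1 z.
- by move=> s d /KP[sH _]; exact: Hrev.
- move=> s d /KP[sH sx]; rewrite !inE => /andP[dx dF]; rewrite HF// andbT.
  apply: contra dx => /eqP.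
  by rewrite -{1}sx => /esym/same_edge[]; rewrite -?Hrev// => /perm_inj ->.
- by rewrite !inE yx.
- by rewrite !inE zx.
- by move=> /KP[sH sx] sy; exists s.
Qed.

End EdgeAction.

(** * Deleting the loops, deleting a vertex *)

Section StableGraph.
Variables (V E : finType) (src tgt : E -> V).
Variables (A : {group {perm dart E}}) (g : nat).
Notation D := (dart E).
Notation org := (@org V E src tgt).
Hypothesis Arev : forall s d, s \in A -> s (rev d) = rev (s d).
Hypothesis Aorg : forall s d d', s \in A -> org d = org d' -> org (s d) = org (s d').
Hypothesis conn : forall T : {set V}, T != set0 ->
  (forall d, org d \in T -> org (rev d) \in T) -> T = setT.
Hypothesis deg3 : forall v, (3 <= #|[set d | org d == v]|)%N.
Hypothesis genus : #|E|.+1 = (g + #|V|)%N.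
Hypothesis g2 : (2 <= g)%N.

Definition loops := [set e | src e == tgt e].

Lemma loopP d : (d.1 \in loops) = (org d == org (rev d)).
Proof. by case: d => e []; rewrite inE /org/= // eq_sym. Qed.

Lemma loops_inv s d : s \in A -> ((s d).1 \in loops) = (d.1 \in loops).
Proof.
move=> sA; rewrite !loopP -Arev//; apply/eqP/eqP => [|/(Aorg sA)//].
by move/(Aorg (groupVr sA)); rewrite !permK.
Qed.

Lemma sum_deg : (\sum_v #|[set d | org d == v]| = #|E|.*2)%N.
Proof.
rewrite -cardsT -card_fdarts -sum1_card (partition_big org predT)//=.
by apply: eq_bigr => v _; rewrite -sum1_card; apply: eq_bigl => d; rewrite !inE.
Qed.

Lemma card_vertices_le : (3 * #|V| <= #|E|.*2)%N.
Proof.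
rewrite mulnC -sum_deg -[#|V|]cardsT -sum_nat_const.
by rewrite [leqRHS](eq_bigl (mem setT)) ?leq_sum// => v; rewrite /= inE.
Qed.

(** What fixes the loops fixes a vertex, and the vertices that it moves have no
    loop, so they keep all their darts when the loops are deleted. *)
Lemma loops_bound : (0 < #|loops|)%N -> (#|loops| <= g)%N /\
  (#|A : 'C_A(fdarts loops | 'P)| <= hyperoct #|loops|)%N /\
  (#|'C_A(fdarts loops | 'P)| <= hyperoct (g - #|loops|))%N.
Proof.
move=> /card_gt0P[e0 e0L]; pose H := 'C_A(fdarts loops | 'P)%G.
have HP s : s \in H -> s \in A /\ {in fdarts loops, forall d, s d = d}.
  by move=> /in_stabP.
have HC : 'C_H(fdarts (~: loops) | 'P) = 1 :> {set _}.
  rewrite -[RHS](stab_setT A).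
  apply: stab_eq => [|s sA]; first exact: subsetIl.
  split=> [[/HP[_ sL] sF] d _|sT].
    by have [dL|dL] := boolP (d.1 \in loops); [apply: sL|apply: sF]; rewrite !inE in dL *.
  by split=> [|d _]; [apply/in_stabP; split=> // d _|]; apply: sT; rewrite inE.
have cL : (#|~: loops| + #|loops| = #|E|)%N by rewrite addnC cardsC.
have := @pointed_bound V E src tgt H (~: loops) setT (src e0).
rewrite HC indexg1 cardsT => -[].
- by move=> s d /HP[sA _]; exact: Arev.
- by move=> s d d' /HP[sA _]; exact: Aorg.
- by move=> s d /HP[sA _]; rewrite !in_setC loops_inv.
- move=> s d /HP[sA sL] de0; rewrite (Aorg sA (de0 : org d = org (e0, false))).
  by rewrite sL// inE.
- by move=> d _; rewrite inE.
- by rewrite inE.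
- move=> T e0T cT; suff -> : T = setT by [].
  apply: conn => [|d dT]; first by apply/set0Pn; exists (src e0).
  have [dL|dL] := boolP (d.1 \in loops); last by apply: cT; rewrite // inE.
  by move: dL; rewrite loopP => /eqP <-.
- move=> v _; have [/existsP[d /andP[dL /eqP dv]]|nL] :=
    boolP [exists d, (d.1 \in loops) && (org d == v)].
    left=> s d' /HP[sA sL] d'v; have /(Aorg sA) -> : org d' = org d by rewrite d'v.
    by rewrite sL// inE.
  right; apply: leq_trans (deg3 v) _; apply/subset_leq_card/subsetP => d.
  rewrite !inE => dv; rewrite dv andbT; apply: contra nL => dL.
  by apply/existsP; exists d; rewrite dv inE dL.
- move=> le1 le2; split; first by lia.
  split; last by apply: leq_trans le2 (hyperoct_mono _); lia.
  apply: index_stab_edges => // s d sA; by rewrite loops_inv.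
Qed.

Lemma dart_at v : exists d, org d == v.
Proof.
have /card_gt0P[d] : (0 < #|[set d | org d == v]|)%N by apply: leq_trans (deg3 v).
by rewrite inE; exists d.
Qed.

(** The action on vertices; it does not depend on the chosen dart by [vactE]. *)
Definition vact (s : {perm D}) v := org (s (xchoose (dart_at v))).

Lemma vactE s d : s \in A -> vact s (org d) = org (s d).
Proof. by move=> sA; apply: Aorg => //; exact/eqP/(xchooseP (dart_at _)). Qed.

Lemma vactK s : s \in A -> cancel (vact s) (vact s^-1).
Proof.
move=> sA v; have /existsP[d /eqP<-] : [exists d, org d == v] by apply/existsP/dart_at.
by rewrite !vactE ?groupV// permK.
Qed.

Definition vdarts (X : {set V}) := [set d | org d \in X].

Lemma vdarts_im s X : s \in A -> s @: vdarts X = vdarts (vact s @: X).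
Proof.
move=> sA; apply/setP => d; rewrite inE; apply/imsetP/imsetP => [[d' + ->]|[v vX dv]].
  by rewrite inE => d'X; exists (org d') => //; rewrite vactE.
exists (s^-1 d); rewrite ?permKV// inE.
by rewrite -vactE ?groupV// dv vactK.
Qed.

(** [X] is a union of components of the complement of [u], but not all of it. *)
Definition piece u (X : {set V}) := [&& X != set0, u \notin X, u |: X != setT &
  [forall d, (org d \in X) ==> (org (rev d) \in u |: X)]].

Definition touch (X : {set V}) := [set e | (src e \in X) || (tgt e \in X)].

Lemma touchP X d : (d.1 \in touch X) = (org d \in X) || (org (rev d) \in X).
Proof. by case: d => e []; rewrite inE /org//= orbC. Qed.

Section Loopless.
Hypothesis loopless : loops = set0.

Lemma org_rev d : org (rev d) != org d.
Proof. by rewrite eq_sym -loopP loopless inE. Qed.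

Lemma card_touch1 u : #|touch [set u]| = #|[set d | org d == u]|.
Proof.
rewrite -(card_in_imset (f := fst) (D := [set d | org d == u])); last first.
  move=> d d'; rewrite !inE => /eqP du /eqP d'u /same_edge[]// dd'.
  by have := org_rev d; rewrite -dd' du d'u eqxx.
apply: eq_card => e; rewrite inE !in_set1; apply/orP/imsetP => [|[d]].
  by case=> eu; [exists (e, false)|exists (e, true)]; rewrite ?inE.
by rewrite inE => + ->; case: d => [? []] /= du; [right|left].
Qed.

Definition vertex_stab u := setstab A (vdarts [set u]).
Definition star_stab u : {group {perm D}} := 'C_(vertex_stab u)(vdarts [set u] | 'P)%G.

(** An automorphism that fixes the darts at [u] fixes the neighbours of [u], and all
    other vertices keep their darts when [u] is deleted. As [u] cuts off no piece,
    the complement of [u] is connected, and it can be pointed at a neighbour. *)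
Lemma star_bound u : (forall X, ~~ piece u X) ->
  [/\ (#|[set d | org d == u]| <= g.+1)%N,
      #|A| = (#|A : vertex_stab u| * #|vertex_stab u : star_stab u| * #|star_stab u|)%N,
      (#|A : vertex_stab u| <= #|V|)%N,
      (#|vertex_stab u : star_stab u| <= #|[set d | org d == u]|`!)%N &
      (#|star_stab u| <= hyperoct (g.+1 - #|[set d | org d == u]|))%N].
Proof.
move=> nopiece; rewrite /star_stab; set H := vertex_stab u; set K := 'C_H(_ | _)%G.
have KP s : s \in K -> s \in A /\ {in vdarts [set u], forall d, s d = d}.
  by move=> /in_stabP[/in_setstabP[]].
have [d0 /eqP d0u] := dart_at u.
have cE : (#|~: touch [set u]| + #|[set d | org d == u]| = #|E|)%N.
  by rewrite -card_touch1 addnC cardsC.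
have cV : (#|~: [set u]|.+1 = #|V|)%N by rewrite -(cardsC [set u]) cards1.
have KC : 'C_K(fdarts (~: touch [set u]) | 'P) = 1 :> {set _}.
  rewrite -[RHS](stab_setT A).
  have KA : K \subset A by apply/subsetP => s /KP[].
  apply: stab_eq => // s sA; split=> [[/KP[_ sL] sF] d _|sT].
    have [du|du] := boolP (d \in vdarts [set u]); first exact: sL.
    have [d'u|d'u] := boolP (rev d \in vdarts [set u]).
      by apply: (can_inj (@revK E)); rewrite -Arev// sL.
    by apply: sF; rewrite inE in_setC touchP; move: du d'u; rewrite !in_set => /negPf -> /negPf ->.
  have sT' d : s d = d by apply: sT; rewrite inE.
  split=> [|d _]; last exact: sT'.
  apply/in_stabP; split=> [|d _]; last exact: sT'.
  by apply/in_setstabP; split=> //; rewrite -[RHS]imset_id; apply: eq_imset.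
have := @pointed_bound V E src tgt K (~: touch [set u]) (~: [set u]) (org (rev d0)).
rewrite KC indexg1 => -[].
- by move=> s d /KP[sA _]; exact: Arev.
- by move=> s d d' /KP[sA _]; exact: Aorg.
- move=> s d /KP[sA su]; rewrite !in_setC !touchP; apply: contra.
  have su' d' : org (s d') \in [set u] -> org d' \in [set u].
    move=> d'u; have sdu : s d' \in vdarts [set u] by rewrite inE.
    by have := su _ sdu => /perm_inj sd'; rewrite -sd'.
  by case/orP => [/su' ->//|]; rewrite -Arev// => /su' ->; rewrite orbT.
- move=> s d /KP[sA su] /(Aorg sA) ->.
  by rewrite Arev// su// !inE d0u.
- by move=> d; rewrite in_setC touchP !inE negb_or => /andP[].
- by rewrite !inE -d0u org_rev.
- move=> T wT cT; apply/subsetP => v; rewrite !inE => vu.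
  have /negPn/eqP uT : ~~ (u |: (T :\ u) != setT).
    apply: contra (nopiece (T :\ u)) => uT; rewrite /piece uT !inE eqxx/=.
    apply/andP; split; first by apply/set0Pn; exists (org (rev d0)); rewrite !inE wT -d0u org_rev.
    apply/forallP => d; apply/implyP; rewrite !inE => /andP[du dT].
    have [//|d'u] := eqVneq (org (rev d)) u; rewrite /= cT//.
    by rewrite in_setC touchP !inE negb_or du.
  by have := in_setT v; rewrite -uT !inE (negbTE vu).
- move=> v; rewrite !inE => vu.
  have [/existsP[d /andP[/eqP du /eqP dv]]|nL] :=
    boolP [exists d, (org d == u) && (org (rev d) == v)].
    left=> s d' /KP[sA sL] d'v; have /(Aorg sA) -> : org d' = org (rev d) by rewrite d'v.
    by rewrite Arev// sL// !inE du.
  right; apply: leq_trans (deg3 v) _; apply/subset_leq_card/subsetP => d.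
  rewrite inE => dv; rewrite inE [_ \in fdarts _]inE dv andbT in_setC touchP !inE negb_or (eqP dv) vu.
  by apply: contra nL => d'u; apply/existsP; exists (rev d); rewrite revK d'u.
- move=> le1 le2; split; first by lia.
  + rewrite -(Lagrange (setstab_sub A (vdarts [set u]))) -/H.
    rewrite -(Lagrange (subsetIl H 'C(vdarts [set u] | 'P))) -/K.
    by rewrite mulnC (mulnC #|K|) mulnA.
  + apply: (@leq_trans #|[set vdarts [set v] | v in V]|); last exact: leq_imset_card.
    apply: index_setstab => s sA; rewrite vdarts_im// imset_set1.
    by apply/imsetP; exists (vact s u).
  + rewrite (_ : [set d | org d == u] = vdarts [set u]); last first.
      by apply/setP => d; rewrite !inE.
    apply: index_stab_perm => s d /in_setstabP[sA su] du.
    by rewrite -su imset_f.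
  + by apply: leq_trans le2 (hyperoct_mono _); lia.
Qed.

End Loopless.
End StableGraph.

(** * Loopless graphs without cut vertices *)

Section NoPiece.
Variables (V E : finType) (src tgt : E -> V).
Variables (A : {group {perm dart E}}) (g : nat).
Notation D := (dart E).
Notation org := (@org V E src tgt).
Notation deg u := #|[set d | org d == u]|.
Hypothesis Arev : forall s d, s \in A -> s (rev d) = rev (s d).
Hypothesis Aorg : forall s d d', s \in A -> org d = org d' -> org (s d) = org (s d').
Hypothesis conn : forall T : {set V}, T != set0 ->
  (forall d, org d \in T -> org (rev d) \in T) -> T = setT.
Hypothesis deg3 : forall v, (3 <= deg v)%N.
Hypothesis genus : #|E|.+1 = (g + #|V|)%N.
Hypothesis g2 : (2 <= g)%N.
Hypothesis loopless : loops src tgt = set0.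

Let card_V2 (v0 : V) : (1 < #|V|)%N.
Proof.
have [d /eqP dv] := dart_at deg3 v0.
rewrite (cardD1 (org d)) (cardD1 (org (rev d))) !inE.
by rewrite (org_rev loopless).
Qed.

Let deg_lt4 u : #|V| = 4 -> g = 3 -> (deg u <= 3)%N.
Proof.
move=> n4 g3; have := sum_deg src tgt; rewrite (bigD1 u)//=.
have : (\sum_(v | v != u) 3 <= \sum_(v | v != u) deg v)%N by exact: leq_sum.
rewrite sum_nat_const cardC1 n4; set S := (\sum_(_ | _) _)%N; move: genus; rewrite n4 g3 => -[->]; lia.
Qed.

(** Here the estimate by [star_bound] is 4 * 6 * 2 = 48, which is not strict. If it
    were attained, the darts at [u] would be permuted in all six ways, and some
    automorphism fixing them would move a dart [d]. By the first, the neighbours of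
    [u] are either all equal or all distinct. If they are equal, they cut [u] off.
    If they are distinct, both ends of [d] are neighbours of [u]; their third dart
    goes to [u], so that [u] cuts them off. *)
Lemma four_vertices_strict (u : V) : (forall v X, ~~ piece src tgt v X) ->
  #|V| = 4 -> g = 3 -> (#|A| < hyperoct g)%N.
Proof.
move=> nopiece n4 g3; have du : deg u = 3.
  by apply/eqP; rewrite eqn_leq deg3 deg_lt4.
have [_ cA a4 h6 k2] := star_bound Arev Aorg deg3 genus g2 loopless (nopiece u).
set H := vertex_stab _ _ _ u in cA a4 h6; set K := star_stab _ _ _ u in cA h6 k2.
rewrite ltnNge; apply/negP => big.
have h3 : hyperoct 3 = 48 by []. have h1 : hyperoct 1 = 2 by [].
rewrite n4 in a4; rewrite du (_ : 3`! = 6)// in h6; rewrite g3 du in k2 big.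
rewrite {}h3 cA in big; rewrite {}h1 in k2.
have hE : #|H : K| = 6.
  apply/eqP; rewrite eqn_leq h6 leqNgt; apply/negP => h5.
  have : (#|A : H| * #|H : K| * #|K| <= 4 * 5 * 2)%N by rewrite !leq_mul.
  by move/(leq_trans big).
have K2 : (1 < #|K|)%N.
  rewrite ltnNge; apply/negP => K1.
  have : (#|A : H| * #|H : K| * #|K| <= 4 * 6 * 1)%N by rewrite !leq_mul.
  by move/(leq_trans big).
have HP s : s \in H -> s \in A /\ s @: vdarts src tgt [set u] = vdarts src tgt [set u].
  by move=> /in_setstabP.
have KP s : s \in K -> s \in A /\ {in vdarts src tgt [set u], forall d, s d = d}.
  by move=> /in_stabP[/HP[sA _] sK].
have vdE : vdarts src tgt [set u] = [set d | org d == u].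
  by apply/setP => d; rewrite !inE.
have Hu s y : s \in H -> y \in vdarts src tgt [set u] -> s y \in vdarts src tgt [set u].
  by move=> /HP[_ {2}<-] yu; apply: imset_f.
have full : #|H : 'C_H(vdarts src tgt [set u] | 'P)| = #|vdarts src tgt [set u]|`!.
  by rewrite vdE du -vdE.
have nu (d : D) : org d == u -> org (rev d) != u.
  by move=> /eqP <-; exact: org_rev.
(* the neighbours are distinct: otherwise they coincide and cut off [set u] *)
have inj d d' : org d == u -> org d' == u -> org (rev d) = org (rev d') -> d = d'.
  move=> ud ud' dd'; apply/eqP; apply: contraT => nd.
  have udE x : org x == u -> x \in vdarts src tgt [set u] by rewrite !inE.
  suff pc : piece src tgt (org (rev d)) [set u] by have := nopiece (org (rev d)) [set u]; rewrite pc.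
  apply/and4P; split.
  - by apply/set0Pn; exists u; rewrite inE.
  - by rewrite inE nu.
  - apply/negP => /eqP T; have := cardsC (org (rev d) |: [set u]).
    by rewrite T setCT cards0 -T cards2 n4; case: (_ != _).
  apply/forallP => x; apply/implyP; rewrite !inE => ux.
  have [->|xd] := eqVneq x d; first by rewrite eqxx.
  rewrite eq_sym in nd.
  have [s sH [sd sd']] := full_index_perm2 Hu full (udE _ ud) (udE _ ud') (udE _ ux) nd xd.
  have sA := (HP _ sH).1.
  by rewrite -sd' -{1}sd -!Arev// (Aorg sA dd') eqxx.
have [t tK t1] : exists2 t, t \in K & t != 1.
  have : K :!=: 1 by rewrite -cardG_gt1.
  by case/trivgPn => t tK t1; exists t.
have [tA tu] := KP _ tK.
have [d td] : exists d, t d != d.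
  apply/existsP; apply: contraNT t1 => /existsPn te; apply/eqP/permP => x.
  by rewrite perm1; have := te x; rewrite negbK => /eqP.
have trd : t (rev d) != rev d by rewrite Arev// (inj_eq (can_inj (@revK E))).
have ndu x : t x != x -> org x != u.
  by apply: contraNN => xu; rewrite tu// inE in_set1.
pose N := [set org (rev x) | x in [set d | org d == u]].
have cN : #|N| = 3.
  by rewrite card_in_imset ?du// => x y; rewrite !inE; exact: inj.
have NP v : v != u -> v \in N.
  move=> vu; have : u |: N = setT.
    apply/eqP; rewrite eqEcard subsetT cardsU1 cN cardsT n4.
    rewrite (_ : u \notin N)//; apply/imsetP => -[x]; rewrite inE => /nu + ux.
    by rewrite -ux eqxx.
  by move/setP/(_ v); rewrite !inE (negbTE vu) => NV; exact: NV.
(* a moved dart, its image and the dart to u are all the darts at a vertex *)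
have ends x : t x != x -> forall y, org y = org x -> y = x \/ y = t x \/ org (rev y) = u.
  move=> tx y yx; have /imsetP[z] := NP _ (ndu _ tx); rewrite inE => uz xz.
  have txo : org (t x) = org x.
    by rewrite (Aorg tA xz) Arev// tu ?inE ?in_set1.
  have sub : [set x; t x; rev z] \subset [set d | org d == org x].
    by apply/subsetP => a; rewrite !inE => /orP[/orP[]|] /eqP ->; rewrite ?eqxx ?txo// -xz.
  have zfix : t (rev z) = rev z by rewrite Arev// tu ?inE ?in_set1.
  have xz' : x != rev z by apply: contraNneq tx => ->; rewrite zfix.
  have txz' : t x != rev z by rewrite -zfix (inj_eq perm_inj).
  have : y \in [set x; t x; rev z].
    suff -> : [set x; t x; rev z] = [set d | org d == org x] by rewrite inE yx.
    apply/eqP; rewrite eqEcard sub (leq_trans (deg_lt4 _ n4 g3))//.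
    by rewrite setUC cardsU1 cards2 !inE !(eq_sym (rev z)) (negbTE xz') (negbTE txz') eq_sym tx.
  rewrite !inE => /orP[/orP[]|] /eqP->; [by left|by right; left|right; right].
  by rewrite revK; apply/eqP.
have txo x : t x != x -> org (t x) = org x.
  move=> tx; have /imsetP[z] := NP _ (ndu _ tx); rewrite inE => uz xz.
  by rewrite (Aorg tA xz) Arev// tu ?inE ?in_set1.
have := nopiece u [set org d; org (rev d)].
apply/negP; rewrite negbK; apply/and4P; split.
- by apply/set0Pn; exists (org d); rewrite !inE eqxx.
- by rewrite !inE !(eq_sym u) negb_or !ndu.
- apply/negP => /eqP T; have := cardsT V.
  by rewrite -T n4 cardsU1 cards2; case: (_ \notin _); case: (_ != _).
apply/forallP => y; apply/implyP; rewrite !inE => /orP[] /eqP yd.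
  have [->|[->|->]] := ends _ td _ yd; rewrite ?eqxx ?orbT// -Arev// txo// eqxx !orbT//.
have [->|[->|->]] := ends _ trd _ yd; rewrite -?Arev// ?revK ?txo// ?eqxx ?orbT//.
Qed.

(** With [h = g + 1 - k], the bound is [#|V| * k! * f h], to be compared with
    [f g = 'C(g, h) * f h * f (k - 1)]. For [h = 0] there are two vertices; for
    [h > 0] the estimate ['C(g, h) >= g] suffices if [k >= 4], the exact value of
    ['C(g, 2)] if [k = 3] and [g >= 4]. *)
Lemma nopiece_bound : (forall v X, ~~ piece src tgt v X) ->
  #|V| = 2 \/ (#|A| < hyperoct g)%N.
Proof.
move=> nopiece; have [v0 _|V0] := pickP (@predT V); last first.
  have c0 : #|V| = 0%N by apply: eq_card0 => v; have := V0 v.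
  have [E0|/card_gt0P[e _]] := posnP #|E|; first by move: genus; rewrite E0 c0; lia.
  by have := V0 (src e).
have [u _ umin] := arg_minnP (P := predT) (fun u => deg u) (erefl : predT v0).
have [kg cA a4 h6 k2] := star_bound Arev Aorg deg3 genus g2 loopless (nopiece u).
have k3 := deg3 u; move: umin kg h6 k2 k3; set k := deg u => umin kg h6 k2 k3.
have nk : (#|V| * k <= (g + #|V|).-1.*2)%N.
  rewrite -genus/= -(sum_deg src tgt).
  have -> : (#|V| * k = \sum_(v : V) k)%N by rewrite sum_nat_const.
  by apply: leq_sum => v _; exact: umin.
have n2 := card_V2 v0.
have [h0|h0] := posnP (g.+1 - k)%N.
  left; have kE : k = g.+1 by lia.
  move: nk; rewrite {}kE => nk; apply/eqP; rewrite eqn_leq n2 andbT leqNgt.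
  by apply/negP => n3; nia.
have [k3'|k4] : k = 3 \/ (4 <= k)%N by lia.
  have [g3|g4] : g = 3 \/ (4 <= g)%N by lia.
    have [n3|n4] := leqP #|V| 3; last first.
      by right; apply: (four_vertices_strict u) => //; move: nk; rewrite k3' g3; lia.
    right; rewrite cA g3; apply: (@leq_ltn_trans (3 * 6 * 2)%N) => //.
    rewrite !leq_mul//; first exact: leq_trans a4 _.
      by apply: leq_trans h6 _; rewrite k3'.
    by apply: leq_trans k2 _; rewrite k3' g3.
  right; have gE : g = (2 + (g - 2))%N by lia.
  rewrite cA; apply: (@leq_ltn_trans (#|V| * 6 * hyperoct (g - 2))%N).
    rewrite !leq_mul//; first by apply: leq_trans h6 _; rewrite k3'.
    by apply: leq_trans k2 _; rewrite k3' subSS.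
  rewrite [in ltnRHS]gE hyperoctD mulnA ltn_pmul2r ?hyperoct_gt0//.
  have -> : hyperoct 2 = 8 by [].
  have -> : (2 + (g - 2) = g)%N by lia.
  have := bin2_double g.
  move: nk; rewrite k3'; nia.
right; have gE : g = (k.-1 + (g.+1 - k))%N by lia.
rewrite cA; apply: (@leq_ltn_trans (#|V| * k`! * hyperoct (g.+1 - k))%N).
  by rewrite !leq_mul.
rewrite [in ltnRHS]gE hyperoctD mulnA ltn_pmul2r ?hyperoct_gt0//.
rewrite /hyperoct -[k in k`!]prednK ?factS; last by lia.
rewrite !mulnA ltn_pmul2r ?fact_gt0// prednK; last by lia.
apply: (@leq_trans (g * 2 ^ k.-1)%N); last first.
  rewrite leq_mul2r; apply/orP; right; rewrite {1}gE; apply: leq_bin_mid; lia.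
(* where k >= 4 is used; this fails for k = 3 *)
have e2 : (2 * k <= (k - 2) * 2 ^ k.-1)%N.
  have : (k <= 2 ^ k.-1)%N by rewrite -{1}(@prednK k) ?succ_leq_exp2//; lia.
  nia.
have nk2 : (#|V| * (k - 2) <= 2 * (g - 1))%N by nia.
rewrite -(ltn_pmul2r (_ : 0 < k - 2)%N); last by lia.
apply: (@leq_ltn_trans (2 * (g - 1) * k)%N).
  by rewrite mulnAC leq_mul2r nk2 orbT.
have : (2 * (g - 1) * k <= (g - 1) * ((k - 2) * 2 ^ k.-1))%N.
  by rewrite -mulnA mulnCA leq_mul2l e2 orbT.
have : (0 < 2 ^ k.-1)%N by rewrite expn_gt0.
nia.
Qed.

End NoPiece.

(** * Loopless graphs with a cut vertex *)

Section Pieces.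
Variables (V E : finType) (src tgt : E -> V).
Variables (A : {group {perm dart E}}) (g : nat).
Notation D := (dart E).
Notation org := (@org V E src tgt).
Notation deg u := #|[set d | org d == u]|.
Hypothesis Arev : forall s d, s \in A -> s (rev d) = rev (s d).
Hypothesis Aorg : forall s d d', s \in A -> org d = org d' -> org (s d) = org (s d').
Hypothesis conn : forall T : {set V}, T != set0 ->
  (forall d, org d \in T -> org (rev d) \in T) -> T = setT.
Hypothesis deg3 : forall v, (3 <= deg v)%N.
Hypothesis genus : #|E|.+1 = (g + #|V|)%N.
Hypothesis g2 : (2 <= g)%N.
Hypothesis loopless : loops src tgt = set0.

Lemma piece_boundary u X : piece src tgt u X ->
  exists2 d, org d \in X & org (rev d) = u.
Proof.
case/and4P => X0 uX _ /forallP Xu.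
have /existsP[d /andP[dX /eqP du]] : [exists d, (org d \in X) && (org (rev d) == u)]; last by exists d.
apply: contraT => /existsPn nd; have XT : X = setT.
  apply: conn => // d dX; have := Xu d; rewrite dX !inE => /orP[du|//].
  by have := nd d; rewrite dX du.
by rewrite XT inE in uX.
Qed.

(** The genus of a piece together with [u] is [#|touch X| - #|X|]. It is at least two
    because there are no loops: count the darts at [X], at least three at each
    vertex, and those from [u] to [X]. *)
Lemma piece_genus u X : piece src tgt u X -> (#|X|.+2 <= #|touch src tgt X|)%N.
Proof.
move=> pX; have [d0 d0X d0u] := piece_boundary pX.
case/and4P: pX => X0 uX _ /forallP Xu.
pose B := [set d | (org d \notin X) && (org (rev d) \in X)].
have cT : (#|vdarts src tgt X| + #|B| = #|touch src tgt X|.*2)%N.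
  rewrite -card_fdarts -(cardsID (vdarts src tgt X) (fdarts _)); congr addn; apply: eq_card => d.
    by rewrite in_setI [d \in fdarts _]inE touchP inE andb_idl// => ->.
  by rewrite in_setD [d \in fdarts _]inE touchP !inE; case: (_ \in X).
have cX : (3 * #|X| <= #|vdarts src tgt X|)%N.
  rewrite -[X in (_ <= X)%N]sum1_card (partition_big org (mem X))/=; last by move=> d; rewrite inE.
  rewrite mulnC -sum_nat_const; apply: leq_sum => v vX.
  apply: leq_trans (deg3 v) _; rewrite -sum1_card; apply: eq_leq; apply: eq_bigl => d.
  by rewrite !inE; case: eqP => [->|_]; rewrite ?vX ?andbF.
have B0 : (0 < #|B|)%N.
  by apply/card_gt0P; exists (rev d0); rewrite inE revK d0X d0u uX.
have X1 : (0 < #|X|)%N by rewrite card_gt0.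
(* a single vertex sends all its darts to u, which improves the count *)
have [x1|x2] : #|X| = 1%N \/ (2 <= #|X|)%N by lia.
  have : (3 <= #|B|)%N.
    have /cards1P[v Xv] : #|X| == 1%N by apply/eqP.
    apply: leq_trans (deg3 v) _; rewrite -(card_imset _ (can_inj (@revK E))).
    apply/subset_leq_card/subsetP => _ /imsetP[d + ->]; rewrite !inE revK Xv !inE => dv.
    by rewrite dv andbT -(eqP dv) org_rev.
  by lia.
by lia.
Qed.

Lemma piece_compl u X : piece src tgt u X -> piece src tgt u (~: (u |: X)).
Proof.
case/and4P => X0 uX XT /forallP Xu; apply/and4P; split.
- by apply: contraNneq XT => /(congr1 (@setC _)); rewrite setCK setC0 => ->.
- by rewrite !inE eqxx.
- apply: contraNneq X0 => /setP T; apply/eqP/setP => v; have := T v.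
  rewrite !inE negb_or; have [->|_]/= := eqVneq v u; first by rewrite (negbTE uX).
  by move=> /negbTE.
- apply/forallP => d; apply/implyP; rewrite !inE negb_or => /andP[du dX].
  have [//|/= d'u] := eqVneq (org (rev d)) u; apply/negP => d'X.
  by have := Xu (rev d); rewrite d'X revK !inE (negbTE du) (negbTE dX).
Qed.

Lemma touch_compl u X : piece src tgt u X ->
  touch src tgt (~: (u |: X)) = ~: touch src tgt X.
Proof.
case/and4P => X0 uX XT /forallP Xu; apply/setP => e.
rewrite in_setC; set d : D := (e, false).
rewrite [LHS](touchP src tgt _ d) (touchP src tgt X d : (e \in _) = _).
have nuu : ~~ ((org d == u) && (org (rev d) == u)).
  by apply/negP => /andP[/eqP du /eqP d'u]; have := org_rev loopless d; rewrite du d'u eqxx.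
have := Xu d; have := Xu (rev d); rewrite revK !inE !negb_or; move: nuu.
by case: (_ == u); case: (_ == u); case: (_ \in X); case: (_ \in X).
Qed.

(** A piece together with [u] is a graph pointed at [u] in which the other vertices
    keep all their darts. *)
Lemma piece_bound u X (H : {group {perm D}}) : piece src tgt u X -> H \subset A ->
  (forall s, s \in H -> s @: vdarts src tgt X = vdarts src tgt X) ->
  (forall s d, s \in H -> org d = u -> org (s d) = u) /\
  (#|H : 'C_H(fdarts (touch src tgt X) | 'P)| <= hyperoct (#|touch src tgt X| - #|X|))%N.
Proof.
move=> pX /subsetP HA HX; have [d0 d0X d0u] := piece_boundary pX.
have tX := piece_genus pX.
case/and4P: pX => X0 uX _ /forallP Xu.
have HX' s d : s \in H -> (org (s d) \in X) = (org d \in X).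
  move=> sH; have := HX _ sH => /setP/(_ (s d)); rewrite inE => <-.
  by rewrite mem_imset ?inE//; exact: perm_inj.
have Hu s d : s \in H -> org d = u -> org (s d) = u.
  move=> sH du; rewrite (Aorg (HA _ sH) (etrans du (esym d0u))) Arev ?HA//.
  have := Xu (s d0); rewrite HX'// d0X in_setU1 => /orP[/eqP//|].
  by rewrite -Arev ?HA// HX'// d0u (negbTE uX).
split=> //; have := @pointed_bound V E src tgt H (touch src tgt X) (u |: X) u.
rewrite cardsU1 uX add1n subSS => -[].
- by move=> s d /HA; exact: Arev.
- by move=> s d d' /HA; exact: Aorg.
- by move=> s d sH; rewrite !touchP -Arev ?HA// !HX'.
- exact: Hu.
- move=> d; rewrite touchP in_setU1 => /orP[->|d'X]; first by rewrite orbT.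
  by have := Xu (rev d); rewrite d'X revK in_setU1.
- by rewrite !inE eqxx.
- move=> T uT cT; apply/subsetP => v; rewrite in_setU1 => /orP[/eqP->//|vX].
  apply: contraT => vT; have YT : X :\: T = setT.
    apply: conn; first by apply/set0Pn; exists v; rewrite inE vT.
    move=> d; rewrite !in_setD => /andP[dT dX].
    have d'T : org (rev d) \notin T.
      apply: contra dT => d'T; rewrite -(revK d); apply: cT => //.
      by rewrite touchP revK dX orbT.
    rewrite d'T; have := Xu d; rewrite dX in_setU1 => /orP[/eqP d'u|//].
    by rewrite d'u uT in d'T.
  by have := in_setT u; rewrite -YT inE uT.
- move=> v; rewrite in_setU1 => /orP[/eqP->|vX]; first by left=> s d sH; exact: Hu.
  right; apply: leq_trans (deg3 v) _; apply/subset_leq_card/subsetP => d.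
  by rewrite inE => /eqP dv; rewrite inE [_ \in fdarts _]inE touchP dv vX eqxx.
- by [].
Qed.

(** Minimal among the pieces of all vertices, not only those of [u]. *)
Definition minpiece u X := piece src tgt u X /\
  forall v Y, piece src tgt v Y -> (#|X| <= #|Y|)%N.

(** If each root lies in the other piece, then the two pieces cover the graph, as
    nothing leads out of them. The complement of the first piece is then a piece
    strictly inside the second. *)
Lemma minpiece_not_crossed u X v Y : minpiece u X -> minpiece v Y ->
  u \in Y -> v \in X -> False.
Proof.
move=> [pX mX] [pY mY] uY vX.
have XY : X :|: Y = setT.
  apply/eqP; apply: contraT => XYT.
  have WT : ~: (X :|: Y) = setT.
    apply: conn => [|d].
      by apply: contra XYT => /eqP/(congr1 (@setC _)); rewrite setCK setC0 => ->.
    rewrite !inE !negb_or => /andP[dX dY]; apply/andP; split; apply/negP => d'.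
      case/and4P: pX => _ _ _ /forallP/(_ (rev d)); rewrite d' revK in_setU1 (negbTE dX) orbF.
      by move=> /eqP du; rewrite du uY in dY.
    case/and4P: pY => _ _ _ /forallP/(_ (rev d)); rewrite d' revK in_setU1 (negbTE dY) orbF.
    by move=> /eqP dv; rewrite dv vX in dX.
  by have := in_setT v; rewrite -WT !inE vX.
have := mY _ _ (piece_compl pX); rewrite leqNgt; case/negP.
apply: (@leq_ltn_trans #|Y :\ u|); last by rewrite [X in (_ < X)%N](cardsD1 u) uY.
apply/subset_leq_card/subsetP => w; rewrite !inE negb_or => /andP[-> wX].
by have := in_setT w; rewrite -XY inE (negbTE wX).
Qed.

(** Nothing but [u] can be reached from [X :&: Y], which is therefore a piece; by
    minimality it is all of [X] and all of [Y]. *)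
Lemma minpiece_half u X v Y : minpiece u X -> minpiece v Y ->
  X :&: Y != set0 -> v \notin X -> X = Y.
Proof.
move=> mpX mpY XY0 vX; have [pX mX] := mpX; have [pY mY] := mpY.
have cXY : #|X| = #|Y| by apply/eqP; rewrite eqn_leq (mX _ _ pY) (mY _ _ pX).
have XuP d : org d \in X -> org (rev d) \in u |: X.
  by case/and4P: pX => _ _ _ /forallP/(_ d)/implyP.
have YvP d : org d \in Y -> org (rev d) \in v |: Y.
  by case/and4P: pY => _ _ _ /forallP/(_ d)/implyP.
have uX : u \notin X by case/and4P: pX.
have vY : v \notin Y by case/and4P: pY.
suff : piece src tgt u (X :&: Y).
  move=> /mX le; have XI : X :&: Y = X by apply/eqP; rewrite eqEcard subsetIl.
  by apply/eqP; rewrite eqEcard cXY leqnn andbT -XI subsetIr.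
apply/and4P; split => //.
- by rewrite inE (negbTE uX).
- have [uv|uv] := eqVneq u v.
    case/and4P: pX => _ _ + _; apply: contraNneq => T; apply/eqP/setP => w.
    by have /setP/(_ w) := T; rewrite !inE => /orP[->//|/andP[->]]; rewrite orbT.
  apply/eqP => /setP/(_ v); rewrite !inE eq_sym (negbTE uv) (negbTE vX)//.
- apply/forallP => d; apply/implyP; rewrite inE => /andP[/XuP + /YvP].
  rewrite !inE => /orP[->//|d'X] /orP[/eqP d'v|->]; last by rewrite d'X orbT.
  by rewrite d'v (negbTE vX) in d'X.
Qed.

Lemma minpiece_disjoint u X v Y : minpiece u X -> minpiece v Y ->
  X :&: Y != set0 -> X = Y.
Proof.
move=> mX mY XY; have [vX|vX] := boolP (v \in X); last exact: minpiece_half mX mY XY vX.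
have [uY|uY] := boolP (u \in Y); first by case: (minpiece_not_crossed mX mY uY vX).
by apply/esym; apply: minpiece_half mY mX _ uY; rewrite setIC.
Qed.

(** If [u] were in [Y], disjoint from [X], then a dart from [X] to [u] would enter
    [Y], and it can only do so from [v]: the pieces would be crossed. *)
Lemma minpiece_root u X v Y : minpiece u X -> minpiece v Y -> u \notin Y.
Proof.
move=> mX mY; apply/negP => uY.
have uX : u \notin X by case: mX => /and4P[].
have [XY|XY] := eqVneq (X :&: Y) set0; last first.
  by rewrite (minpiece_disjoint mX mY XY) uY in uX.
have [d dX du] := piece_boundary mX.1.
apply: (minpiece_not_crossed mX mY uY).
case: mY => /and4P[_ _ _ /forallP/(_ (rev d))] + _; rewrite du uY revK in_setU1.
case/orP => [/eqP <-//|dY].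
by have := in_set0 (org d); rewrite -XY inE dX dY.
Qed.

Let va := vact (src := src) (tgt := tgt) deg3.

Let va_inj s : s \in A -> injective (va s).
Proof. by move=> sA; exact: can_inj (vactK Aorg deg3 sA). Qed.

Lemma minpiece_im s u X : s \in A -> minpiece u X -> minpiece (va s u) (va s @: X).
Proof.
move=> sA [/and4P[X0 uX XT /forallP Xu] mX].
split; last by move=> v Y /mX; rewrite card_imset//; exact: va_inj.
apply/and4P; split.
- by rewrite imset_eq0.
- by rewrite mem_imset//; exact: va_inj.
- rewrite -(imsetU1 (va s)); apply: contraNneq XT => /(congr1 (fun Y : {set V} => #|Y|)).
  by rewrite card_imset => [cX|]; [rewrite eqEcard subsetT cX leqnn|exact: va_inj].
- apply/forallP => d; apply/implyP; rewrite -(permKV s d) -Arev//.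
  rewrite -(imsetU1 (va s)) -[org (s (s^-1 d))](vactE Aorg deg3)//.
  rewrite -[org (s (rev _))](vactE Aorg deg3)// !mem_imset; try exact: va_inj.
  exact/implyP.
Qed.

(** The translates of a minimal piece are disjoint and avoid its root, so there are
    fewer than [#|V|], and [#|V| <= 2 * g - 2]. The stabiliser acts on the piece,
    and what acts trivially there acts on the complementary piece. *)
Lemma piece_strict u X : piece src tgt u X -> (#|A| < hyperoct g)%N.
Proof.
move=> p0; pose P n := [exists v, [exists Y, piece src tgt v Y && (#|Y| == n)]].
have exP : exists n, P n.
  by exists #|X|; apply/existsP; exists u; apply/existsP; exists X; rewrite p0 eqxx.
have [n /existsP[{p0}v /existsP[Y /andP[pY /eqP cY]]] nmin] := ex_minnP exP.
have mY : minpiece v Y.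
  split=> // w Z pZ; rewrite cY; apply: nmin; apply/existsP; exists w.
  by apply/existsP; exists Z; rewrite pZ eqxx.
pose M := [set Z : {set V} | (#|Z| == n) && [exists w, piece src tgt w Z]].
have MP Z : Z \in M -> exists w, minpiece w Z.
  rewrite inE => /andP[/eqP cZ /existsP[w pZ]]; exists w; split=> // w' Z' pZ'.
  by rewrite cZ -cY; exact: mY.2 pZ'.
have PM w Z : minpiece w Z -> Z \in M.
  move=> [pZ mZ]; rewrite inE; apply/andP; split; last by apply/existsP; exists w.
  by rewrite eqn_leq -cY (mY.2 _ _ pZ) (mZ _ _ pY).
pose H := setstab A (vdarts src tgt Y).
have HP s : s \in H -> s \in A /\ s @: vdarts src tgt Y = vdarts src tgt Y.
  by move=> /in_setstabP.
have HA : H \subset A by exact: setstab_sub.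
have Mle : (#|M| < #|V|)%N.
  have tM : trivIset M.
    apply/trivIsetP => Z Z' /MP[w mZ] /MP[w' mZ'] ZZ'; rewrite -setI_eq0.
    by apply: contraNT ZZ' => /(minpiece_disjoint mZ mZ') ->.
  have : (#|M| <= #|cover M|)%N.
    rewrite -(eqP tM) -sum1_card leq_sum// => Z /MP[w [/and4P[Z0 _ _ _] _]].
    by rewrite card_gt0.
  move/leq_ltn_trans; apply; rewrite -cardsT; apply: proper_card.
  rewrite properT; apply/negP => /eqP cT; have := in_setT v; rewrite -cT.
  by case/bigcupP => Z /MP[w mZ]; apply/negP; exact: minpiece_root mY mZ.
have AH : (#|A : H| <= #|M|)%N.
  apply: (@leq_trans #|vdarts src tgt @: M|); last exact: leq_imset_card.
  apply: index_setstab => s sA; rewrite (vdarts_im Aorg deg3)// imset_f//.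
  exact: PM (minpiece_im sA mY).
have [Hv H1] := piece_bound pY HA (fun s sH => (HP s sH).2).
pose Yc := ~: (v |: Y); have pYc : piece src tgt v Yc by exact: piece_compl.
pose K := 'C_H(fdarts (touch src tgt Y) | 'P)%G.
have KH : K \subset H by exact: subsetIl.
have KYc s : s \in K -> s @: vdarts src tgt Yc = vdarts src tgt Yc.
  move=> sK; have sH := subsetP KH _ sK; have [sA sY] := HP _ sH.
  apply/eqP; rewrite eqEcard card_imset ?leqnn ?andbT; last exact: perm_inj.
  apply/subsetP => _ /imsetP[d + ->]; rewrite !inE !negb_or => /andP[dv dY].
  apply/andP; split.
    apply: contra dv => /eqP sdv.
    by have := Hv _ _ (groupVr sH) sdv; rewrite permK => ->.
  apply: contra dY => sdY; have : s d \in s @: vdarts src tgt Y by rewrite sY inE.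
  by rewrite mem_imset ?inE//; exact: perm_inj.
have [_ K1] := piece_bound pYc (subset_trans KH HA) KYc.
have KC : 'C_K(fdarts (touch src tgt Yc) | 'P) = 1 :> {set _}.
  rewrite -[RHS](stab_setT A) (touch_compl pY).
  apply: stab_eq => [|s sA]; first exact: subset_trans KH HA.
  split=> [[/in_stabP[_ sY] sF] d _|sT].
    by have [dF|dF] := boolP (d.1 \in touch src tgt Y); [apply: sY|apply: sF]; rewrite inE // in_setC.
  have sT' d : s d = d by apply: sT; rewrite inE.
  split=> [|d _]; last exact: sT'.
  apply/in_stabP; split=> [|d _]; last exact: sT'.
  by apply/in_setstabP; split=> //; rewrite -[RHS]imset_id; apply: eq_imset.
rewrite KC indexg1 in K1.
have cA : #|A| = (#|A : H| * (#|H : K| * #|K|))%N.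
  by rewrite (mulnC #|H : K|) Lagrange// mulnC Lagrange.
have hY := piece_genus pY; have hYc := piece_genus pYc.
have cE : (#|touch src tgt Y| + #|touch src tgt Yc| = #|E|)%N.
  by rewrite (touch_compl pY) cardsC.
have cV : (#|Y| + #|Yc| + 1 = #|V|)%N.
  rewrite -(cardsC (v |: Y)) cardsU1 (_ : v \notin Y); first by rewrite -/Yc; lia.
  by case/and4P: pY.
pose h := (#|touch src tgt Y| - #|Y|)%N; pose h' := (#|touch src tgt Yc| - #|Yc|)%N.
have gE : g = (h + h')%N by rewrite /h /h'; lia.
have V3 := card_vertices_le deg3.
rewrite cA [in ltnRHS]gE hyperoctD.
apply: (@leq_ltn_trans (#|M| * (hyperoct h * hyperoct h'))%N).
  by rewrite leq_mul// leq_mul.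
have := hyperoct_gt0 h; have := hyperoct_gt0 h' => h0' h0.
rewrite ltn_pmul2r; last by rewrite -[0]/(0 * 0)%N ltn_mul.
have h1 : (1 < h)%N by rewrite /h; lia.
have h1' : (1 < h')%N by rewrite /h'; lia.
by have := bin_mid_gt h1 h1'; rewrite -gE; lia.
Qed.

End Pieces.

(** * The largest order *)

Section Extremal.
Variables (V E : finType) (src tgt : E -> V).
Variables (A : {group {perm dart E}}) (g : nat).
Notation D := (dart E).
Notation org := (@org V E src tgt).
Notation loops := (loops src tgt).
Hypothesis Arev : forall s d, s \in A -> s (rev d) = rev (s d).
Hypothesis Aorg : forall s d d', s \in A -> org d = org d' -> org (s d) = org (s d').
Hypothesis conn : forall T : {set V}, T != set0 ->
  (forall d, org d \in T -> org (rev d) \in T) -> T = setT.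
Hypothesis deg3 : forall v, (3 <= #|[set d | org d == v]|)%N.
Hypothesis genus : #|E|.+1 = (g + #|V|)%N.
Hypothesis g2 : (2 <= g)%N.

Definition edge_transitive (F : {set E}) :=
  forall e e', e \in F -> e' \in F -> exists2 s, s \in A & (s (e, false)).1 = e'.

Lemma edge_of_dart s d (e : E) : s \in A -> d.1 = e -> (s (e, false)).1 = (s d).1.
Proof.
move=> sA de; have [->|->] := same_edge (de : d.1 = (e, false).1); rewrite ?Arev//.
Qed.

(** Both vertices have degree [g + 1], and what fixes the darts at one of them is
    trivial. *)
Lemma two_vertices : #|V| = 2 -> loops = set0 ->
  (#|A| <= 2 * g.+1`!)%N /\ (#|A| = (2 * g.+1`!)%N -> edge_transitive setT).
Proof.
move=> V2 loopless.
have nopiece v X : ~~ piece src tgt v X.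
  apply/negP => /and4P[X0 vX XT _]; have : (#|v |: X| < #|V|)%N.
    by rewrite -cardsT proper_card// properT.
  by rewrite cardsU1 vX; move: X0; rewrite -card_gt0; lia.
have [u _] : exists2 u : V, u \in setT & true.
  have /card_gt0P[u _] : (0 < #|V|)%N by rewrite V2.
  by exists u; rewrite ?inE.
move=> _.
have tu e : e \in touch src tgt [set u].
  apply: contraT; rewrite !inE negb_or => /andP[su tu].
  have := org_rev loopless (e, false); rewrite /org/= => st.
  have := subset_leq_card (subsetT [set u; src e; tgt e]).
  by rewrite cardsT V2 setUC cardsU1 cards2 !inE (negbTE tu) (negbTE st) eq_sym su.
have du : #|[set d | org d == u]| = g.+1.
  rewrite -(card_touch1 loopless); have -> : touch src tgt [set u] = setT.
    by apply/setP => e; rewrite tu inE.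
  by rewrite cardsT; move: genus; rewrite V2; lia.
have [_ cA a2 hk k0] := star_bound Arev Aorg deg3 genus g2 loopless (nopiece u).
rewrite du subnn in hk k0.
have {k0} : (#|star_stab src tgt A u| <= 1)%N by exact: k0.
set H := vertex_stab _ _ _ _ in cA a2 hk *; set K := star_stab _ _ _ _ in cA hk * => k1.
rewrite V2 in a2; split.
  by rewrite cA -[leqRHS]muln1 leq_mul// leq_mul.
move=> full; have hE : #|H : K| = g.+1`!.
  apply/eqP; rewrite eqn_leq hk -(@leq_pmul2l 2)// -full cA.
  by rewrite -[leqRHS]muln1 leq_mul// leq_mul.
have vdE : vdarts src tgt [set u] = [set d | org d == u].
  by apply/setP => d; rewrite !inE.
have HP s : s \in H -> s \in A /\ s @: vdarts src tgt [set u] = vdarts src tgt [set u].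
  by move=> /in_setstabP.
have Hu s y : s \in H -> y \in vdarts src tgt [set u] -> s y \in vdarts src tgt [set u].
  by move=> /HP[_ {2}<-] yu; apply: imset_f.
have full' : #|H : 'C_H(vdarts src tgt [set u] | 'P)| = #|vdarts src tgt [set u]|`!.
  by rewrite [in RHS]vdE du.
have atu e : exists2 d : D, d \in vdarts src tgt [set u] & d.1 = e.
  have := tu e; rewrite inE => /orP[] eu; first by exists (e, false); rewrite // inE.
  by exists (e, true); rewrite // inE.
move=> e e' _ _; have [d ud de] := atu e; have [d' ud' de'] := atu e'.
have [s sH sd] := (full_index_perm Hu full' ud).1 d' ud'.
by have [sA _] := HP _ sH; exists s => //; rewrite (edge_of_dart sA de) sd.
Qed.

Lemma order_loops : loops != set0 -> (#|A| <= hyperoct g)%N /\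
  (3 <= g -> #|A| = hyperoct g ->
    #|loops| = g /\ #|A : 'C_A(fdarts loops | 'P)| = hyperoct #|loops|)%N.
Proof.
rewrite -card_gt0 => L0; have [Lg [h1 h2]] := loops_bound Arev Aorg conn deg3 genus g2 L0.
have cA : #|A| = (#|A : 'C_A(fdarts loops | 'P)| * #|'C_A(fdarts loops | 'P)|)%N.
  by rewrite mulnC Lagrange// subsetIl.
have gE : g = (#|loops| + (g - #|loops|))%N by rewrite subnKC.
have le : (#|A| <= hyperoct #|loops| * hyperoct (g - #|loops|))%N.
  by rewrite cA leq_mul.
split; first by rewrite gE; exact: leq_trans le (hyperoct_le _ _).
move=> g3 full; have LE : #|loops| = g.
  apply/eqP; rewrite eqn_leq Lg/= leqNgt; apply/negP => Llt.
  move: le; rewrite full leqNgt => /negP; apply; rewrite [in ltnRHS]gE.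
  by apply: hyperoct_strict; lia.
split=> //; apply/eqP; rewrite eqn_leq h1/= LE -full cA.
by rewrite LE subnn in h2; rewrite -[leqRHS]muln1 leq_mul.
Qed.

Lemma order_loopless : loops = set0 -> #|V| = 2 \/ (#|A| < hyperoct g)%N.
Proof.
move=> loopless; have [/existsP[u /existsP[X pX]]|np] :=
  boolP [exists u, [exists X, piece src tgt u X]].
  by right; apply: piece_strict pX.
apply: (nopiece_bound Arev Aorg deg3 genus g2 loopless) => v X; apply: contra np => pX.
by apply/existsP; exists v; apply/existsP; exists X.
Qed.

Lemma order_bound : (#|A| <= aut_bound g)%N.
Proof.
rewrite /aut_bound -/(hyperoct g); have g2E : ~~ (3 <= g)%N -> g = 2 by lia.
have f2 : hyperoct 2 = 8 by [].
have [/eqP loopless|/order_loops[le _]] := boolP (loops == set0); last first.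
  by case: ifPn => // /g2E gE; apply: leq_trans le _; rewrite gE.
have [V2|lt] := order_loopless loopless; last first.
  by case: ifPn => [_|/g2E gE]; [exact: ltnW|move: lt; rewrite gE f2; lia].
have [le _] := two_vertices V2 loopless; apply: leq_trans le _.
case: ifPn => [g3|/g2E gE]; last by rewrite gE.
have [->//|g4] : g = 3 \/ (4 <= g)%N by lia.
exact/ltnW/banana_order_lt.
Qed.

Lemma loopless_extremal : #|A| = aut_bound g -> loops = set0 ->
  [/\ g = 2 \/ g = 3, #|V| = 2 & edge_transitive setT].
Proof.
rewrite /aut_bound -/(hyperoct g) => full loopless; have f2 : hyperoct 2 = 8 by [].
have g2E : ~~ (3 <= g)%N -> g = 2 by lia.
have [V2|lt] := order_loopless loopless; last first.
  by move: lt; rewrite full; case: ifPn => [_|/g2E ->]; rewrite ?ltnn.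
have [le tr] := two_vertices V2 loopless.
have g23 : g = 2 \/ g = 3.
  have [->|[->|g4]] : g = 2 \/ g = 3 \/ (4 <= g)%N by lia.
  - by left.
  - by right.
  - move: le; rewrite full; have -> : (2 < g)%N by lia.
    by rewrite leqNgt banana_order_lt.
by split=> //; apply: tr; rewrite full; case: g23 => ->.
Qed.

End Extremal.

(** * The extremal graphs with loops *)

Section LoopsExtremal.
Variables (V E : finType) (src tgt : E -> V).
Variables (A : {group {perm dart E}}) (g : nat).
Notation D := (dart E).
Notation org := (@org V E src tgt).
Notation loops := (loops src tgt).
Hypothesis Arev : forall s d, s \in A -> s (rev d) = rev (s d).
Hypothesis Aorg : forall s d d', s \in A -> org d = org d' -> org (s d) = org (s d').
Hypothesis conn : forall T : {set V}, T != set0 ->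
  (forall d, org d \in T -> org (rev d) \in T) -> T = setT.
Hypothesis deg3 : forall v, (3 <= #|[set d | org d == v]|)%N.
Hypothesis genus : #|E|.+1 = (g + #|V|)%N.
Hypothesis g3 : (3 <= g)%N.
Hypothesis cL : #|loops| = g.
Hypothesis full : #|A : 'C_A(fdarts loops | 'P)| = hyperoct #|loops|.

(** In the extremal case the graph has genus [g] and [g] loops, so that the other
    edges form a tree. *)
Definition bridge_darts v := [set d | (d.1 \notin loops) && (org d == v)].

Lemma in_bridge v d : (d \in bridge_darts v) = (d.1 \notin loops) && (org d == v).
Proof. exact: in_set. Qed.

Let loop_inv s d : s \in A -> ((s d).1 \in loops) = (d.1 \in loops).
Proof. exact: loops_inv. Qed.

Let trans1 x y : x.1 \in loops -> y.1 \in loops -> exists2 s, s \in A & s x = y.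
Proof.
move=> xL yL; apply: (full_index_edges Arev _ full xL).1 => // s d sA.
by rewrite loop_inv.
Qed.

Let trans2 x y z : x.1 \in loops -> y.1 \in loops -> z.1 \in loops ->
  y.1 != x.1 -> z.1 != x.1 -> exists2 s, s \in A & s x = x /\ s y = z.
Proof.
move=> xL yL zL yx zx; apply: (full_index_edges2 Arev _ full) => // s d sA.
by rewrite loop_inv.
Qed.

Let org_loop d : d.1 \in loops -> org d = src d.1.
Proof. by case: d => e []; rewrite inE /org//= => /eqP. Qed.

Lemma sum_bridge_darts : (\sum_v #|bridge_darts v| = (#|V| - 1).*2)%N.
Proof.
transitivity #|fdarts (~: loops)|.
  rewrite -sum1_card (partition_big org predT)//=.
  by apply: eq_bigr => v _; rewrite -sum1_card; apply: eq_bigl => d; rewrite !inE.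
rewrite card_fdarts; have := cardsC loops; move: genus; rewrite cL.
by move=> gen cE; congr double; move: gen; rewrite -cE; lia.
Qed.

Lemma bridge_darts_ge3 v : (forall e, e \in loops -> src e != v) ->
  (3 <= #|bridge_darts v|)%N.
Proof.
move=> nv; apply: leq_trans (deg3 v) _; apply/subset_leq_card/subsetP => d.
rewrite 2!inE => dv; rewrite dv andbT; apply/negP => dL.
by have := nv _ dL; rewrite -(org_loop dL) dv.
Qed.

(** By double transitivity, if two loops share their vertex then all do. The other
    vertices would then have degree at least three in the tree of bridges, which
    leaves room for none. *)
Lemma bouquet_or_injective :
  (#|V| = 1%N /\ edge_transitive A setT) \/ {in loops &, injective src}.
Proof.
have [/existsP[e1 /existsP[e2 /and4P[e1L e2L e12 /eqP s12]]]|ninj] := boolP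
  [exists e1, [exists e2, [&& e1 \in loops, e2 \in loops, e1 != e2 & src e1 == src e2]]]; last first.
  right=> e1 e2 e1L e2L s12; apply/eqP; apply: contraNT ninj => e12.
  by apply/existsP; exists e1; apply/existsP; exists e2; rewrite e1L e2L e12 s12 eqxx.
left; have base e : e \in loops -> src e = src e1.
  move=> eL; have [->//|ee1] := eqVneq e e1.
  rewrite eq_sym in e12.
  have [s sA [s1 s2]] := @trans2 (e1, false) (e2, false) (e, false) e1L e2L eL e12 ee1.
  have : org (s (e2, false)) = org (s (e1, false)) by apply: Aorg.
  by rewrite s1 s2.
have V1 : #|V| = 1%N.
  have := sum_bridge_darts; rewrite (bigD1 (src e1))//=.
  have : (\sum_(v | v != src e1) 3 <= \sum_(v | v != src e1) #|bridge_darts v|)%N.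
    apply: leq_sum => v vw; apply: bridge_darts_ge3 => e eL.
    by rewrite base// eq_sym.
  rewrite sum_nat_const cardC1; set S := (\sum_(_ | _) _)%N => le1 le2.
  have : (0 < #|V|)%N by apply/card_gt0P; exists (src e1).
  by move: le1 le2; move: S #|V| #|bridge_darts _| => S n k; lia.
split=> // e e' _ _; have allL x : x \in loops.
  have /card_le1_eqP V1' : (#|V| <= 1)%N by rewrite V1.
  by rewrite inE; apply/eqP; exact: V1'.
by have [s sA se] := @trans1 (e, false) (e', false) (allL e) (allL e'); exists s; rewrite ?se.
Qed.

(** The loops sit at distinct, equivalent vertices, which the sum of degrees in the
    tree of bridges forces to be leaves. By double transitivity their bridges lead
    all to the same vertex or to distinct ones, and not to a leaf. Distinct ones
    would again be too many for the sum of degrees; if they are the same vertex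
    [p], it has degree at least [g] in the tree, and there is room for no other. *)
Lemma lollipop_structure : {in loops &, injective src} -> exists p : V,
  [/\ forall e, e \in loops -> src e != p,
      forall v, v = p \/ exists2 e, e \in loops & src e = v,
      forall e, e \in loops -> exists2 d, bridge_darts (src e) = [set d] & org (rev d) = p,
      edge_transitive A loops & edge_transitive A (~: loops)].
Proof.
move=> inj; pose B := src @: loops.
have cB : #|B| = g by rewrite card_in_imset.
have cV : #|V| = (g + #|~: B|)%N by rewrite -(cardsC B) cB.
have OP v : v \in ~: B -> (3 <= #|bridge_darts v|)%N.
  rewrite inE => vB; apply: bridge_darts_ge3 => e eL.
  by apply: contraNneq vB => <-; apply: imset_f.
have sumE : (\sum_(v in B) #|bridge_darts v| + \sum_(v in ~: B) #|bridge_darts v| = (#|V| - 1).*2)%N.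
  rewrite -sum_bridge_darts [RHS](bigID (mem B))/=; congr addn.
  by apply: eq_bigl => v; rewrite inE.
have sO : (3 * #|~: B| <= \sum_(v in ~: B) #|bridge_darts v|)%N.
  by rewrite mulnC -sum_nat_const leq_sum.
have transL e e' : e \in loops -> e' \in loops -> exists2 s, s \in A & s (e, false) = (e', false).
  by move=> eL e'L; exact: trans1.
have im_bridge s e e' d : s \in A -> s (e, false) = (e', false) -> d \in bridge_darts (src e) ->
    s d \in bridge_darts (src e').
  rewrite !in_bridge => sA se /andP[dL /eqP de]; rewrite loop_inv// dL/=.
  by rewrite (Aorg sA (de : org d = org (e, false))) se.
have [e0 e0L] : exists e0, e0 \in loops by apply/card_gt0P; rewrite cL; lia.
have tdegE e : e \in loops -> #|bridge_darts (src e)| = #|bridge_darts (src e0)|.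
  have le a b : a \in loops -> b \in loops -> (#|bridge_darts (src a)| <= #|bridge_darts (src b)|)%N.
    move=> aL bL; have [s sA sab] := transL _ _ aL bL.
    rewrite -(card_imset _ (@perm_inj _ s)); apply/subset_leq_card/subsetP => _ /imsetP[d dB ->].
    exact: im_bridge sab dB.
  by move=> eL; apply/eqP; rewrite eqn_leq !le.
have sB : (\sum_(v in B) #|bridge_darts v| = g * #|bridge_darts (src e0)|)%N.
  by rewrite -cB -sum_nat_const; apply: eq_bigr => _ /imsetP[e eL ->]; rewrite tdegE.
(* the vertices that carry loops are leaves of the tree of bridges *)
have t1 : #|bridge_darts (src e0)| = 1%N.
  apply/eqP; rewrite eqn_leq; apply/andP; split; first by rewrite leqNgt; apply/negP => t2; nia.
  have /subsetPn[d] : ~~ ([set d | org d == src e0] \subset [set (e0, false); (e0, true)]).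
    apply: contraTN (deg3 (src e0)) => /subset_leq_card; rewrite cards2.
    by case: (_ != _); lia.
  rewrite !inE => /eqP de0 nd; apply/card_gt0P; exists d; rewrite in_bridge de0 eqxx andbT.
  apply: contraNN nd => dL.
  have : d.1 = e0 by apply: inj => //; rewrite -org_loop.
  by case: (d) => e [] /= ->; rewrite eqxx ?orbT.
have /fin_all_exists[td tdP] e : exists d, e \in loops -> bridge_darts (src e) = [set d].
  have [eL|] := boolP (e \in loops); last by exists (e, false).
  have /eqP/cards1P[d dE] : #|bridge_darts (src e)| = 1%N by rewrite tdegE.
  by exists d.
have tdL e : e \in loops -> (td e).1 \notin loops /\ org (td e) = src e.
  by move=> /tdP/setP/(_ (td e)); rewrite in_bridge in_set1 eqxx => /andP[-> /eqP].
have tdS s e e' : s \in A -> e \in loops -> e' \in loops -> s (e, false) = (e', false) -> s (td e) = td e'.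
  move=> sA eL e'L see'; have := im_bridge _ _ _ (td e) sA see'.
  by rewrite !tdP// !inE eqxx => /(_ isT)/eqP.
pose p e := org (rev (td e)).
(* if the bridge of e ended at the loop e', moving e' to a third loop while fixing e
   would give it another end *)
have pB e : e \in loops -> p e \notin B.
  move=> eL; apply/negP => /imsetP[e' e'L pe].
  have ee' : e' != e.
    apply: contraNneq (tdL _ eL).1 => e'e; by rewrite loopP (tdL _ eL).2 -/(p e) pe e'e.
  have [e'' e''L] : exists e'', e'' \in loops :\: [set e; e'].
    apply/card_gt0P; rewrite cardsD cL.
    by have := subset_leq_card (subsetIr loops [set e; e']); rewrite cards2 eq_sym ee'; lia.
  move: e''L; rewrite in_setD in_set2 negb_or -andbA => /and3P[e''e e''e' e''L].
  have [s sA [s1 s2]] := @trans2 (e, false) (e', false) (e'', false) eL e'L e''L ee' e''e.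
  have := Aorg sA (pe : org (rev (td e)) = org (e', false)).
  rewrite Arev// (tdS s e e)// s2 -/(p e) pe => /(inj _ _ e'L e''L) E'.
  by rewrite E' eqxx in e''e'.
have revtd_inj : {in loops &, injective (fun e => rev (td e))}.
  move=> a b aL bL /(can_inj (@revK E)) tdab; apply: inj => //.
  by rewrite -(tdL _ aL).2 -(tdL _ bL).2 tdab.
have [/existsP[a /existsP[b /and4P[aL bL ab /eqP pab]]]|ninj] := boolP
  [exists a, [exists b, [&& a \in loops, b \in loops, a != b & p a == p b]]]; last first.
  have : (#|p @: loops| <= #|~: B|)%N.
    by apply/subset_leq_card/subsetP => _ /imsetP[e eL ->]; rewrite inE pB.
  rewrite card_in_imset ?cL; first by rewrite sB t1 in sumE; lia.
  move=> a b aL bL pab; apply/eqP; apply: contraNT ninj => ab.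
  by apply/existsP; exists a; apply/existsP; exists b; rewrite aL bL ab pab eqxx.
have pc e : e \in loops -> p e = p a.
  move=> eL; have [->//|ea] := eqVneq e a; rewrite eq_sym in ab.
  have [s sA [s1 s2]] := @trans2 (a, false) (b, false) (e, false) aL bL eL ab ea.
  have := Aorg sA (pab : org (rev (td a)) = org (rev (td b))).
  by rewrite !Arev// (tdS s a a)// (tdS s b e).
have pO : p a \in ~: B by rewrite inE pB.
have cO : (#|~: B| <= 1)%N.
  have : (g <= #|bridge_darts (p a)|)%N.
    rewrite -cL -(card_in_imset revtd_inj); apply/subset_leq_card/subsetP => _ /imsetP[e eL ->].
    by rewrite in_bridge (tdL _ eL).1 -(pc e eL) /=.
  rewrite (bigD1 (p a) pO)/= sB t1 in sumE.
  have : (\sum_(v in ~: B | v != p a) 3 <= \sum_(v in ~: B | v != p a) #|bridge_darts v|)%N.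
    by apply: leq_sum => v /andP[vO _]; exact: OP.
  rewrite sum_nat_const (_ : #|_| = #|~: B|.-1); last first.
    rewrite [in RHS](cardsD1 (p a)) pO; apply: eq_card => v.
    by rewrite in_setD1 andbC.
  move=> le gle; move: sumE cV le gle; set S := (\sum_(_ | _) _)%N.
  by move: S #|V| #|~: B| #|bridge_darts _| => S n o k; lia.
have VP v : v = p a \/ exists2 e, e \in loops & src e = v.
  have [/imsetP[e eL ->]|vB] := boolP (v \in B); first by right; exists e.
  by left; apply: (card_le1_eqP cO); rewrite // inE.
exists (p a); split=> //.
- by move=> e eL; apply: contraNneq (pB a aL) => <-; apply: imset_f.
- by move=> e eL; exists (td e); [exact: tdP|exact: pc].
- by move=> e e' eL e'L; have [s sA se] := transL _ _ eL e'L; exists s; rewrite ?se.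
have bridgeP e : e \in ~: loops -> exists2 x, x \in loops & (td x).1 = e.
  move=> eL; have main d : d.1 = e -> org d <> p a -> exists2 x, x \in loops & (td x).1 = e.
    move=> de dp; have [//|[x xL xd]] := VP (org d); exists x => //.
    have : d \in bridge_darts (src x) by rewrite in_bridge de xd eqxx andbT -in_setC.
    by rewrite tdP// inE => /eqP <-.
  have [dp|dp] := eqVneq (org (e, false)) (p a); last by apply: (main (e, false)) => //; apply/eqP.
  apply: (main (e, true)) => // dp'; move: eL; rewrite !inE => /eqP; apply.
  exact: (etrans dp (esym dp')).
move=> e e' /bridgeP[x xL <-] /bridgeP[x' x'L <-].
have [s sA sx] := transL _ _ xL x'L; exists s => //.
by rewrite (edge_of_dart Arev sA (erefl (td x).1)) (tdS _ _ _ sA xL x'L sx).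
Qed.

End LoopsExtremal.

Local Close Scope group_scope.

From mathcomp Require Import all_classical all_reals all_analysis.
From mathcomp Require Import lra.

Import Order.TTheory GRing.Theory Num.Theory numFieldNormedType.Exports.

Local Open Scope classical_set_scope.
Local Open Scope card_scope.
Local Open Scope ring_scope.

(** * Metric graphs parametrised by darts *)

Notation gdart G := (dart (edge G)).
Notation gorg G := (org (@src G) (@tgt G)).

Section DartPoint.
Variables (R : realType) (G : multigraph) (l : length_function R G).
Implicit Types (d : gdart G) (s t : R).

Definition dart_point d t := edge_point l d.1 (if d.2 then l d.1 - t else t).

Lemma len_gt0 d : 0 < l d.1. Proof. exact: length_gt0. Qed.

Lemma dart_point_rev d t : dart_point (rev d) t = dart_point d (l d.1 - t).
Proof. by case: d => e []; rewrite /dart_point//= opprB addrC subrK. Qed.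

Lemma dart_point_org d : dart_point d 0 = Vertex l (gorg G d).
Proof.
by case: d => e []; rewrite /dart_point/= ?subr0 ?edge_point_src ?edge_point_tgt.
Qed.

Lemma dart_point_end d : dart_point d (l d.1) = Vertex l (gorg G (rev d)).
Proof. by rewrite -dart_point_org dart_point_rev subr0. Qed.

Lemma dart_point_edge e t : edge_point l e t = dart_point (e, false) t.
Proof. by []. Qed.

Lemma dart_point_int e (s : {t : R | 0 < t < l e}) : Interior s = dart_point (e, false) (sval s).
Proof. by rewrite -edge_point_int. Qed.

Lemma mdist_edge_le e s t : 0 <= s <= l e -> 0 <= t <= l e ->
  mdist (edge_point l e s) (edge_point l e t) <= `|s - t|.
Proof. by move=> sl tl; apply/path_dist_le/route1. Qed.

Lemma mdist_dart_le d s t : 0 <= s <= l d.1 -> 0 <= t <= l d.1 ->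
  mdist (dart_point d s) (dart_point d t) <= `|s - t|.
Proof.
case: d => e [] /=; rewrite /dart_point/= => sl tl; last exact: mdist_edge_le.
rewrite (_ : s - t = (l e - t) - (l e - s)); last by lra.
by rewrite distrC; apply: mdist_edge_le; lra.
Qed.

Lemma dart_pointP (x : metric_graph l) : (forall v, exists d, gorg G d = v) ->
  exists d t, 0 <= t <= l d.1 /\ x = dart_point d t.
Proof.
move=> dv; case: x => [v|e s].
  by have [d <-] := dv v; exists d, 0; rewrite dart_point_org lexx ltW ?len_gt0.
exists (e, false), (sval s); rewrite dart_point_int; split=> //=.
by case: s => /= s /andP[/ltW -> /ltW ->].
Qed.

End DartPoint.

Section Lipschitz.
Variables (R : realType) (G G' : multigraph).
Variables (l : length_function R G) (l' : length_function R G').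

(** The distance is the infimum over routes, and routes are made of segments of
    edges. *)
Lemma lipschitz_of_edges (f : metric_graph l -> metric_graph l') :
  (forall e s t, 0 <= s <= l e -> 0 <= t <= l e ->
    mdist (f (edge_point l e s)) (f (edge_point l e t)) <= `|s - t|) ->
  forall x y, mdist (f x) (f y) <= mdist x y.
Proof.
move=> lipf x y; apply: path_dist_ge => L xy.
have := @route_lip _ _ l (fun z => mdist (f z) (f y)) _ x y L xy.
rewrite mdistxx subr0; apply=> e s t sl tl.
by rewrite lerBlDr (le_trans (metric_triangle _ (f (edge_point l e t)) _))// lerD2r lipf.
Qed.

End Lipschitz.

Section DartIso.
Variables (R : realType) (G G' : multigraph).
Variables (l : length_function R G) (l' : length_function R G').
Variable f : gdart G -> gdart G'.
Hypothesis frev : forall d, f (rev d) = rev (f d).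
Hypothesis forg : forall d d', gorg G d = gorg G d' -> gorg G' (f d) = gorg G' (f d').
Hypothesis flen : forall d, l' (f d).1 = l d.1.
Hypothesis dart_at : forall v, exists d, gorg G d == v.

(** On a vertex any dart may be used, on an edge its given orientation. *)
Definition dart_map (x : metric_graph l) : metric_graph l' :=
  match x with
  | Vertex v => Vertex l' (gorg G' (f (xchoose (dart_at v))))
  | Interior e s => dart_point l' (f (e, false)) (sval s)
  end.

Lemma dart_mapE d t : 0 <= t <= l d.1 -> dart_map (dart_point l d t) = dart_point l' (f d) t.
Proof.
have orgE d' : Vertex l' (gorg G' (f (xchoose (dart_at (gorg G d'))))) = Vertex l' (gorg G' (f d')).
  by congr Vertex; apply: forg; exact/eqP/(xchooseP (dart_at _)).
have main' e u : 0 <= u <= l e -> dart_map (dart_point l (e, false) u) = dart_point l' (f (e, false)) u.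
  rewrite -dart_point_edge => te; have [[-> ->]|[-> ->]|[s' [-> ->]]] := edge_pointP te => //=.
    by rewrite (orgE (e, false)) dart_point_org.
  rewrite (orgE (e, true)) -(flen (e, false)) dart_point_end.
  by rewrite -frev.
case: d => e []; last exact: main'.
move=> /= /andP[t0 tl]; rewrite (dart_point_rev l (e, false) t) (frev (e, false)).
by rewrite dart_point_rev flen; apply: main' => /=; rewrite subr_ge0 tl lerBlDr lerDl.
Qed.

Lemma dart_map_lipschitz x y : mdist (dart_map x) (dart_map y) <= mdist x y.
Proof.
apply: lipschitz_of_edges => e s t sl tl.
by rewrite !dart_point_edge !dart_mapE// mdist_dart_le// flen.
Qed.

End DartIso.

Lemma dart_isometry (R : realType) (G G' : multigraph)
    (l : length_function R G) (l' : length_function R G')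
    (f : gdart G -> gdart G') :
  bijective f -> (forall d, f (rev d) = rev (f d)) ->
  (forall d d', gorg G d = gorg G d' <-> gorg G' (f d) = gorg G' (f d')) ->
  (forall d, l' (f d).1 = l d.1) ->
  (forall v, exists d, gorg G d == v) -> (forall v, exists d, gorg G' d == v) ->
  exists2 h : metric_graph l -> metric_graph l', is_isometry h &
    forall d t, 0 <= t <= l d.1 -> h (dart_point l d t) = dart_point l' (f d) t.
Proof.
move=> [f' fK f'K] frev forg flen dat dat'.
have f'rev d : f' (rev d) = rev (f' d) by rewrite -{1}(f'K d) -frev fK.
have forg1 d d' : gorg G d = gorg G d' -> gorg G' (f d) = gorg G' (f d') by case: (forg d d').
have f'org d d' : gorg G' d = gorg G' d' -> gorg G (f' d) = gorg G (f' d').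
  by move=> dd'; apply/forg; rewrite !f'K.
have f'len d : l (f' d).1 = l' d.1 by rewrite -flen f'K.
pose h := dart_map (l := l) l' f dat; pose h' := dart_map (l := l') l f' dat'.
have hE d t : 0 <= t <= l d.1 -> h (dart_point l d t) = dart_point l' (f d) t.
  exact: (dart_mapE frev forg1 flen).
have h'E d t : 0 <= t <= l' d.1 -> h' (dart_point l' d t) = dart_point l (f' d) t.
  exact: (dart_mapE f'rev f'org f'len).
have hK : cancel h h'.
  move=> x; have [|d [t [td ->]]] := dart_pointP x.
    by move=> v; have [d /eqP] := dat v; exists d.
  by rewrite hE// h'E ?flen// fK.
have h'K : cancel h' h.
  move=> x; have [|d [t [td ->]]] := dart_pointP x.
    by move=> v; have [d /eqP] := dat' v; exists d.
  by rewrite h'E// hE ?f'len// f'K.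
exists h => //; split; first by exists h'.
move=> x y; apply/eqP; rewrite eq_le dart_map_lipschitz//= -{1}(hK x) -{1}(hK y).
exact: dart_map_lipschitz.
Qed.

Section IsometryBasics.
Variables (R : realType).
Implicit Types X Y Z : metricType R.

Lemma isometry_inj X Y (f : X -> Y) : is_isometry f -> injective f.
Proof. by case=> /bij_inj. Qed.

Lemma isometry_comp X Y Z (f : X -> Y) (g : Y -> Z) :
  is_isometry f -> is_isometry g -> is_isometry (g \o f).
Proof.
move=> [bf df] [bg dg]; split; first exact: bij_comp.
by move=> x y /=; rewrite dg df.
Qed.

Lemma isometry_inv X Y (f : X -> Y) : is_isometry f ->
  exists g : Y -> X, [/\ is_isometry g, cancel f g & cancel g f].
Proof.
move=> [[g fK gK] df]; exists g; split=> //; split; first by exists f.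
by move=> x y; rewrite -df !gK.
Qed.

End IsometryBasics.

(** * Small spheres *)

Section LocalGeometry.
Variables (R : realType) (G : multigraph) (l : length_function R G).
Variable r : R.
Hypothesis r_gt0 : 0 < r.
Hypothesis r_le : forall e, r + r <= l e.
Notation X := (metric_graph l).
Notation D := (gdart G).
Notation org := (gorg G).
Notation pt := (dart_point l).
Notation len d := (l d.1).

Lemma dist_ge (F : X -> R) :
  (forall e s t, 0 <= s <= l e -> 0 <= t <= l e ->
    F (edge_point l e s) - F (edge_point l e t) <= `|s - t|) ->
  forall x y, F x - F y <= mdist x y.
Proof. by move=> lipF x y; apply: path_dist_ge => L; exact: route_lip. Qed.

Lemma min_shift (a a' b b' h : R) : 0 <= h -> a <= a' + h -> b <= b' + h ->
  Num.min a b <= Num.min a' b' + h.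
Proof.
move=> h0 aa bb; rewrite -lerBlDr le_min !lerBlDr !ge_min.
by rewrite aa bb orbT.
Qed.

(** The distance to the vertex [v], cut off at [r]. *)
Definition cone_on v e t : R :=
  Num.min r (Num.min (if src e == v then t else r) (if tgt e == v then l e - t else r)).
(** Lipschitz, so that it bounds the distance from below by [dist_ge]. *)
Definition cone v (x : X) : R := match x with
  | Vertex w => if w == v then 0 else r
  | Interior e s => cone_on v e (sval s)
  end.

Lemma coneE v e t : 0 <= t <= l e -> cone v (edge_point l e t) = cone_on v e t.
Proof.
move=> te; have re := r_le e; have r0 := r_gt0; rewrite /cone_on.
have [[-> ->]|[-> ->]|[s' [-> ->]]] := edge_pointP te => //=.
  case: eqP => _; case: eqP => _; rewrite ?subr0 ?subrr.
  - by rewrite (min_idPl (_ : 0 <= l e)) ?(min_idPr (ltW r0))//; lra.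
  - by rewrite (min_idPl (ltW r0)) (min_idPr (ltW r0)).
  - by rewrite (min_idPl (_ : r <= l e)) ?minxx//; lra.
  - by rewrite !minxx.
case: eqP => _; case: eqP => _; rewrite ?subr0 ?subrr.
- by rewrite (min_idPr (_ : 0 <= l e)) ?(min_idPr (ltW r0))//; lra.
- by rewrite (min_idPr (ltW r0)) (min_idPr (ltW r0)).
- by rewrite (min_idPr (_ : r <= l e)) ?minxx//; lra.
- by rewrite !minxx.
Qed.

Lemma cone_le v x : cone v x <= mdist (Vertex l v) x.
Proof.
have := @dist_ge (cone v) _ x (Vertex l v); rewrite /= eqxx subr0 metric_sym; apply.
move=> e s t se te; rewrite !coneE// /cone_on lerBlDl.
have n0 := normr_ge0 (s - t); have n1 := ler_norm (s - t).
have n2 := ler_norm (t - s); rewrite (distrC t s) in n2.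
by rewrite addrC !min_shift//; [lra|case: ifP => _; lra|case: ifP => _; lra].
Qed.

Lemma dist_vertex d t : 0 <= t <= r -> mdist (Vertex l (org d)) (pt d t) = t.
Proof.
move=> /andP[t0 tr]; have re := r_le d.1; have r0 := r_gt0.
apply/eqP; rewrite eq_le; apply/andP; split.
  rewrite -dart_point_org (le_trans (mdist_dart_le _ _))//; try lra.
  by rewrite sub0r normrN ger0_norm.
apply: le_trans (cone_le _ _); case: d re => e [] /= re.
  rewrite /dart_point/= coneE /cone_on /org/= ?eqxx; last lra.
  rewrite !le_min tr/=; apply/andP; split; last lra.
  by case: ifP => _ //; lra.
rewrite /dart_point/= coneE /cone_on /org/= ?eqxx; last lra.
rewrite !le_min tr lexx /=.
by case: ifP => _ //; lra.
Qed.

Hypothesis dart_at : forall v, exists d, org d == v.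

Lemma near_vertex v x : mdist (Vertex l v) x < r ->
  exists2 d, org d = v & x = pt d (mdist (Vertex l v) x).
Proof.
move=> xr; have r0 := r_gt0; have cr := le_lt_trans (cone_le v x) xr.
suff [d [t [dv /andP[t0 tr] xE]]] : exists d t, [/\ org d = v, 0 <= t <= r & x = pt d t].
  by exists d => //; rewrite {1}xE {1}xE -dv dist_vertex ?t0.
case: x cr {xr} => [w|e [s s0l]].
  rewrite /=; have [-> _|_] := eqVneq w v; last by rewrite ltxx.
  have [d /eqP dv] := dart_at v; exists d, 0; rewrite dart_point_org dv lexx ltW//.
rewrite /= /cone_on !gt_min ltxx /=; have /andP[s0 sl] := s0l.
have i1 : Interior (exist _ s s0l) = pt (e, false) s by rewrite dart_point_int.
have i2 : Interior (exist _ s s0l) = pt (e, true) (l e - s).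
  by rewrite i1 /dart_point /= subKr.
have far w : (if w == v then s else r) < r -> w = v /\ s < r.
  by case: eqP => // _; rewrite ltxx.
have far' w : (if w == v then l e - s else r) < r -> w = v /\ l e - s < r.
  by case: eqP => // _; rewrite ltxx.
case/orP => [/far|/far'] [sv sr].
  by exists (e, false), s; split=> //; rewrite ?ltW.
by exists (e, true), (l e - s); split=> //; rewrite subr_ge0 !ltW.
Qed.

(** The distance to the point at parameter [a] of [e], cut off at [h]. *)
Definition tent e (a h : R) (x : X) : R := match x with
  | Vertex _ => h
  | Interior e' s => if e' == e then Num.min h `|sval s - a| else h
  end.

Lemma tentE e a h e' t : 0 < a < l e -> h <= a -> h <= l e - a -> 0 <= t <= l e' ->
  tent e a h (edge_point l e' t) = if e' == e then Num.min h `|t - a| else h.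
Proof.
move=> /andP[a0 al] ha hl te.
have [[-> ->]|[-> ->]|[s' [-> ->]]] := edge_pointP te => //=.
  by case: eqP => // _; apply/esym/min_idPl; rewrite sub0r normrN gtr0_norm.
by case: eqP => // ->; apply/esym/min_idPl; rewrite ger0_norm; lra.
Qed.

Lemma tent_le e a h x : 0 < a < l e -> 0 <= h -> h <= a -> h <= l e - a ->
  tent e a h x <= mdist (edge_point l e a) x.
Proof.
move=> al h0 ha hl; have := @dist_ge (tent e a h) _ x (edge_point l e a).
rewrite tentE ?eqxx ?subrr ?normr0 ?(min_idPr h0) ?subr0 ?(metric_sym x)//; last lra.
apply=> e' s t se te; rewrite !tentE//; case: eqP => _; last by rewrite subrr.
rewrite lerBlDl min_shift//; first by have := normr_ge0 (s - t); lra.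
by have := ler_distD t s a; lra.
Qed.

(** The position is in the type of the edge; these projections avoid dependent
    equalities. *)
Definition edge_of_point (x : X) := if x is Interior e _ then Some e else None.
Definition pos_of_point (x : X) : R := if x is Interior e s then sval s else 0.

Lemma interior_coords e t : 0 < t < l e -> edge_of_point (edge_point l e t) = Some e /\ pos_of_point (edge_point l e t) = t.
Proof. by move=> tl; rewrite /edge_point insubT. Qed.

Lemma dart_point_inj d d' t t' : 0 < t < len d -> 0 < t' < len d' ->
  pt d t = pt d' t' -> d' = d /\ t' = t \/ d' = rev d /\ t' = len d - t.
Proof.
move=> tl tl'; rewrite /dart_point => E.
have [|e1 x1] := @interior_coords d.1 (if d.2 then len d - t else t); first by case: ifP => _; lra.
have [|e2 x2] := @interior_coords d'.1 (if d'.2 then len d' - t' else t'); first by case: ifP => _; lra.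
have [ee] : Some d.1 = Some d'.1 by rewrite -e1 -e2 E.
have := x1; rewrite E x2; have [dd|dd] := same_edge ee; [left|right]; split=> //; move: H.
  by rewrite dd; case: ifP => _; lra.
by rewrite dd /=; case: (d.2) => /=; lra.
Qed.

Lemma dist_edge e a t : 0 < a < l e -> `|t - a| <= a -> `|t - a| <= l e - a ->
  mdist (edge_point l e a) (edge_point l e t) = `|t - a|.
Proof.
move=> al ta tl; have /ler_normlP[t1 t2] := ta; have /ler_normlP[t3 t4] := tl.
apply/eqP; rewrite eq_le; apply/andP; split.
  by rewrite distrC mdist_edge_le//; lra.
have := @tent_le e a `|t - a| (edge_point l e t) al (normr_ge0 _) ta tl.
by rewrite tentE ?eqxx ?minxx//; lra.
Qed.

Lemma near_edge e a x : let h := mdist (edge_point l e a) x in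
  0 < a < l e -> h < a -> h < l e - a ->
  x = edge_point l e (a + h) \/ x = edge_point l e (a - h).
Proof.
move=> h al ha hl; pose m := Num.min a (l e - a).
have hm : h < m by rewrite lt_min ha.
have ma : m <= a by rewrite ge_min lexx.
have ml : m <= l e - a by rewrite ge_min lexx orbT.
have m0 : 0 <= m by rewrite le_min; lra.
have := le_lt_trans (tent_le x al m0 ma ml) hm.
case: x @h {ha hl} hm => [v|e' s] h hm; rewrite /= ?ltxx//.
case: eqP => [ee|_]; last by rewrite ltxx.
subst e'; rewrite gt_min ltxx/= => sm.
have hE : h = `|sval s - a|.
  by rewrite /h -(edge_point_int s) dist_edge//; lra.
rewrite -edge_point_int hE; have [sa|sa] := leP 0 (sval s - a); [left|right].
  by congr edge_point; rewrite ?ger0_norm// addrC subrK.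
by congr edge_point; rewrite ltr0_norm// opprK addrC subrK.
Qed.

Lemma dist_dart d a t : 0 < a < len d -> `|t - a| <= a -> `|t - a| <= len d - a ->
  mdist (pt d a) (pt d t) = `|t - a|.
Proof.
case: d => e [] /= al ta tl; last exact: dist_edge.
have E : l e - t - (l e - a) = a - t by lra.
by rewrite /dart_point/= dist_edge ?E ?(distrC a)//; lra.
Qed.

Lemma near_dart d a x : let h := mdist (pt d a) x in
  0 < a < len d -> h < a -> h < len d - a -> x = pt d (a + h) \/ x = pt d (a - h).
Proof.
case: d => e [] h /= al ha hl; last exact: near_edge.
have al' : 0 < l e - a < l e by lra.
have hl' : h < l e - (l e - a) by lra.
by case: (near_edge al' hl hl') => ->; [right|left]; rewrite /dart_point/=;
  congr edge_point; rewrite -/h; lra.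
Qed.

End LocalGeometry.

(** * An isometry permutes the darts *)

Section IsometryDarts.
Variables (R : realType) (G : multigraph) (l : length_function R G).
Variable r : R.
Hypothesis r_gt0 : 0 < r.
Hypothesis r_le : forall e, r + r <= l e.
Notation X := (metric_graph l).
Notation D := (gdart G).
Notation org := (gorg G).
Notation pt := (dart_point l).
Notation len d := (l d.1).
Hypothesis deg3 : forall v, exists x y z, [/\ org x = v, org y = v & org z = v] /\
  [/\ x != y, y != z & z != x].

Let dart_at v : exists d, org d == v.
Proof. by have [x [_ [_ [[xv _ _] _]]]] := deg3 v; exists x; apply/eqP. Qed.

Lemma dart_point_inj_near d d' t : 0 < t < r -> pt d t = pt d' t -> d = d'.
Proof.
move=> tr; have := r_le d.1; have := r_le d'.1 => h h'.
by move=> /dart_point_inj [| |[->//]|[_ ?]]; [lra|lra|exfalso; lra].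
Qed.

Lemma near_dart_at d a h x : mdist (pt d a) x = h -> 0 < a < len d -> h < a ->
  h < len d - a -> x = pt d (a + h) \/ x = pt d (a - h).
Proof. by move=> <-; exact: near_dart. Qed.

(** A small sphere has at least three points around a vertex, and two around an
    interior point. *)
Lemma isometry_vertex (f : X -> X) v : is_isometry f -> exists w, f (Vertex l v) = Vertex l w.
Proof.
move=> fi; have [_ fd] := fi.
case fv: (f (Vertex l v)) => [w|e s]; first by exists w.
exfalso; have := fv; rewrite dart_point_int; have /andP[s0 sl] := svalP s.
set a := sval s in s0 sl * => {}fv; set d := (e, false) in fv.
pose t := Num.min r (Num.min a (l e - a)) / 2.
have m0 : 0 < Num.min r (Num.min a (l e - a)) by rewrite !lt_min r_gt0 s0 subr_gt0.
have mr : Num.min r (Num.min a (l e - a)) <= r by rewrite ge_min lexx.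
have ma : Num.min r (Num.min a (l e - a)) <= a by rewrite !ge_min lexx orbT.
have ml : Num.min r (Num.min a (l e - a)) <= l e - a by rewrite !ge_min lexx !orbT.
have tr : 0 < t < r by rewrite /t; lra.
have ta : t < a by rewrite /t; lra.
have tl : t < l e - a by rewrite /t; lra.
have [x [y [z [[xv yv zv] [xy yz zx]]]]] := deg3 v.
have two d' : org d' = v -> f (pt d' t) = pt d (a + t) \/ f (pt d' t) = pt d (a - t).
  move=> d'v; have E : mdist (pt d a) (f (pt d' t)) = t.
    by rewrite -fv fd -d'v (dist_vertex r_gt0)//; lra.
  by apply: (near_dart_at E) => /=; lra.
have ne d1 d2 : d1 != d2 -> f (pt d1 t) <> f (pt d2 t).
  by move=> /eqP n12 /(isometry_inj fi)/(dart_point_inj_near tr).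
have [|] := two x xv; have [|] := two y yv; have [|] := two z zv => hz hy hx.
- by apply: (ne x y) => //; rewrite hx hy.
- by apply: (ne x y) => //; rewrite hx hy.
- by apply: (ne z x) => //; rewrite hx hz.
- by apply: (ne y z) => //; rewrite hy hz.
- by apply: (ne y z) => //; rewrite hy hz.
- by apply: (ne z x) => //; rewrite hx hz.
- by apply: (ne x y) => //; rewrite hx hy.
- by apply: (ne x y) => //; rewrite hx hy.
Qed.

(** The dart [d'] is the one whose point at distance [r / 2] is the image of that of
    [d]. *)
Section OneDart.
Variables (f : X -> X) (d d' : D).
Hypothesis fi : is_isometry f.
Let c := r / 2.
Hypothesis fv : f (Vertex l (org d)) = Vertex l (org d').
Hypothesis fc : f (pt d c) = pt d' c.

Let fd x y : mdist (f x) (f y) = mdist x y. Proof. exact: fi.2. Qed.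

(** The two points of [d'] at a given distance from [pt d' c] are told apart by
    their distance to the vertex. *)
Lemma isometry_start t : 0 < t < r -> f (pt d t) = pt d' t.
Proof.
move=> tr; have h := r_le d.1; have h' := r_le d'.1.
have tc : `|t - c| < c by rewrite ltr_norml /c; lra.
have E : mdist (pt d' c) (f (pt d t)) = `|t - c|.
  by rewrite -fc fd dist_dart//; move: tc; rewrite /c; lra.
have V : mdist (Vertex l (org d')) (f (pt d t)) = t.
  by rewrite -fv fd (dist_vertex r_gt0)//; lra.
have cc : c + c = r by rewrite /c; lra.
have n0 := normr_ge0 (t - c); move: V.
case: (near_dart_at E); [lra|lra|lra| |] => ->;
  by rewrite (dist_vertex r_gt0) => [->//|//|]; lra.
Qed.

(** Advance along the dart by equal small steps. Of the two points one step away
    from the current one, one is the image of the previous point, hence the other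
    is the image of the next. *)
Lemma isometry_inner t : 0 < t -> t < len d -> t < len d' -> f (pt d t) = pt d' t.
Proof.
move=> t0 td td'; have c0 : 0 < c by rewrite /c; have := r_gt0; lra.
have cc : c + c = r by rewrite /c; lra.
pose N := Num.bound (t / c); pose h := t / N%:R.
have tN : t / c < N%:R by apply: archi_boundP; rewrite divr_ge0 ?ltW.
have N0 : 0 < N%:R :> R by apply: le_lt_trans tN; rewrite divr_ge0 ?ltW.
have h0 : 0 < h by rewrite divr_gt0.
have hc : h < c by rewrite ltr_pdivrMr// mulrC -ltr_pdivrMr.
have hN : N%:R * h = t by rewrite mulrC divfK// gt_eqF.
have le_t k : (k <= N)%N -> k%:R * h <= t.
  by move=> kN; rewrite -hN; apply: ler_wpM2r; [exact: ltW|rewrite ler_nat].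
suff main k : ((k.+1 <= N)%N -> f (pt d (k.+1%:R * h)) = pt d' (k.+1%:R * h)) /\
    ((k.+2 <= N)%N -> f (pt d (k.+2%:R * h)) = pt d' (k.+2%:R * h)).
  have Ngt : (0 < N)%N by rewrite -(ltr_nat R).
  by have := (main N.-1).1; rewrite (prednK Ngt) leqnn hN => ->.
elim: k => [|k [IH1 IH2]].
  by split=> _; apply: isometry_start; rewrite ?mul1r; lra.
split=> // kN; have IH := IH2 (ltnW kN); have := IH1 (ltnW (ltnW kN)) => IH0.
set a := k.+2%:R * h in IH; set b := k.+1%:R * h in IH0.
have ab : a = b + h by rewrite /a /b -[k.+2]addn1 natrD mulrDl mul1r.
have cE : k.+3%:R * h = a + h by rewrite /a -[k.+3]addn1 natrD mulrDl mul1r.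
have b0 : 0 < b by rewrite mulr_gt0.
have ct := le_t _ kN; rewrite {}cE in ct *.
have nh : `|a + h - a| = h by rewrite addrAC subrr add0r gtr0_norm.
have E : mdist (pt d' a) (f (pt d (a + h))) = h.
  by rewrite -IH fd dist_dart ?nh//; lra.
case: (near_dart_at E); [lra|lra|lra|by []|].
rewrite (_ : a - h = b); last by lra.
rewrite -IH0 => /(isometry_inj fi)/dart_point_inj.
by case=> [||[_]|[/(congr1 snd)/=]]; [lra|lra|move=> ?; exfalso; lra|case: (d.2)].
Qed.

(** By continuity, as the image is known at all earlier points. *)
Lemma isometry_common_end : exists2 m, m = Num.min (len d) (len d') & f (pt d m) = pt d' m.
Proof.
exists (Num.min (len d) (len d')) => //; set m := Num.min _ _.
have m0 : 0 < m by rewrite lt_min !len_gt0.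
have md : m <= len d by rewrite ge_min lexx.
have md' : m <= len d' by rewrite ge_min lexx orbT.
apply: mdist_positivity; apply/eqP; rewrite eq_le mdist_ge0 andbT leNgt; apply/negP => D0.
set D := mdist _ _ in D0.
have close t : 0 < t < m -> D <= (m - t) + (m - t).
  move=> tm; rewrite /D (le_trans (metric_triangle _ (f (pt d t)) _))// lerD//.
    by rewrite fd (le_trans (mdist_dart_le _ _))// ?ger0_norm; lra.
  rewrite isometry_inner; try lra.
  by rewrite (le_trans (mdist_dart_le _ _))// ?ler0_norm; lra.
pose k := Num.min D m.
have k0 : 0 < k by rewrite lt_min D0.
have kD : k <= D by rewrite ge_min lexx.
have km : k <= m by rewrite ge_min lexx orbT.
by have := close (m - k / 4) ltac:(lra); lra.
Qed.

(** At the end of the shorter dart one of the two points is a vertex, so both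
    are. *)
Lemma isometry_len : len d' = len d.
Proof.
have [m mE fm] := isometry_common_end.
have [lt|lt|//] := ltgtP (len d') (len d).
  rewrite (min_idPr (ltW lt)) in mE; move: fm; rewrite mE dart_point_end => fm.
  have [h [hi fK hK]] := isometry_inv fi.
  have [w hw] := isometry_vertex (org (rev d')) hi.
  have := fK (pt d (len d')); rewrite fm hw => E.
  have := @interior_coords _ _ l d.1 (if d.2 then len d - len d' else len d').
  rewrite -/(pt d _) -E => -[|//]; have := len_gt0 l d'; case: ifP => _; lra.
rewrite (min_idPl (ltW lt)) in mE; move: fm; rewrite mE dart_point_end => fm.
have [w hw] := isometry_vertex (org (rev d)) fi.
rewrite fm in hw.
have := @interior_coords _ _ l d'.1 (if d'.2 then len d' - len d else len d).
rewrite -/(pt d' _) hw => -[|//]; have := len_gt0 l d; case: ifP => _; lra.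
Qed.

Lemma isometry_dart t : 0 <= t <= len d -> f (pt d t) = pt d' t.
Proof.
move=> tl; have [->|t0] := eqVneq t 0; first by rewrite !dart_point_org.
have [->|tn] := eqVneq t (len d).
  have [m mE fm] := isometry_common_end; rewrite isometry_len minxx in mE.
  by rewrite -mE.
have tl' : 0 < t < len d by rewrite !lt_neqAle eq_sym t0 tn.
by apply: isometry_inner; rewrite ?isometry_len; lra.
Qed.

End OneDart.

Lemma isometry_darts (f : X -> X) : is_isometry f ->
  exists s : {perm D}, [/\ forall d, s (rev d) = rev (s d),
    forall d d', org d = org d' -> org (s d) = org (s d'),
    forall d, len (s d) = len d &
    forall d t, 0 <= t <= len d -> f (pt d t) = pt (s d) t].
Proof.
move=> fi; have fd := fi.2; have r0 := r_gt0.
have ex d : exists d', f (Vertex l (org d)) = Vertex l (org d') /\ f (pt d (r / 2)) = pt d' (r / 2).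
  have [w fw] := isometry_vertex (org d) fi.
  have E : mdist (Vertex l w) (f (pt d (r / 2))) = r / 2.
    by rewrite -fw fd (dist_vertex r_gt0)//; lra.
  have [|d' d'w xE] := @near_vertex _ _ l r r_gt0 r_le dart_at w (f (pt d (r / 2))); rewrite ?E; first lra.
  by exists d'; rewrite d'w; split=> //; rewrite xE E.
have /fin_all_exists[s0 s0P] := ex.
have key d t : 0 <= t <= len d -> f (pt d t) = pt (s0 d) t.
  by have [fv fc] := s0P d; exact: (isometry_dart fi fv fc).
have klen d : len (s0 d) = len d by have [fv fc] := s0P d; exact: (isometry_len fi fv fc).
have near d d' : pt d (r / 2) = pt d' (r / 2) -> d = d'.
  by apply: dart_point_inj_near; lra.
have s0inj : injective s0.
  move=> d d' dd'; apply/near/(isometry_inj fi).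
  by rewrite (s0P d).2 (s0P d').2 dd'.
exists (perm s0inj); split=> [d|d d'|d|d t td]; rewrite ?permE//.
- apply: near; have h := r_le d.1.
  rewrite -(s0P (rev d)).2 dart_point_rev key; last lra.
  by rewrite dart_point_rev klen.
- move=> dd'; have := (s0P d').1; rewrite -dd' (s0P d).1 => E.
  by case: E.
- exact: key.
Qed.

End IsometryDarts.

(** * Isometries and dart automorphisms *)

Definition degree (G : multigraph) (v : vertex G) := #|[set d : gdart G | gorg G d == v]%SET|.
Definition stable (G : multigraph) := forall v : vertex G, (3 <= degree v)%N.

Lemma stable_dart G : stable G -> forall v : vertex G, exists d, gorg G d == v.
Proof. by move=> st; exact: dart_at. Qed.

Section DartAutomorphisms.
Variables (R : realType) (G : multigraph) (l : length_function R G).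
Notation D := (gdart G).
Notation org := (gorg G).
Notation pt := (dart_point l).

Definition dart_aut (s : {perm D}) := [&& [forall d, s (rev d) == rev (s d)],
  [forall d, forall d', (org d == org d') ==> (org (s d) == org (s d'))] &
  [forall d, l (s d).1 == l d.1]].

Lemma dart_autP (s : {perm D}) : reflect [/\ forall d, s (rev d) = rev (s d),
    forall d d', org d = org d' -> org (s d) = org (s d') &
    forall d, l (s d).1 = l d.1] (dart_aut s).
Proof.
apply: (iffP and3P) => -[h1 h2 h3]; split.
- by move=> d; apply/eqP/(forallP h1).
- move=> d d' dd'; have /forallP/(_ d')/implyP := forallP h2 d.
  by rewrite dd' => /(_ (eqxx _))/eqP.
- by move=> d; apply/eqP/(forallP h3).
- by apply/forallP => d; apply/eqP.
- by apply/forallP => d; apply/forallP => d'; apply/implyP => /eqP /h2 ->.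
- by apply/forallP => d; apply/eqP.
Qed.

Lemma dart_auts_group : group_set [set s | dart_aut s]%SET.
Proof.
apply/group_setP; split.
  by rewrite inE; apply/dart_autP; split=> *; rewrite !perm1.
move=> s t; rewrite !inE => /dart_autP[s1 s2 s3] /dart_autP[t1 t2 t3].
apply/dart_autP; split=> [d|d d' dd'|d]; rewrite !permM ?s1 ?t3//.
exact/t2/s2.
Qed.

Definition dart_auts : {group {perm D}} := group dart_auts_group.

Lemma in_dart_auts (s : {perm D}) : (s \in dart_auts) = dart_aut s.
Proof. by rewrite inE. Qed.

Lemma dart_auts_rev (s : {perm D}) d : s \in dart_auts -> s (rev d) = rev (s d).
Proof. by rewrite in_dart_auts => /dart_autP[]. Qed.

Lemma dart_auts_org (s : {perm D}) d d' : s \in dart_auts -> org d = org d' -> org (s d) = org (s d').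
Proof. by rewrite in_dart_auts => /dart_autP[_ + _]; apply. Qed.

Lemma dart_auts_len (s : {perm D}) d : s \in dart_auts -> l (s d).1 = l d.1.
Proof. by rewrite in_dart_auts => /dart_autP[]. Qed.

Hypothesis st : stable G.

(** Balls of radius [r] around distinct vertices have no interior point in common,
    and around one vertex the darts stay apart. *)
Lemma ends_radius : exists2 r : R, 0 < r & forall e, r + r <= l e.
Proof.
exists (\big[Num.min/1]_e l e / 2).
  by rewrite divr_gt0//; apply: lt_bigmin => // e _; exact: length_gt0.
by move=> e; rewrite -splitr; exact: bigmin_le_cond.
Qed.

Lemma isometry_of_dart_aut (s : {perm D}) : s \in dart_auts ->
  exists2 h : metric_graph l -> metric_graph l, is_isometry h &
    forall d t, 0 <= t <= l d.1 -> h (pt d t) = pt (s d) t.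
Proof.
move=> sA; apply: dart_isometry.
- by exists (s^-1)%g; [exact: permK|exact: permKV].
- by move=> d; exact: dart_auts_rev.
- move=> d d'; split; first exact: dart_auts_org.
  by move=> /(dart_auts_org (groupVr sA)); rewrite !permK.
- by move=> d; exact: dart_auts_len.
- exact: stable_dart.
- exact: stable_dart.
Qed.

Lemma dart_aut_of_isometry (f : metric_graph l -> metric_graph l) : is_isometry f ->
  exists2 s, s \in dart_auts & forall d t, 0 <= t <= l d.1 -> f (pt d t) = pt (s d) t.
Proof.
move=> fi; have [r r0 rl] := ends_radius.
have three v : exists x y z, [/\ org x = v, org y = v & org z = v] /\
    [/\ x != y, y != z & z != x].
  have /card_gt2P[x [y [z [[]]]]] := st v; rewrite !inE => /eqP xv /eqP yv /eqP zv ne.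
  by exists x, y, z.
have [s [s1 s2 s3 s4]] := isometry_darts r0 rl three fi.
by exists s; rewrite // in_dart_auts; apply/dart_autP.
Qed.

Lemma dart_auts_faithful (s t : {perm D}) : s \in dart_auts ->
  (forall d u, 0 <= u <= l d.1 -> pt (s d) u = pt (t d) u) -> s = t.
Proof.
move=> sA st'; apply/permP => d; have [r r0 rl] := ends_radius.
have h := rl d.1; have h2 := rl (t d).1.
have := st' d (r / 2); have := dart_auts_len d sA => ls.
move=> /(_ ltac:(lra))/dart_point_inj; rewrite ls.
by case=> [||[->//]|[_ E]]; [lra|lra|exfalso; lra].
Qed.

Theorem card_Aut : Aut (metric_graph l) #= `I_#|dart_auts|.
Proof.
pose n := #|dart_auts|; pose S i := nth 1%g (enum dart_auts) i.
have SA i : (i < n)%N -> S i \in dart_auts.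
  by move=> iN; rewrite -mem_enum mem_nth// -cardE.
have ex i : exists h : metric_graph l -> metric_graph l, (i < n)%N -> is_isometry h /\
    forall d t, 0 <= t <= l d.1 -> h (pt d t) = pt (S i d) t.
  have [iN|_] := boolP (i < n)%N; last by exists id.
  by have [h hi hE] := isometry_of_dart_aut (SA i iN); exists h.
have [F FP] := choice ex.
have dv v : exists d, org d = v by have [d /eqP] := stable_dart st v; exists d.
have <- : F @` `I_n = Aut (metric_graph l).
  apply/seteqP; split => [_ [i /= iN <-]|f fi]; first by have [] := FP i iN.
  have [s sA sE] := dart_aut_of_isometry fi.
  have iN : (index s (enum dart_auts) < n)%N by rewrite /n cardE index_mem mem_enum.
  exists (index s (enum dart_auts)) => //; apply/funext => x.
  have [d [t [td ->]]] := dart_pointP x dv.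
  by rewrite (FP _ iN).2// sE// /S nth_index// mem_enum.
apply: inj_card_eq => i j; rewrite !inE /= => iN jN Fij.
have : S i = S j.
  apply: dart_auts_faithful (SA i iN) _ => d u ud.
  by rewrite -(FP i iN).2// -(FP j jN).2// Fij.
by move/eqP; rewrite nth_uniq ?enum_uniq -?cardE// => /eqP.
Qed.

End DartAutomorphisms.

Lemma Aut_isometric (R : realType) (X Y : metricType R) (h : X -> Y) :
  is_isometry h -> Aut X #= Aut Y.
Proof.
move=> hi; have [k [ki hK kK]] := isometry_inv hi.
rewrite card_eq_sym; have <- : (fun f => h \o f \o k) @` Aut X = Aut Y.
  apply/seteqP; split => [_ [f fi <-]|f fi].
    exact: isometry_comp (isometry_comp ki fi) hi.
  exists (k \o f \o h); first exact: isometry_comp (isometry_comp hi fi) ki.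
  by apply/funext => y /=; rewrite !kK.
apply: inj_card_eq => f f' _ _ E; apply/funext => x.
have /(congr1 (fun u => k (u (h x)))) := E.
by rewrite /= !hK.
Qed.

(** Bijectivity comes from the count of edges. *)
Lemma defined_by_darts (R : realType) (X : metricType R) (G G' : multigraph)
    (l : length_function R G) (l' : length_function R G') (f : gdart G' -> gdart G) :
  defined_by X l -> injective f -> (#|edge G| <= #|edge G'|)%N ->
  (forall d, f (rev d) = rev (f d)) ->
  (forall d d', gorg G' d = gorg G' d' <-> gorg G (f d) = gorg G (f d')) ->
  (forall d, l (f d).1 = l' d.1) -> stable G -> stable G' -> defined_by X l'.
Proof.
move=> [h hi] finj cE frev forg flen st st'.
have fbij : bijective f by apply: inj_card_bij finj _; rewrite !card_prod leq_mul2r cE orbT.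
have [k ki _] := dart_isometry fbij frev forg flen (stable_dart st') (stable_dart st).
have [k' [ki' _ _]] := isometry_inv ki.
by exists (k' \o h); exact: isometry_comp hi ki'.
Qed.

(** * Symmetries of the banana, the bouquet and the lollipop *)

Section ModelGraphs.
Variable R : realType.

Lemma leq_card_dart_auts (G : multigraph) (l : length_function R G) (T : finType)
    (m : T -> gdart G -> gdart G) :
  (forall x, injective (m x)) -> (forall x d, m x (rev d) = rev (m x d)) ->
  (forall x d d', gorg G d = gorg G d' -> gorg G (m x d) = gorg G (m x d')) ->
  (forall x d, l (m x d).1 = l d.1) -> (forall x y, m x =1 m y -> x = y) ->
  (#|T| <= #|dart_auts l|)%N.
Proof.
move=> minj mrev morg mlen mfaith; pose s x := perm (minj x).
have sinj : injective s.
  by move=> x y sxy; apply: mfaith => d; have := congr1 (fun u : {perm _} => u d) sxy; rewrite !permE.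
rewrite -cardsT -(card_imset _ sinj); apply/subset_leq_card/fintype.subsetP => _ /imsetP[x _ ->].
rewrite in_dart_auts; apply/dart_autP; split=> *; rewrite !permE//.
exact: morg.
Qed.

Variable g : nat.

Lemma stable_banana : (2 <= g)%N -> stable (banana g).
Proof.
move=> g2 v; apply: (@leq_trans #|[set (i, v) | i : 'I_g.+1]%SET|).
  by rewrite card_imset ?card_ord// => i j [].
apply/subset_leq_card/fintype.subsetP => _ /imsetP[i _ ->].
by rewrite inE /org /=; case: v.
Qed.

Lemma stable_bouquet : (2 <= g)%N -> stable (bouquet g).
Proof.
move=> g2 v; apply: (@leq_trans #|[set: gdart (bouquet g)]%SET|).
  by rewrite cardsT card_prod card_bool card_ord; lia.
apply/subset_leq_card/fintype.subsetP => d _; rewrite inE.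
by case: (gorg _ _); case: v.
Qed.

Lemma stable_lollipop : (3 <= g)%N -> stable (lollipop g).
Proof.
move=> g3 [i|].
  apply/card_gt2P; exists (inl i, false), (inl i, true), (inr i, true).
  split; first by split; rewrite inE; exact/eqP.
  by split; apply/eqP => -[].
apply: (@leq_trans #|[set ((inr i, false) : gdart (lollipop g)) | i : 'I_g]%SET|).
  by rewrite card_imset ?card_ord// => i j [].
apply/subset_leq_card/fintype.subsetP => _ /imsetP[i _ ->].
by rewrite inE /org.
Qed.

Lemma card_banana_auts (l : length_function R (banana g)) :
  (exists c, range l = [set c]) -> (2 * g.+1`! <= #|dart_auts l|)%N.
Proof.
move=> [c lc]; have lE i : l i = c.
  have : range l (l i) by exists i.
  by rewrite lc.
pose m (x : bool * {perm 'I_g.+1}) (d : gdart (banana g)) : gdart (banana g) :=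
  (x.2 d.1, x.1 (+) d.2).
have -> : (2 * g.+1`! = #|{: bool * {perm 'I_g.+1}}|)%N.
  by rewrite card_prod card_bool card_Sn.
apply: (leq_card_dart_auts (m := m)).
- by move=> [b p] [i a] [j a'] [/perm_inj -> /addbI ->].
- by move=> [b p] [i a]; rewrite /m /rev/= addbN.
- by move=> [b p] [i a] [j a']; rewrite /org /m/=; case: a; case: a'; case: b.
- by move=> x d; rewrite !lE.
- move=> [b p] [b' p'] E; congr pair.
    by have := E (ord0, false) => -[_]; rewrite !addbF.
  by apply/permP => i; have [] := E (i, false).
Qed.

Lemma card_bouquet_auts (l : length_function R (bouquet g)) :
  (exists c, range l = [set c]) -> (hyperoct g <= #|dart_auts l|)%N.
Proof.
move=> [c lc]; have lE i : l i = c.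
  have : range l (l i) by exists i.
  by rewrite lc.
pose m (x : {ffun 'I_g -> bool} * {perm 'I_g}) (d : gdart (bouquet g)) : gdart (bouquet g) :=
  (x.2 d.1, x.1 d.1 (+) d.2).
have -> : (hyperoct g = #|{: {ffun 'I_g -> bool} * {perm 'I_g}}|)%N.
  by rewrite card_prod card_ffun card_bool card_ord card_Sn.
apply: (leq_card_dart_auts (m := m)).
- by move=> [b p] [i a] [j a'] [/perm_inj -> /addbI ->].
- by move=> [b p] [i a]; rewrite /m /rev/= addbN.
- by move=> x d d' _; case: (gorg _ _); case: (gorg _ _).
- by move=> x d; rewrite !lE.
- move=> [b p] [b' p'] E; congr pair.
    by apply/ffunP => i; have := E (i, false) => -[_]; rewrite !addbF.
  by apply/permP => i; have [] := E (i, false).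
Qed.

Lemma card_lollipop_auts (l : length_function R (lollipop g)) :
  (forall i j : 'I_g, l (inl i) = l (inl j)) -> (forall i j : 'I_g, l (inr i) = l (inr j)) ->
  (hyperoct g <= #|dart_auts l|)%N.
Proof.
move=> ll lr.
pose m (x : {ffun 'I_g -> bool} * {perm 'I_g}) (d : gdart (lollipop g)) : gdart (lollipop g) :=
  match d.1 with
  | inl i => (inl (x.2 i), x.1 i (+) d.2)
  | inr i => (inr (x.2 i), d.2)
  end.
have -> : (hyperoct g = #|{: {ffun 'I_g -> bool} * {perm 'I_g}}|)%N.
  by rewrite card_prod card_ffun card_bool card_ord card_Sn.
apply: (leq_card_dart_auts (m := m)).
- by move=> [b p] [[i|i] a] [[j|j] a'] //= [/perm_inj ->]; [move/addbI ->|move->].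
- by move=> [b p] [[i|i] a]; rewrite /m /rev/= ?addbN.
- move=> [b p] d d'.
  have E (e : gdart (lollipop g)) : gorg (lollipop g) (m (b, p) e) = omap p (gorg (lollipop g) e).
    by case: e => [[i|i] a]; rewrite /org /m/=; case: a => //=; case: (b i).
  by rewrite !E => ->.
- by move=> x [[i|i] a]; rewrite /m/=.
- move=> [b p] [b' p'] E; congr pair.
    by apply/ffunP => i; have := E (inl i, false) => -[_]; rewrite !addbF.
  by apply/permP => i; have [] := E (inr i, false).
Qed.

End ModelGraphs.

(** * Recognising the three graphs *)

Section Recognition.
Variables (R : realType) (X : metricType R) (G : multigraph) (l : length_function R G).
Variable g : nat.
Hypothesis XG : defined_by X l.
Hypothesis st : stable G.
Hypothesis gen : (#|edge G|.+1 = g + #|vertex G|)%N.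
Notation A := (dart_auts l).
Notation org := (gorg G).
Notation gloops := (loops (@src G) (@tgt G)).

Lemma edge_transitive_len (F : {set edge G}) e e' :
  edge_transitive A F -> e \in F -> e' \in F -> l e = l e'.
Proof.
by move=> tr eF e'F; have [s sA <-] := tr e e' eF e'F; rewrite dart_auts_len.
Qed.

(** Fix one of the two vertices, and orient every edge away from it. *)
Lemma recognise_banana : (2 <= g)%N -> #|vertex G| = 2 -> gloops = finset.set0 ->
  edge_transitive A [set: edge G]%SET ->
  exists2 l' : length_function R (banana g), (exists c, range l' = [set c]) & defined_by X l'.
Proof.
move=> g2 V2 loopless tr; have cE : #|edge G| = g.+1 by move: gen; rewrite V2; lia.
have [u _] : exists2 u : vertex G, u \in vertex G & true.
  by have /card_gt0P[u _] : (0 < #|vertex G|)%N; [rewrite V2|exists u].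
move=> _; have two x y : x != u -> y != u -> x = y.
  have /card_le1_eqP le1 : (#|[set~ u]%SET| <= 1)%N by rewrite cardsC1 V2.
  by move=> xu yu; apply: le1; rewrite !inE.
pose en (i : 'I_g.+1) : edge G := enum_val (cast_ord (esym cE) i).
have en_inj : injective en by move=> i j /enum_val_inj/cast_ord_inj.
pose f (d : gdart (banana g)) : gdart G := (en d.1, d.2 (+) (src (en d.1) != u)).
have fu d : (org (f d) == u) = ~~ d.2.
  rewrite /f /org/=; have ne : src (en d.1) != tgt (en d.1).
    by have := finset.in_set0 (en d.1); rewrite -loopless inE => ->.
  case: (d.2); case: (eqVneq (src (en d.1)) u) => [su|su] /=.
  - by apply/negbTE; rewrite -su eq_sym.
  - exact/negbTE.
  - by rewrite su eqxx.
  - by apply: contraNT ne => tu; apply/eqP; exact: two.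
pose l' : length_function R (banana g) := LengthFunction (fun i : edge (banana g) => length_gt0 l (en i)).
exists l'.
  exists (l (en ord0)); apply/seteqP; split => [_ [i _ <-] /=|_ ->]; last by exists ord0.
  by apply: edge_transitive_len tr _ _; rewrite inE.
apply: (defined_by_darts (f := f) XG) => //.
- by move=> [i a] [j b] [/en_inj -> /addIb ->].
- by rewrite cE card_ord.
- by move=> [i a]; rewrite /f /rev/= addNb.
- move=> d d'; have ob e : gorg (banana g) e = e.2 by case: e => i [].
  rewrite !ob; split=> [dd'|E].
    have [/eqP du|du] := boolP (org (f d) == u).
      by apply/eqP; rewrite du eq_sym fu -dd' -fu du.
    by apply: two => //; rewrite fu -dd' -fu.
  by apply: negb_inj; rewrite -!fu E.
- exact: stable_banana.
Qed.

Lemma recognise_bouquet : (3 <= g)%N -> #|vertex G| = 1%N ->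
  edge_transitive A [set: edge G]%SET ->
  exists2 l' : length_function R (bouquet g), (exists c, range l' = [set c]) & defined_by X l'.
Proof.
move=> g3 V1 tr; have cE : #|edge G| = g by move: gen; rewrite V1; lia.
have one (x y : vertex G) : x = y.
  by have /card_le1_eqP le1 : (#|vertex G| <= 1)%N; [rewrite V1|exact: le1].
pose en (i : 'I_g) : edge G := enum_val (cast_ord (esym cE) i).
have en_inj : injective en by move=> i j /enum_val_inj/cast_ord_inj.
pose f (d : gdart (bouquet g)) : gdart G := (en d.1, d.2).
pose l' : length_function R (bouquet g) := LengthFunction (fun i : edge (bouquet g) => length_gt0 l (en i)).
exists l'.
  have i0 : 'I_g by exists 0%N; lia.
  exists (l (en i0)); apply/seteqP; split => [_ [i _ <-] /=|_ ->]; last by exists i0.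
  by apply: edge_transitive_len tr _ _; rewrite inE.
apply: (defined_by_darts (f := f) XG) => //.
- by move=> [i a] [j b] [/en_inj -> ->].
- by rewrite cE card_ord.
- by move=> d d'; split=> _; [exact: one|case: (gorg _ d); case: (gorg _ d')].
- by apply: stable_bouquet; lia.
Qed.

(** The bridge numbered [i] starts at [p] and ends at the vertex of loop [i], like in
    the model. *)
Lemma recognise_lollipop (p : vertex G) : (3 <= g)%N -> #|gloops| = g ->
  {in gloops &, injective (@src G)} ->
  (forall e, e \in gloops -> src e != p) ->
  (forall v, v = p \/ exists2 e, e \in gloops & src e = v) ->
  (forall e, e \in gloops ->
    exists2 d, bridge_darts (@src G) (@tgt G) (src e) = [set d]%SET & org (rev d) = p) ->
  edge_transitive A gloops -> edge_transitive A (~: gloops)%SET ->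
  exists2 l' : length_function R (lollipop g),
    (forall i j : 'I_g, l' (inl i) = l' (inl j)) /\ (forall i j : 'I_g, l' (inr i) = l' (inr j))
    & defined_by X l'.
Proof.
move=> g3 cL inj np Vp bP trL trB.
have cV : (#|vertex G| <= g.+1)%N.
  rewrite -cL -(card_in_imset inj) -cardsT.
  apply: (@leq_trans #|p |: [set src x | x in gloops]|%SET); last by rewrite cardsU1; case: (_ \notin _).
  apply/subset_leq_card/fintype.subsetP => v _; rewrite !inE.
  by have [->|[e eL <-]] := Vp v; rewrite ?eqxx ?imset_f ?orbT.
pose en (i : 'I_g) : edge G := enum_val (cast_ord (esym cL) i).
have en_inj : injective en by move=> i j /enum_val_inj/cast_ord_inj.
have enL i : en i \in gloops by exact: enum_valP.
have ex i : exists d, [/\ d.1 \notin gloops, org d = src (en i) & org (rev d) = p].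
  have [d dE dp] := bP _ (enL i); exists d.
  have : d \in bridge_darts (@src G) (@tgt G) (src (en i)) by rewrite dE inE.
  by rewrite in_bridge => /andP[? /eqP].
have /fin_all_exists[br brP] := ex.
have brL i : (br i).1 \notin gloops by case: (brP i).
have bro i : org (br i) = src (en i) by case: (brP i).
have brp i : org (rev (br i)) = p by case: (brP i).
have ent i : tgt (en i) = src (en i) by have := enL i; rewrite inE => /eqP.
pose f (d : gdart (lollipop g)) : gdart G :=
  match d.1 with
  | inl i => (en i, d.2)
  | inr i => if d.2 then br i else rev (br i)
  end.
pose vm (v : vertex (lollipop g)) : vertex G := if v is Some i then src (en i) else p.
have vm_inj : injective vm.
  move=> [i|] [j|] //=; rewrite /vm.
  - by move=> /(inj _ _ (enL i) (enL j))/en_inj ->.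
  - by move=> E; have := np _ (enL i); rewrite E eqxx.
  - by move=> E; have := np _ (enL j); rewrite E eqxx.
have forg d : org (f d) = vm (gorg (lollipop g) d).
  by case: d => [[i|i] []]; rewrite /f /= ?bro ?brp// /org/= ?ent.
have f1 d : (f d).1 = match d.1 with inl i => en i | inr i => (br i).1 end.
  by case: d => [[i|i] []].
pose l' : length_function R (lollipop g) :=
  LengthFunction (fun e : edge (lollipop g) => length_gt0 l (f (e, true)).1).
have fl d : l (f d).1 = l' d.1 by rewrite [RHS]/= !f1.
exists l'.
  split=> i j /=.
    exact: edge_transitive_len trL (enL i) (enL j).
  by apply: edge_transitive_len trB _ _; rewrite finset.in_setC brL.
apply: (defined_by_darts (f := f) XG) => //.
- move=> d d' dd'; have := congr1 fst dd'; have := congr1 org dd'; rewrite !f1 !forg.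
  move=> /vm_inj; move: dd'; case: d d' => [[i|i] a] [[j|j] a'] dd' oE /= bE.
  + by move: dd' => -[/en_inj -> ->].
  + by have := brL j; rewrite -bE enL.
  + by have := brL i; rewrite bE enL.
  + have aE : a = a' by move: oE {dd'}; rewrite /org; case: a; case: a'.
    move: dd'; rewrite /f /= -{}aE => dd'.
    have /(congr1 org) : br i = br j by case: a dd' {oE} => // /(can_inj (@revK _)).
    by rewrite !bro => /(inj _ _ (enL i) (enL j))/en_inj ->.
- have := card_sum 'I_g 'I_g; rewrite card_ord => cS.
  by rewrite [leqRHS]cS; lia.
- by move=> [[i|i] []] //; exact: (esym (revK (br i))).
- by move=> d d'; rewrite !forg; split=> [->//|/vm_inj].
- exact: stable_lollipop.
Qed.

End Recognition.

(** * Leafless graphs have no vertex of degree one *)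

Section EndPoint.
Variables (R : realType) (M : metricType R).

Lemma lipschitz_dist_continuous (x : M) : continuous (mdist x : M -> R).
Proof.
move=> y; apply/cvgrPdist_lt => e e0; apply/nbhs_ballP; exists e => // z.
rewrite ballEmdist /= => yz; rewrite ltr_norml.
have := metric_triangle x y z; have := metric_triangle x z y.
by rewrite (metric_sym z y); lra.
Qed.

Lemma lipschitz_curve_continuous (c : R -> M) :
  (forall s t, mdist (c s) (c t) <= `|s - t|) -> continuous c.
Proof.
move=> lc s; apply/cvg_ballP => e e0; apply/nbhs_ballP; exists e => //= t st.
by rewrite ballEmdist /=; exact: le_lt_trans (lc s t) st.
Qed.

(** The distance to [x] maps a small connected neighbourhood of [x] to an interval
    that starts at 0, and [c] is its inverse. Without 0 it is still an interval. *)
Lemma end_point_valency (x : M) (r : R) (c : R -> M) : 0 < r ->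
  (forall s t, 0 <= s < r -> 0 <= t < r -> mdist (c s) (c t) = `|s - t|) ->
  c 0 = x -> (forall y, mdist x y < r -> y = c (mdist x y)) -> has_valency x 1.
Proof.
move=> r0 cd c0 cx; pose h := r / 2; have hr : h + h = r by rewrite /h; lra.
(* c is controlled on [0, r) only; c \o cl is continuous everywhere and agrees with c
   on [0, h] *)
pose cl t : R := Num.max 0 (Num.min h t).
have clE t : 0 <= t <= h -> cl t = t.
  by move=> /andP[t0 th]; rewrite /cl (min_idPr th) (max_idPr t0).
have clr t : 0 <= cl t < r.
  by rewrite /cl le_max lexx/= gt_max r0 gt_min; apply/orP; left; lra.
have cll s t : `|cl s - cl t| <= `|s - t|.
  have n0 := normr_ge0 (s - t); have n1 := ler_norm (s - t).
  have n2 := ler_norm (t - s); rewrite (distrC t s) in n2.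
  rewrite ler_norml /cl; case: (leP h s) => hs; case: (leP h t) => ht;
  case: (leP 0 h) => h1; try case: (leP 0 s) => h2; try case: (leP 0 t) => h3; lra.
have cc : continuous (c \o cl).
  by apply: lipschitz_curve_continuous => s t; rewrite /= cd ?clr// cll.
have dE t : 0 <= t < r -> mdist x (c t) = t.
  by move=> /[dup] /andP[t0 tr] tt; rewrite -c0 cd ?lexx ?r0// sub0r normrN ger0_norm.
exists (ball x h); first by apply: nbhsx_ballx; lra.
move=> U xU Uh Uc; have UP y : U y -> y = c (mdist x y) /\ 0 <= mdist x y < h.
  by move=> /Uh; rewrite ballEmdist /= => yh; rewrite -cx ?mdist_ge0//; lra.
pose J := (mdist x @` U) `\ 0.
have JI : is_interval J.
  have : is_interval (mdist x @` U).
    apply/connected_intervalP/connected_continuous_connected => //.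
    exact/continuous_subspaceT/lipschitz_dist_continuous.
  move=> Ji a b [aU a0] [bU b0] t /= abt; split; first exact: Ji aU bU _ abt.
  move=> t0; have {}a0 : a != 0 by apply/eqP.
  case: aU a0 abt => y _ <- y0; rewrite t0 => /andP[y0' _].
  have := mdist_ge0 x y; move: y0'; rewrite le_eqVlt => /orP[/eqP E|lt0].
    by rewrite E eqxx in y0.
  by rewrite leNgt lt0.
have UE : U `\ x = (c \o cl) @` J.
  apply/seteqP; split => [y [Uy yx]|_ [t [[y Uy <-] t0] <-]] /=.
    have [yE /andP[y0 yh]] := UP _ Uy; exists (mdist x y).
      split; first by exists y.
      by move=> /mdist_positivity xy; apply: yx.
    by rewrite /= clE ?y0 ?ltW.
  have [yE /andP[y0 yh]] := UP _ Uy; rewrite clE ?y0 ?ltW// -yE; split=> // yx.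
  by apply: t0; rewrite yx mdistxx.
have Cc : connected (U `\ x).
  rewrite UE; apply: connected_continuous_connected; first exact/connected_intervalP.
  exact: continuous_subspaceT.
have [y Uy] : exists y, (U `\ x) y.
  have /nbhs_ballP[e /= e0 eU] := xU; pose t := Num.min e h / 2.
  have m0 : 0 < Num.min e h by rewrite lt_min e0 /h divr_gt0.
  have me : Num.min e h <= e by rewrite ge_min lexx.
  have mh : Num.min e h <= h by rewrite ge_min lexx orbT.
  have tE : mdist x (c t) = t by apply: dE; rewrite /t; lra.
  exists (c t); split; first by apply: eU; rewrite ballEmdist /= tE /t; lra.
  move=> ctx; move: tE; rewrite ctx mdistxx /t; lra.
rewrite (_ : components _ = [set U `\ x]); first exact: card_set1.
apply/seteqP; split => [_ [z Uz <-]|_ ->] /=; first exact: connected_component_id.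
by exists y => //; exact: connected_component_id.
Qed.

End EndPoint.

Section DegreeOne.
Variables (R : realType) (X : metricType R) (G : multigraph) (l : length_function R G).

(** The dart at a vertex of degree one is a curve as in [end_point_valency]. *)
Lemma leafless_degree (v : vertex G) : defined_by X l -> leafless X ->
  (forall v : vertex G, exists d, gorg G d == v) -> degree v != 1%N.
Proof.
move=> [h hi] lX dat; apply/negP => /cards1P[d dE].
have [k [ki hK kK]] := isometry_inv hi; have [r r0 rl] := ends_radius l.
have dv : gorg G d = v by apply/eqP; have /setP/(_ d) := dE; rewrite !inE eqxx.
have dP d' : gorg G d' = v -> d' = d.
  by move=> d'v; have /setP/(_ d') := dE; rewrite !inE d'v eqxx => /esym/eqP.
apply: (lX (k (Vertex l v))).
apply: (@end_point_valency _ _ _ r (fun t => k (dart_point l d t))) => //.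
- move=> s t /andP[s0 sr] /andP[t0 tr]; have rd := rl d.1; rewrite ki.2.
  apply/eqP; rewrite eq_le mdist_dart_le/=; try lra.
  have ds : mdist (Vertex l v) (dart_point l d s) = s by rewrite -dv (dist_vertex r0)//; lra.
  have dt : mdist (Vertex l v) (dart_point l d t) = t by rewrite -dv (dist_vertex r0)//; lra.
  have := metric_triangle (Vertex l v) (dart_point l d s) (dart_point l d t).
  have := metric_triangle (Vertex l v) (dart_point l d t) (dart_point l d s).
  rewrite ds dt (metric_sym (dart_point l d t)) => h1 h2.
  by rewrite ler_norml; lra.
- by rewrite dart_point_org dv.
- move=> y; rewrite -(hK y) ki.2 => yr.
  have [d' d'v yE] := near_vertex r0 rl dat yr.
  by rewrite {1}yE (dP d' d'v).
Qed.

End DegreeOne.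

(** * Smoothing a vertex of degree two *)

Lemma closed_setT (G : multigraph) (T : {set vertex G}) : T != finset.set0 ->
  (forall d, gorg G d \in T -> gorg G (rev d) \in T) -> T = [set: vertex G]%SET.
Proof.
move=> /set0Pn[u uT] cT; apply/setP => v; rewrite inE; apply/idP.
have /connectP[p + ->] := vertex_connected u v.
elim: p u uT => //= w p IH u uT /andP[/existsP[e uw] /IH]; apply.
case/orP: uw => /andP[/eqP su /eqP tw].
  by have := cT (e, false); rewrite /org/= su tw; apply.
by have := cT (e, true); rewrite /org/= su tw; apply.
Qed.

Lemma connected_of_closed (V E : finType) (src tgt : E -> V) :
  (forall T : {set V}, T != finset.set0 ->
    (forall d, org src tgt d \in T -> org src tgt (rev d) \in T) -> T = [set: V]%SET) ->
  forall u v, connect (Defs.adjacent src tgt) u v.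
Proof.
move=> cl u v; have /setP/(_ v) : [set w | connect (Defs.adjacent src tgt) u w]%SET = [set: V]%SET.
  apply: cl; first by apply/set0Pn; exists u; rewrite inE.
  move=> [e b]; rewrite !inE => /connect_trans; apply; apply/connect1/existsP; exists e.
  by rewrite /org/=; case: b; rewrite /= !eqxx ?orbT.
by rewrite !inE.
Qed.

Lemma isometry_of_lipschitz (R : realType) (X Y : metricType R) (f : X -> Y) (h : Y -> X) :
  cancel f h -> cancel h f -> (forall x y, mdist (f x) (f y) <= mdist x y) ->
  (forall x y, mdist (h x) (h y) <= mdist x y) -> is_isometry f.
Proof.
move=> fK hK lf lh; split; first by exists h.
by move=> x y; apply/eqP; rewrite eq_le lf/= -{1}(fK x) -{1}(fK y).
Qed.

Section Smoothing.
Variables (R : realType) (G : multigraph) (l : length_function R G).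
Variables (v : vertex G) (a b : gdart G).
Hypothesis av : gorg G a = v.
Hypothesis bv : gorg G b = v.
Hypothesis ab : a.1 != b.1.
Hypothesis only : forall d, gorg G d = v -> d = a \/ d = b.
Notation origin := (gorg G).
Notation pt := (dart_point l).

Let xv : origin (rev a) != v.
Proof.
apply/eqP => /only[/eqP|E]; first by rewrite (negbTE (rev_neq a)).
by move: ab; rewrite -E eqxx.
Qed.

Let yv : origin (rev b) != v.
Proof.
apply/eqP => /only[E|/eqP]; last by rewrite (negbTE (rev_neq b)).
by move: ab; rewrite -E eqxx.
Qed.

Let other d : d.1 != a.1 -> d.1 != b.1 -> origin d != v.
Proof. by move=> da db; apply/eqP => /only[dE|dE]; move: da db; rewrite dE eqxx. Qed.

Notation svertex := {w : vertex G | w != v}.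
Notation sedge := {e : edge G | e != b.1}.
(** The vertex [v] and the edge of [b] are removed, and the edge of [a] is stretched
    from the far end of [a] to the far end of [b]. The default value of [insubd] is
    used for [v] only. *)
Definition to_svertex (w : vertex G) : svertex := insubd (exist (fun w => w != v) (origin (rev a)) xv) w.
Definition ssrc (e : sedge) : svertex := to_svertex (if val e == a.1 then origin (rev a) else src (val e)).
Definition stgt (e : sedge) : svertex := to_svertex (if val e == a.1 then origin (rev b) else tgt (val e)).
Definition joined_edge : sedge := exist (fun e => e != b.1) a.1 ab.

Let to_svertexK w : w != v -> val (to_svertex w) = w.
Proof. by move=> wv; rewrite insubdK. Qed.

Let ssrcE e : val (ssrc e) = if val e == a.1 then origin (rev a) else src (val e).
Proof.
by apply: to_svertexK; case: (eqVneq (val e) a.1) => [_|ea]; [exact: xv|exact: (other (d := (val e, false)) ea (valP e))].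
Qed.

Let stgtE e : val (stgt e) = if val e == a.1 then origin (rev b) else tgt (val e).
Proof.
by apply: to_svertexK; case: (eqVneq (val e) a.1) => [_|ea]; [exact: yv|exact: (other (d := (val e, true)) ea (valP e))].
Qed.

Lemma smoothing_nonempty : (0 < #|{: svertex}|)%N.
Proof. by apply/card_gt0P; exists (to_svertex v). Qed.

Lemma smoothing_connected u w : connect (Defs.adjacent ssrc stgt) u w.
Proof.
apply: connected_of_closed => T T0 cT.
(* v is put on the side of its neighbours, which are joined in the smoothing *)
pose T' := [set z | if z == v then to_svertex (origin (rev a)) \in T else to_svertex z \in T]%SET.
have xy : (to_svertex (origin (rev a)) \in T) = (to_svertex (origin (rev b)) \in T).
  have := cT (joined_edge, false); have := cT (joined_edge, true).
  by rewrite /org/= /ssrc /stgt/= eqxx => h1 h2; apply/idP/idP.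
have T'T : T' = [set: vertex G]%SET.
  apply: closed_setT.
    have /set0Pn[z zT] := T0; apply/set0Pn; exists (val z).
    by rewrite inE (negbTE (valP z)) /to_svertex valKd.
  move=> d; rewrite !inE; have [dv|dv] := eqVneq (origin d) v.
    have [->|->] := only dv; first by rewrite (negbTE xv).
    by rewrite (negbTE yv) -xy.
  have [d'v|d'v] := eqVneq (origin (rev d)) v.
    have [dE|dE] := only d'v; first by rewrite -dE revK.
    by rewrite xy -dE revK.
  have da : d.1 != a.1.
    by apply/eqP => /same_edge[] aE; [have := dv|have := d'v]; rewrite -aE av eqxx.
  have db : d.1 != b.1.
    by apply/eqP => /same_edge[] bE; [have := dv|have := d'v]; rewrite -bE bv eqxx.
  pose d' : dart sedge := (exist (fun e => e != b.1) d.1 db, d.2).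
  have := cT d'; rewrite /org /ssrc /stgt /rev/= (negbTE da).
  by case: (d.2).
apply/setP => z; have /setP/(_ (val z)) := T'T.
by rewrite !inE (negbTE (valP z)) /to_svertex valKd.
Qed.

Definition smoothing : multigraph := Multigraph smoothing_nonempty smoothing_connected.

Lemma card_svertex : #|vertex smoothing|.+1 = #|vertex G|.
Proof.
have -> : #|vertex smoothing| = #|vertex G|.-1 by rewrite card_sig -(cardC1 v); apply: eq_card.
by rewrite prednK//; apply/card_gt0P; exists v.
Qed.

Lemma card_sedge : #|edge smoothing|.+1 = #|edge G|.
Proof.
have -> : #|edge smoothing| = #|edge G|.-1 by rewrite card_sig -(cardC1 b.1); apply: eq_card.
by rewrite prednK//; apply/card_gt0P; exists b.1.
Qed.

Lemma smoothing_genus : genus smoothing = genus G.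
Proof. by have := genusE smoothing; have := genusE G; have := card_svertex; have := card_sedge; lia. Qed.

Definition slen_of (e : edge smoothing) := if val e == a.1 then l a.1 + l b.1 else l (val e).

Lemma slen_gt0 e : 0 < slen_of e.
Proof. by rewrite /slen_of; case: ifP => _; rewrite ?addr_gt0 ?length_gt0. Qed.

Definition slen : length_function R smoothing := LengthFunction slen_gt0.

(** The two edges at [v], traversed from the far end of [a] to that of [b]. *)
Definition joined (t : R) := if t <= l a.1 then pt (rev a) t else pt b (t - l a.1).

Definition unsmooth (x : metric_graph slen) : metric_graph l := match x with
  | Vertex w => Vertex l (val w)
  | Interior e s => if val e == a.1 then joined (sval s) else edge_point l (val e) (sval s)
  end.

Let spt := edge_point slen.

Definition smooth (x : metric_graph l) : metric_graph slen := match x with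
  | Vertex w => if w == v then spt joined_edge (l a.1) else Vertex slen (to_svertex w : vertex smoothing)
  | Interior e s =>
    if e == a.1 then spt joined_edge (if a.2 then sval s else l a.1 - sval s)
    else if e == b.1 then spt joined_edge (l a.1 + (if b.2 then l b.1 - sval s else sval s))
    else spt (insubd joined_edge e) (sval s)
  end.

Lemma edge_dart_point (d : gdart G) t : edge_point l d.1 t = pt d (if d.2 then l d.1 - t else t).
Proof. by rewrite /dart_point; case: (d.2) => //; rewrite subKr. Qed.

Lemma joined_right t : l a.1 <= t -> joined t = pt b (t - l a.1).
Proof.
move=> at_; rewrite /joined; case: leP => // ta; have -> : t = l a.1 by lra.
by rewrite subrr dart_point_org bv -[l a.1]/(l (rev a).1) dart_point_end revK av.
Qed.

Lemma unsmoothE e t : 0 <= t <= slen e ->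
  unsmooth (spt e t) = if val e == a.1 then joined t else edge_point l (val e) t.
Proof.
have la := length_gt0 l a.1; have lb := length_gt0 l b.1.
rewrite /spt => te; have [[-> ->]|[-> ->]|[s [-> ->]]] := edge_pointP te => //=.
  rewrite ssrcE; case: ifP => _; last by rewrite edge_point_src.
  by rewrite /joined ltW// dart_point_org.
rewrite stgtE /slen_of; case: ifP => _; last by rewrite edge_point_tgt.
by rewrite joined_right ?lerDl ?ltW// addrC addKr dart_point_end.
Qed.

Lemma smooth_vertex w : w != v -> smooth (Vertex l w) = Vertex slen (to_svertex w : vertex smoothing).
Proof. by rewrite /= => /negbTE ->. Qed.

Lemma smooth_a t : 0 <= t <= l a.1 -> smooth (pt (rev a) t) = spt joined_edge t.
Proof.
have la := length_gt0 l a.1; have lb := length_gt0 l b.1.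
move=> ta; have [->|t0] := eqVneq t 0.
  rewrite dart_point_org smooth_vertex// /spt edge_point_src; congr Vertex.
  by apply: val_inj; rewrite to_svertexK// ssrcE eqxx.
have [->|tl] := eqVneq t (l a.1).
  by rewrite -[in LHS](_ : l (rev a).1 = l a.1)// dart_point_end revK av /= eqxx.
pose u := if (rev a).2 then l a.1 - t else t.
have u0 : 0 < u < l a.1.
  have : 0 < t < l a.1 by rewrite !lt_neqAle eq_sym t0 tl.
  by rewrite /u; case: ifP => _; lra.
have -> : pt (rev a) t = @Interior _ _ l a.1 (exist _ u u0) by rewrite -edge_point_int.
rewrite /= eqxx /u /=; case: (a.2) => //=.
by rewrite subKr.
Qed.

Lemma smooth_b t : 0 <= t <= l b.1 -> smooth (pt b t) = spt joined_edge (l a.1 + t).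
Proof.
have la := length_gt0 l a.1; have lb := length_gt0 l b.1.
move=> tb; have [->|t0] := eqVneq t 0.
  by rewrite dart_point_org bv /= eqxx addr0.
have [->|tl] := eqVneq t (l b.1).
  rewrite dart_point_end smooth_vertex//.
  have -> : l a.1 + l b.1 = slen joined_edge by rewrite /= /slen_of eqxx.
  by rewrite /spt edge_point_tgt; congr Vertex; apply: val_inj; rewrite to_svertexK// stgtE eqxx.
pose u := if b.2 then l b.1 - t else t.
have u0 : 0 < u < l b.1.
  have : 0 < t < l b.1 by rewrite !lt_neqAle eq_sym t0 tl.
  by rewrite /u; case: ifP => _; lra.
have -> : pt b t = @Interior _ _ l b.1 (exist _ u u0) by rewrite -edge_point_int.
rewrite /= eq_sym (negbTE ab) eqxx /u /=; case: (b.2) => //=.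
by rewrite subKr.
Qed.

Lemma smooth_other e t : e != a.1 -> e != b.1 -> 0 <= t <= l e ->
  smooth (edge_point l e t) = spt (insubd joined_edge e) t.
Proof.
move=> ea eb te; have vE : val (insubd joined_edge e) = e by rewrite insubdK.
have [[-> ->]|[-> ->]|[s [-> ->]]] := edge_pointP te.
- rewrite smooth_vertex; last exact: (other (d := (e, false)) ea eb).
  rewrite /spt edge_point_src; congr Vertex; apply: val_inj.
  by rewrite to_svertexK ?ssrcE ?vE ?(negbTE ea)//; exact: (other (d := (e, false)) ea eb).
- rewrite smooth_vertex; last exact: (other (d := (e, true)) ea eb).
  have -> : l e = slen (insubd joined_edge e) by rewrite /= /slen_of vE (negbTE ea).
  rewrite /spt edge_point_tgt; congr Vertex; apply: val_inj.
  by rewrite to_svertexK ?stgtE ?vE ?(negbTE ea)//; exact: (other (d := (e, true)) ea eb).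
- by rewrite /= (negbTE ea) (negbTE eb).
Qed.

Lemma smoothK : cancel smooth unsmooth.
Proof.
have la := length_gt0 l a.1; have lb := length_gt0 l b.1.
have saE : slen joined_edge = l a.1 + l b.1 by rewrite /= /slen_of eqxx.
have jl t : 0 <= t <= l a.1 -> unsmooth (smooth (pt (rev a) t)) = pt (rev a) t.
  move=> ta; rewrite smooth_a// unsmoothE ?saE; last lra.
  by rewrite eqxx /joined; case/andP: ta => _ ->.
have jr t : 0 <= t <= l b.1 -> unsmooth (smooth (pt b t)) = pt b t.
  move=> tb; rewrite smooth_b// unsmoothE ?saE; last lra.
  by rewrite eqxx joined_right ?addKr//; [rewrite addrC addKr|lra].
case=> [w|e s].
  have [->|wv] := eqVneq w v; first by rewrite -bv -dart_point_org jr//; lra.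
  by rewrite smooth_vertex//= to_svertexK.
have /andP[] := svalP s; rewrite -edge_point_int; move: (sval s) => {}s s0 sl.
have [ea|ea] := eqVneq e a.1.
  by rewrite ea in s0 sl *; rewrite -[a.1]/(rev a).1 edge_dart_point jl//; case: ifP => _ /=; lra.
have [eb|eb] := eqVneq e b.1.
  by rewrite eb in s0 sl *; rewrite edge_dart_point jr//; case: ifP => _; lra.
have vE : val (insubd joined_edge e) = e by rewrite insubdK.
rewrite smooth_other// ?ltW// unsmoothE ?vE ?(negbTE ea)//.
by rewrite /= /slen_of vE (negbTE ea) !ltW.
Qed.

Lemma unsmoothK : cancel unsmooth smooth.
Proof.
have la := length_gt0 l a.1; have lb := length_gt0 l b.1.
case=> [w|e s].
  by rewrite /= (negbTE (valP w)) /to_svertex valKd.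
have /andP[] := svalP s; rewrite -edge_point_int; move: (sval s) => {}s s0 sl.
rewrite -/(spt e s) unsmoothE ?ltW//; move: sl; rewrite /= /slen_of; case: (eqVneq (val e) a.1) => ea sl.
  have -> : e = joined_edge by exact: val_inj.
  rewrite /joined; case: leP => sa'; first by rewrite smooth_a// ltW.
  by rewrite smooth_b; [rewrite addrC subrK|lra].
by rewrite smooth_other ?valKd// ?(valP e)// !ltW.
Qed.

Lemma unsmooth_lipschitz x y : mdist (unsmooth x) (unsmooth y) <= mdist x y.
Proof.
apply: lipschitz_of_edges => {x y} e s t sl tl; rewrite !unsmoothE//.
move: sl tl; rewrite /= /slen_of; case: eqP => _ sl tl; last exact: mdist_edge_le.
wlog st : s t sl tl / s <= t.
  move=> W; have [st|ts] := leP s t; first exact: W.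
  by rewrite metric_sym distrC; apply: W => //; exact: ltW.
have dist : `|s - t| = t - s by rewrite distrC ger0_norm// subr_ge0.
have [ta|ta] := leP t (l a.1).
  by rewrite /joined ta (le_trans st ta) mdist_dart_le//=; lra.
have [sa'|sa'] := leP s (l a.1); last first.
  rewrite (joined_right (ltW sa')) (joined_right (ltW ta)).
  rewrite (le_trans (mdist_dart_le _ _))//; try lra.
  by rewrite dist ler0_norm; lra.
rewrite (le_trans (metric_triangle _ (joined (l a.1)) _))//.
have h1 : mdist (joined s) (joined (l a.1)) <= `|s - l a.1|.
  by rewrite /joined sa' lexx mdist_dart_le//=; lra.
have h2 : mdist (joined (l a.1)) (joined t) <= `|l a.1 - l a.1 - (t - l a.1)|.
  by rewrite (joined_right (lexx _)) (joined_right (ltW ta)) mdist_dart_le//; lra.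
move: h1 h2; rewrite dist subrr sub0r opprB !ler0_norm; lra.
Qed.

Lemma smooth_lipschitz x y : mdist (smooth x) (smooth y) <= mdist x y.
Proof.
have la := length_gt0 l a.1; have lb := length_gt0 l b.1.
have saE : slen joined_edge = l a.1 + l b.1 by rewrite /= /slen_of eqxx.
apply: lipschitz_of_edges => {x y} e s t sl tl.
have [ea|ea] := eqVneq e a.1.
  rewrite ea in sl tl *; rewrite -[a.1]/(rev a).1 !edge_dart_point/= !smooth_a; try by case: ifP => _; lra.
  rewrite (le_trans (mdist_edge_le _ _))// ?saE; try by case: ifP => _; lra.
  case: ifP => _ //; have -> : l a.1 - s - (l a.1 - t) = t - s by lra.
  by rewrite distrC.
have [eb|eb] := eqVneq e b.1.
  rewrite eb in sl tl *; rewrite !edge_dart_point/= !smooth_b; try by case: ifP => _; lra.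
  rewrite (le_trans (mdist_edge_le _ _))// ?saE; try by case: ifP => _; lra.
  case: ifP => _; last by have -> : l a.1 + s - (l a.1 + t) = s - t by lra.
  have -> : l a.1 + (l b.1 - s) - (l a.1 + (l b.1 - t)) = t - s by lra.
  by rewrite distrC.
have vE : val (insubd joined_edge e) = e by rewrite insubdK.
by rewrite !smooth_other// mdist_edge_le//= /slen_of vE (negbTE ea).
Qed.

Lemma smooth_isometry : is_isometry smooth.
Proof.
exact: isometry_of_lipschitz smoothK unsmoothK smooth_lipschitz unsmooth_lipschitz.
Qed.

End Smoothing.

(** * The stable model and the theorem *)

Lemma one_vertex_degree (G : multigraph) (v : vertex G) :
  (forall d, gorg G d = v -> gorg G (rev d) = v) -> degree v = #|edge G|.*2.
Proof.
move=> cv; have V1 : [set v]%SET = [set: vertex G]%SET.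
  apply: closed_setT; first by apply/set0Pn; exists v; rewrite inE.
  by move=> d; rewrite !inE => /eqP/cv ->.
rewrite /degree -muln2 -card_bool -card_prod -cardsT; apply: eq_card => d.
by rewrite !inE; have /setP/(_ (gorg G d)) := V1; rewrite !inE.
Qed.

(** Vertices of degree two are smoothed one by one. The degree is never one in a
    model of a leafless graph, whatever the model; it is zero, or two with a loop,
    only if the graph has a single vertex and genus at most one. *)
Lemma stable_model (R : realType) (X : metricType R) (G : multigraph) (l : length_function R G) :
  defined_by X l -> leafless X -> (2 <= genus G)%N ->
  exists (G' : multigraph) (l' : length_function R G'),
    [/\ stable G', genus G' = genus G & defined_by X l'].
Proof.
move: {2}#|vertex G| (leqnn #|vertex G|) => n.
elim: n G l => [|n IH] G l Vn XG lX g2.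
  by move: Vn; rewrite leqNgt vertex_nonempty.
have gE := genusE G.
have dat v : exists d, gorg G d == v.
  have [/existsP//|nd] := boolP [exists d, gorg G d == v].
  exfalso; have nd' d : gorg G d <> v.
    by move=> dv; move/existsPn/(_ d): nd; rewrite dv eqxx.
  have dE : degree v = #|edge G|.*2 by apply: one_vertex_degree => d /nd'.
  have d0 : degree v = 0%N.
    by apply/eqP; rewrite cards_eq0; apply/eqP/setP => d; rewrite !inE; apply/eqP/nd'.
  have := vertex_nonempty G; lia.
have [/forallP stG|/forallPn[v]] := boolP [forall v : vertex G, (3 <= degree v)%N].
  by exists G, l.
rewrite -ltnNge => v3.
have v1 := leafless_degree v XG lX dat.
have v0 : (0 < degree v)%N.
  by have [d dv] := dat v; apply/card_gt0P; exists d; rewrite inE.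
have /eqP/cards2P[a [b [nab dE]]] : degree v = 2 by lia.
have dP d : (gorg G d == v) = (d == a) || (d == b).
  by have /setP/(_ d) := dE; rewrite !inE.
have av : gorg G a = v by apply/eqP; rewrite dP eqxx.
have bv : gorg G b = v by apply/eqP; rewrite dP eqxx orbT.
have only d : gorg G d = v -> d = a \/ d = b.
  by move/eqP; rewrite dP => /orP[]/eqP; [left|right].
have ab : a.1 != b.1.
  apply/eqP => /same_edge[E|bE]; first by rewrite E eqxx in nab.
  have vE : degree v = #|edge G|.*2.
    by apply: one_vertex_degree => d /only[]->; rewrite ?bE ?revK// -bE.
  have := vertex_nonempty G; lia.
have gE' := smoothing_genus av bv ab only.
have [||||G' [l' [st' g' X']]] := IH _ (slen l av bv ab only).
- by have := card_svertex av bv ab only; lia.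
- have [h hi] := XG; exists (smooth (l := l) av bv ab only \o h).
  exact: isometry_comp hi (smooth_isometry _ _ _ _ _).
- by [].
- by rewrite gE'.
- by exists G', l'; rewrite g' gE'.
Qed.

Theorem theorem1 (R : realType) (Gamma : metricType R)
    (G : multigraph) (l : length_function R G) (g : nat) :
  defined_by Gamma l -> leafless Gamma -> genus G = g -> (2 <= g)%N ->
  Aut Gamma #<= `I_(aut_bound g) /\
  (Aut Gamma #= `I_(aut_bound g) <->
   [\/ [/\ (g = 2 \/ g = 3)%N &
         exists2 l' : length_function R (banana g),
           (exists c, range l' = [set c]) & defined_by Gamma l'],
       (3 <= g)%N /\
         (exists2 l' : length_function R (bouquet g),
           (exists c, range l' = [set c]) & defined_by Gamma l')
     | (3 <= g)%N /\
         (exists2 l' : length_function R (lollipop g),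
           (forall i j : 'I_g, l' (inl i) = l' (inl j)) /\
           (forall i j : 'I_g, l' (inr i) = l' (inr j))
           & defined_by Gamma l')]).
Proof.
move=> GG lG gE g2; rewrite -gE in g2.
have [G1 [l1 [st g1 G1G]]] := stable_model GG lG g2; rewrite gE in g1 g2.
have gen : (#|edge G1|.+1 = g + #|vertex G1|)%N by rewrite -g1 genusE addn1.
have card_model (G' : multigraph) (l' : length_function R G') : stable G' ->
    defined_by Gamma l' -> Aut Gamma #= `I_#|dart_auts l'|.
  by move=> st' [h hi]; apply: card_eq_trans (Aut_isometric hi) (card_Aut l' st').
have cA := card_model _ _ st G1G; set A := dart_auts l1 in cA.
have Arev := @dart_auts_rev _ _ l1; have Aorg := @dart_auts_org _ _ l1.
have conn := @closed_setT G1.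
have le : (#|A| <= aut_bound g)%N := order_bound Arev Aorg conn st gen g2.
split; first by rewrite (card_le_eql cA) card_le_II.
have cE n : Aut Gamma #= `I_n <-> #|A| = n.
  by rewrite (card_eql cA); split=> [/card_eq_II|->].
have ge (G' : multigraph) (l' : length_function R G') : stable G' -> defined_by Gamma l' ->
    (aut_bound g <= #|dart_auts l'|)%N -> #|A| = aut_bound g.
  move=> st' G'G ge; apply/eqP; rewrite eqn_leq le; apply: leq_trans ge _.
  by have /cE -> := card_model _ _ st' G'G.
rewrite cE; split=> [full|]; last first.
  case=> [[g23 [l' c' G'G]]|[g3 [l' c' G'G]]|[g3 [l' [cl cr] G'G]]].
  - apply: ge G'G _; first exact: stable_banana.
    by apply: leq_trans (card_banana_auts c'); case: g23 => ->.
  - apply: ge G'G _; first exact: stable_bouquet.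
    by apply: leq_trans (card_bouquet_auts c'); rewrite /aut_bound g3.
  - apply: ge G'G _; first exact: stable_lollipop.
    by apply: leq_trans (card_lollipop_auts cl cr); rewrite /aut_bound g3.
have [/eqP loopless|nl] := boolP (loops (@src G1) (@tgt G1) == finset.set0).
  have [g23 V2 tr] := loopless_extremal Arev Aorg conn st gen g2 full loopless.
  by apply: Or31; split=> //; exact: recognise_banana tr.
have [leL eqL] := order_loops Arev Aorg conn st gen g2 nl.
have g3 : (3 <= g)%N.
  rewrite leqNgt; apply/negP => g3; have g2' : g = 2 by lia.
  by move: leL; rewrite -/A full g2'.
have [|cL fullL] := eqL g3; first by rewrite -/A full /aut_bound g3.
have [[V1 tr]|inj] := bouquet_or_injective Arev Aorg st gen g3 cL fullL.
  by apply: Or32; split=> //; exact: recognise_bouquet tr.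
have [p [np Vp bP trL trB]] := lollipop_structure Arev Aorg st gen g3 cL fullL inj.
by apply: Or33; split=> //; exact: (recognise_lollipop G1G _ _ _ _ inj np Vp bP trL trB).
Qed.
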